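(* Let $(M,F)$ be a compact boundaryless Einstein Randers manifold of dimension $n\ge2$ with constant Ricci scalar, and let $p$ be the projective parameter of $(M,F)$. (1) If $S(p)=0$ (along all geodesics), then $(M,F)$ is Berwaldian. (2) If $S(p)<0$ (along all geodesics), then $(M,F)$ is Riemannian.
   Context: $M$ is a connected smooth $n$-manifold. A Finsler structure is $F:TM\to[0,\infty)$, smooth on the bundle $TM_0$ of nonzero tangent vectors, with $F(x,\lambda y)=\lambda F(x,y)$ for $\lambda>0$ and $g_{ij}=\frac12\frac{\partial^2F^2}{\partial y^i\partial y^j}$ positive definite on $TM_0$. A Randers metric is a Finsler structure of the form $F=\alpha+\beta$, with $\alpha=\sqrt{a_{ij}(x)y^iy^j}$ a Riemannian metric and $\beta=b_i(x)y^i$ a 1-form. Let $G^i=\frac14 g^{il}\{[F^2]_{x^ky^l}y^k-[F^2]_{x^l}\}$; geodesics parameterized by arc length $s$ satisfy $\frac{d^2x^i}{ds^2}+2G^i(x,\frac{dx}{ds})=0$. $F$ is Berwaldian if the Berwald coefficients $\frac{\partial^2G^i}{\partial y^j\partial y^k}$ do not depend on $y$; it is Riemannian if $g_{ij}$ does not depend on $y$. The Ricci scalar $Ric(x,y)$ is the trace of the Riemann curvature, normalized to be homogeneous of degree $0$ in $y$ (the sum of $n-1$ flag curvatures with flagpole $y$), and the Ricci tensor is $Ric_{ij}=\frac12(F^2Ric)_{y^iy^j}$, so that $Ric_{ij}y^iy^j=F^2Ric$. $F$ is Einstein if $Ric=(n-1)K(x)$ for a function $K$ on $M$; constant Ricci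 scalar means that $K$ is constant. For a real function $p(s)$ with $p'\ne0$, the Schwarzian derivative is $S(p)=\frac{p'''}{p'}-\frac32\big(\frac{p''}{p'}\big)^2$. A projective parameter along a geodesic $x(s)$ (with $s$ the arc length) is a solution $p(s)$, unique up to linear fractional transformations, of $$S(p(s))=\frac{2}{n-1}Ric_{jk}\frac{dx^j}{ds}\frac{dx^k}{ds}.$$ *)

(* Defs.v *)
From HB Require Import structures.
From mathcomp Require Import all_boot all_order all_algebra.
From mathcomp Require Import all_classical all_reals all_analysis.

Set Implicit Arguments.
Unset Strict Implicit.
Unset Printing Implicit Defensive.

Import Order.TTheory GRing.Theory Num.Theory.
Import numFieldNormedType.Exports.

Local Open Scope classical_set_scope.
Local Open Scope ring_scope.

(* C^oo on U: every iterated directional derivative of f is (Frechet)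
   differentiable, hence continuous, at every point of U. *)
Definition smooth_on (R : realType) (V W : normedModType R) (U : set V)
    (f : V -> W) : Prop :=
  forall (s : seq V) (x : V), U x ->
    differentiable (foldr (fun v (h : V -> W) => 'D_v h) f s) x.

(* [chart_map] and [chart_inv] are total functions; only their values on
   [chart_dom] and on its image are meaningful. *)
Record chart (R : realType) (n : nat) (M : topologicalType) := Chart {
  chart_dom : set M;
  chart_map : M -> 'rV[R]_n;
  chart_inv : 'rV[R]_n -> M;
  chart_dom_open : open chart_dom;
  chart_cod_open : open (chart_map @` chart_dom);
  chart_mapK : forall p, chart_dom p -> chart_inv (chart_map p) = p;
  chart_map_cont : forall p, chart_dom p -> {for p, continuous chart_map};
  chart_inv_cont :
    forall p, chart_dom p -> {for chart_map p, continuous chart_inv}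
}.

Definition chart_cod (R : realType) (n : nat) (M : topologicalType)
  (c : chart R n M) : set 'rV[R]_n := chart_map c @` chart_dom c.

Definition transition (R : realType) (n : nat) (M : topologicalType)
  (c d : chart R n M) : 'rV[R]_n -> 'rV[R]_n := chart_map d \o chart_inv c.

Record smooth_atlas (R : realType) (n : nat) (M : topologicalType) := Atlas {
  atlas_index : Type;
  atlas_chart :> atlas_index -> chart R n M;
  atlas_cover : forall p, exists c, chart_dom (atlas_chart c) p;
  atlas_smooth : forall c d,
    smooth_on (chart_map (atlas_chart c) @`
                 (chart_dom (atlas_chart c) `&` chart_dom (atlas_chart d)))
              (transition (atlas_chart c) (atlas_chart d))
}.

(* An element of TM: a base point and one component vector for each chart
   around it, the components being related by the Jacobians of the chart
   transitions.  The value 0 at the other charts makes the representation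
   unique. *)
Record tangent_vector (R : realType) (n : nat) (M : topologicalType)
    (A : smooth_atlas R n M) := TangentVector {
  base_point : M;
  component : atlas_index A -> 'rV[R]_n;
  component_out : forall c, ~ chart_dom (A c) base_point -> component c = 0;
  component_change : forall c d,
    chart_dom (A c) base_point -> chart_dom (A d) base_point ->
    component d =
      'D_(component c) (transition (A c) (A d)) (chart_map (A c) base_point)
}.

Section Coordinates.
Variables (R : realType) (n : nat) (M : topologicalType).
Variable (A : smooth_atlas R n M).

Definition coord_component (c : atlas_index A) (p : M) (y : 'rV[R]_n)
    (d : atlas_index A) : 'rV[R]_n :=
  if `[< chart_dom (A c) p /\ chart_dom (A d) p >]
  then 'D_y (transition (A c) (A d)) (chart_map (A c) p) else 0.

Fact coord_component_out c p y d :
  ~ chart_dom (A d) p -> coord_component c p y d = 0.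
Proof. by move=> nd; rewrite /coord_component; case: asboolP => // -[]. Qed.

Fact coord_component_change c p y d e :
  chart_dom (A d) p -> chart_dom (A e) p ->
  coord_component c p y e =
  'D_(coord_component c p y d) (transition (A d) (A e)) (chart_map (A d) p).
Proof.
move=> pd pe; rewrite /coord_component.
case: (asboolP (chart_dom (A c) p /\ _)) => [[pc _]|nce]; last first.
  case: asboolP => [[pc _]|_]; first by case: nce.
  by rewrite derive0.
case: asboolP => [_|[]//].
have dcd : differentiable (transition (A c) (A d)) (chart_map (A c) p).
  by apply: (@atlas_smooth _ _ _ A c d [::]); exists p.
have tp : transition (A c) (A d) (chart_map (A c) p) = chart_map (A d) p.
  by rewrite /transition /= chart_mapK.
have dde : differentiable (transition (A d) (A e))
             (transition (A c) (A d) (chart_map (A c) p)).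
  by rewrite tp; apply: (@atlas_smooth _ _ _ A d e [::]); exists p.
rewrite -tp.
transitivity ('D_y (transition (A d) (A e) \o transition (A c) (A d))
                (chart_map (A c) p)).
  apply: near_eq_derive.
  have Ud : nbhs (chart_inv (A c) (chart_map (A c) p)) (chart_dom (A d)).
    rewrite chart_mapK//; apply: open_nbhs_nbhs; split => //.
    exact: chart_dom_open.
  have : nbhs (chart_map (A c) p) (chart_inv (A c) @^-1` chart_dom (A d)).
    exact: (chart_inv_cont pc Ud).
  by apply: filterS => x xd; rewrite /transition /= chart_mapK.
rewrite deriveE; last exact: (differentiable_comp dcd dde).
by rewrite (diff_comp dcd dde) /= -!deriveE.
Qed.

(* The tangent vector with coordinates (x, y) in the chart c, that is,
   y^i d/dx^i at the point of coordinates x. *)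
Definition coord_vector (c : atlas_index A) (x y : 'rV[R]_n) :
    tangent_vector A :=
  TangentVector (@coord_component_out c (chart_inv (A c) x) y)
                (@coord_component_change c (chart_inv (A c) x) y).

(* F(x, y) in the coordinates of the chart c. *)
Definition in_chart (F : tangent_vector A -> R) (c : atlas_index A)
  (z : 'rV[R]_n * 'rV[R]_n) : R := F (coord_vector c z.1 z.2).

End Coordinates.

Section LocalFormulas.
Variables (R : realType) (n : nat).

Definition dx (k : 'I_n) : 'rV[R]_n * 'rV[R]_n := (delta_mx 0 k, 0).
Definition dy (k : 'I_n) : 'rV[R]_n * 'rV[R]_n := (0, delta_mx 0 k).

(* In this section L is the coordinate expression of F in some chart. *)
Variable L : 'rV[R]_n * 'rV[R]_n -> R.
Implicit Types (z : 'rV[R]_n * 'rV[R]_n) (i j k : 'I_n).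

Definition sqF z : R := L z ^+ 2.

Definition fundamental_tensor z : 'M[R]_n :=
  \matrix_(i, j) (2^-1 * 'D_(dy i) ('D_(dy j) sqF) z).

Definition spray i z : R :=
  4^-1 * \sum_(l < n) invmx (fundamental_tensor z) i l *
    (\sum_(k < n) 'D_(dy l) ('D_(dx k) sqF) z * z.2 0 k - 'D_(dx l) sqF z).

Definition berwald_coef i j k z : R := 'D_(dy k) ('D_(dy j) (spray i)) z.

(* Riemann curvature, not divided by F^2:
   R^i_k = 2 (G^i)_{x^k} - y^j (G^i)_{x^j y^k} + 2 G^j (G^i)_{y^j y^k}
           - (G^i)_{y^j} (G^j)_{y^k}. *)
Definition riemann_curvature i k z : R :=
  2 * 'D_(dx k) (spray i) z
  - \sum_(j < n) z.2 0 j * 'D_(dx j) ('D_(dy k) (spray i)) z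
  + 2 * \sum_(j < n) spray j z * 'D_(dy j) ('D_(dy k) (spray i)) z
  - \sum_(j < n) 'D_(dy j) (spray i) z * 'D_(dy k) (spray j) z.

Definition ricci_scalar z : R :=
  (\sum_(i < n) riemann_curvature i i z) / sqF z.

Definition ricci_tensor i j z : R :=
  2^-1 * 'D_(dy i) ('D_(dy j) (fun w => sqF w * ricci_scalar w)) z.

End LocalFormulas.

Section Finsler.
Variables (R : realType) (n : nat) (M : topologicalType).
Variable (A : smooth_atlas R n M).
Implicit Types (F : tangent_vector A -> R) (c : atlas_index A).

Definition positive_definite (m : nat) (g : 'M[R]_m) : Prop :=
  forall v : 'rV[R]_m, v != 0 ->
    0 < \sum_(i < m) \sum_(j < m) g i j * v 0 i * v 0 j.

Definition slit_cod c : set ('rV[R]_n * 'rV[R]_n) :=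
  [set z | chart_cod (A c) z.1 /\ z.2 != 0].

Definition finsler_structure F : Prop :=
  [/\ forall v, 0 <= F v,
      forall c, smooth_on (slit_cod c) (in_chart F c),
      forall c x y (l : R), chart_cod (A c) x -> 0 < l ->
        in_chart F c (x, l *: y) = l * in_chart F c (x, y)
    & forall c z, slit_cod c z ->
        positive_definite (fundamental_tensor (in_chart F c) z)].

(* alpha is the norm of a Riemannian metric a. *)
Definition riemannian_norm (alpha : tangent_vector A -> R) : Prop :=
  forall c, exists a : 'rV[R]_n -> 'M[R]_n,
    [/\ smooth_on (chart_cod (A c)) a,
        forall x, chart_cod (A c) x -> (a x)^T = a x /\ positive_definite (a x)
      & forall x y, chart_cod (A c) x -> in_chart alpha c (x, y) =
          Num.sqrt (\sum_(i < n) \sum_(j < n) a x i j * y 0 i * y 0 j)].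

Definition one_form (beta : tangent_vector A -> R) : Prop :=
  forall c, exists2 b : 'rV[R]_n -> 'rV[R]_n,
    smooth_on (chart_cod (A c)) b &
    forall x y, chart_cod (A c) x ->
      in_chart beta c (x, y) = \sum_(i < n) b x 0 i * y 0 i.

Definition randers_metric F : Prop :=
  finsler_structure F /\
  exists alpha beta, [/\ riemannian_norm alpha, one_form beta
                       & forall v, F v = alpha v + beta v].

Definition einstein F (K : M -> R) : Prop :=
  forall c z, slit_cod c z ->
    ricci_scalar (in_chart F c) z = (n%:R - 1) * K (chart_inv (A c) z.1).

Definition berwaldian F : Prop :=
  forall c x y y' i j k, slit_cod c (x, y) -> slit_cod c (x, y') ->
    berwald_coef (in_chart F c) i j k (x, y) =
    berwald_coef (in_chart F c) i j k (x, y').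

Definition riemannian F : Prop :=
  forall c x y y', slit_cod c (x, y) -> slit_cod c (x, y') ->
    fundamental_tensor (in_chart F c) (x, y) =
    fundamental_tensor (in_chart F c) (x, y').

(* g restricted to the open interval J is a geodesic parameterized by arc
   length; its values outside J are irrelevant. *)
Definition arclength_geodesic F (J : set R) (g : R -> M) : Prop :=
  [/\ open J, is_interval J
    & forall s, J s -> {for s, continuous g} /\
      forall c, chart_dom (A c) (g s) ->
        let u : R -> 'rV[R]_n := chart_map (A c) \o g in
        [/\ derivable u s 1, derivable (derive1 u) s 1,
            in_chart F c (u s, derive1 u s) = 1
          & forall i, derive1n 2 u s 0 i +
                      2 * spray (in_chart F c) i (u s, derive1 u s) = 0]].

Definition schwarzian (p : R -> R) (s : R) : R :=
  derive1n 3 p s / derive1 p s - 3 / 2 * (derive1n 2 p s / derive1 p s) ^+ 2.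

Definition projective_parameter F (J : set R) (g : R -> M) (p : R -> R) :
    Prop :=
  forall s, J s ->
    [/\ forall m : nat, (m < 3)%N -> derivable (derive1n m p) s 1,
        derive1 p s != 0
      & forall c, chart_dom (A c) (g s) ->
          let u : R -> 'rV[R]_n := chart_map (A c) \o g in
          schwarzian p s = 2 / (n%:R - 1) *
            \sum_(j < n) \sum_(k < n)
              ricci_tensor (in_chart F c) j k (u s, derive1 u s) *
              derive1 u s 0 j * derive1 u s 0 k].

(* Projective parameters may only exist locally (they can have poles), so
   all open pieces of all geodesics are considered. *)
Definition schwarzian_along_geodesics F (P : R -> Prop) : Prop :=
  forall (J : set R) (g : R -> M) (p : R -> R),
    arclength_geodesic F J g -> projective_parameter F J g p ->
    forall s, J s -> P (schwarzian p s).

End Finsler.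

(* Main.v *)
Require Import Defs.
From mathcomp Require Import all_boot all_order all_algebra.
From mathcomp Require Import all_classical all_reals all_analysis.
From mathcomp Require Import ring lra.

(* Along unit-speed geodesics the right-hand side of the Schwarzian equation is the
   constant 2K, since Ric_jk y^j y^k = (n-1) K F^2.  As unit-speed geodesics exist
   locally and p = tan (sqrt K s) (or p = s if K = 0) is a projective parameter when
   K >= 0, S(p) = 0 forces K <= 0 and S(p) < 0 forces K < 0.

   Let F = alpha + beta, let b be the 1-form and u = |b|^2 for the Riemannian metric.
   With e = r_00 + 2 beta s_0, the part of the Einstein equation that is odd in y shows
   that alpha^2 - beta^2 divides e^2 as a polynomial on suitable lines; being irreducible
   there, it divides e, i.e. e = 2 c (alpha^2 - beta^2) with c = c(x) wherever b <> 0.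
   Feeding this back and taking a divergence gives, for K <= 0, an elliptic inequality
   a^{jk} u_{jk} >= V . grad u near every point with u > 0, so Hopf's strong maximum
   principle and the connectedness of the compact M make u constant.  Then c = 0, b is
   parallel and K u = 0: the spray of F is that of alpha, and b = 0 if K < 0. *)

Set Implicit Arguments.
Unset Strict Implicit.
Unset Printing Implicit Defensive.

Import Order.TTheory GRing.Theory Num.Theory.
Import numFieldNormedType.Exports.

Local Open Scope classical_set_scope.
Local Open Scope ring_scope.

(** * Directional derivatives and functions of class C^k *)

(** Why the odd part: the spray of F contains [alpha], a square root. Once the equations at y and -y
    are subtracted and the result is divided by [alpha], only alpha^2 is left. The identity is then
    polynomial in y, and e^2 beta is its only term that is not visibly a multiple of alpha^2 -
    beta^2. Contracting e = 2 c (alpha^2 - beta^2) with b^# expresses c and s_j through b, u and du.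
    The divergence of s_j is therefore of second order in u, while the odd equation at y = b^# also
    computes it. Besides first-order terms there remains |curl b|^2 - (n-1) K u, and K <= 0 makes
    both summands non-negative. The formula for c breaks down where b = 0, so the inequality is
    available only where u > 0; a maximum of u equal to 0 is trivial. The hypotheses on S(p) would
    hold vacuously if there were no geodesics, so these have to be constructed. A geodesic must
    satisfy its equation in every chart; this is obtained from the Euler-Lagrange equation of F^2,
    whose form does not depend on the chart. *)

Section NearDifferentiable.
Variables (R : realType) (V W : normedModType R).

(** The zero map serves as differential. The differential is obtained by choice among the linear
    maps satisfying an expansion at [lim (nbhs x)], so exhibiting one such map is enough. *)
Lemma near0_differentiable (f : V -> W) (x : V) :
  (\near x, f x = 0) -> differentiable f x.
Proof.
move=> f0.
have fx0 : f x = 0 := nbhs_singleton f0.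
apply/diffP; apply: (@getPex _ (fun (df : {linear V -> W}) => continuous df /\
  forall y, f y = f (lim (nbhs x)) + df (y - lim (nbhs x))
                  +o_(y \near x) (y - lim (nbhs x)))).
pose z0 : {linear V -> W} := (\0 : V -> W).
exists z0; split; first exact: cst_continuous.
suff h : f = (fun y => f x + z0 (y - x)) +o_ (nbhs x) (fun y => y - x).
  by move=> y; rewrite lim_id//; exact: (congr1 (fun g => g y) h).
apply/eqaddoP => e e0; near=> z.
have -> : (f - (fun y0 => f x + z0 (y0 - x))) z = 0.
  have fz : f z = 0 by near: z.
  by rewrite !fctE fz fx0 /= addr0 subr0.
by rewrite normr0 mulr_ge0// ltW.
Unshelve. all: by end_near. Qed.

Lemma near_eq_differentiable (f g : V -> W) (x : V) :
  (\near x, f x = g x) -> differentiable f x -> differentiable g x.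
Proof.
move=> fg df.
have -> : g = f + (g - f) by rewrite addrC subrK.
apply: differentiableD; first exact: df.
apply: near0_differentiable.
by apply: filterS fg => y fgy; rewrite !fctE fgy subrr.
Qed.

End NearDifferentiable.

Section IsDerive.
Variables (R : realType) (V : normedModType R).
Implicit Types (f g : V -> R) (x v : V).

Lemma isd_val (W : normedModType R) (f : V -> W) x v d : is_derive x v f d -> 'D_v f x = d.
Proof. by case. Qed.

Lemma isd_cst x v (c : R) : is_derive x v (fun _ => c) 0.
Proof. exact: is_derive_cst. Qed.

Lemma isd_add f g x v df dg :
  is_derive x v f df -> is_derive x v g dg ->
  is_derive x v (fun z => f z + g z) (df + dg).
Proof. exact: is_deriveD. Qed.

Lemma isd_opp f x v df :
  is_derive x v f df -> is_derive x v (fun z => - f z) (- df).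
Proof. exact: is_deriveN. Qed.

Lemma isd_mul f g x v df dg :
  is_derive x v f df -> is_derive x v g dg ->
  is_derive x v (fun z => f z * g z) (df * g x + f x * dg).
Proof.
move=> hf hg; apply: (is_derive_eq (is_deriveM hf hg)).
by rewrite addrC mulrC.
Qed.

Lemma isd_scale (c : R) f x v df :
  is_derive x v f df -> is_derive x v (fun z => c * f z) (c * df).
Proof.
by move=> h; have := isd_mul (isd_cst x v c) h; rewrite mul0r add0r.
Qed.

Lemma isd_sub f g x v df dg :
  is_derive x v f df -> is_derive x v g dg ->
  is_derive x v (fun z => f z - g z) (df - dg).
Proof. exact: is_deriveB. Qed.

Lemma isd_inv f x v df : f x != 0 ->
  is_derive x v f df -> is_derive x v (fun z => (f z)^-1) (- df / f x ^+ 2).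
Proof.
move=> f0 hf; split; first by apply: derivableV.
by rewrite deriveV// derive_val /GRing.scale/= mulNr mulNr mulrC.
Qed.

Lemma isd_exp f x v df n :
  is_derive x v f df -> is_derive x v (fun z => f z ^+ n) (n%:R * f x ^+ n.-1 * df).
Proof.
move=> hf; have := is_deriveX n hf; rewrite (_ : f ^+ n = (fun z => f z ^+ n))//.
by apply/funext => z; rewrite exprfctE.
Qed.

Lemma isd_sum (I : Type) (r : seq I) (P : pred I)
    (f : I -> V -> R) x v df :
  (forall i, P i -> is_derive x v (f i) (df i)) ->
  is_derive x v (fun z => \sum_(i <- r | P i) f i z) (\sum_(i <- r | P i) df i).
Proof.
move=> h; have -> : (fun z => \sum_(i <- r | P i) f i z) = \sum_(i <- r | P i) f i.
  by apply/funext => z; rewrite fct_sumE.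
elim/big_ind2 : _; [exact: is_derive_cst|by move=> *; exact: is_deriveD|exact: h].
Qed.

Arguments isd_sum {I r P f x v df}.

Lemma isd_mx m n (M : V -> 'M[R]_(m, n)) x v (dM : 'M[R]_(m, n)) :
  (forall i j, is_derive x v (fun z => M z i j) (dM i j)) <->
  is_derive x v M dM.
Proof.
split=> [h|h i j].
  have dM' : derivable M x v by apply/derivable_mxP => i j; have [] := h i j.
  split => //; rewrite derive_mx//; apply/matrixP => i j; rewrite mxE.
  by have [_ ->] := h i j.
have dM' : derivable M x v by have [] := h.
split; first by move/derivable_mxP : dM'; apply.
by have [_ <-] := h; rewrite derive_mx// mxE.
Qed.

Lemma isd_comp (W : normedModType R) (Z : normedModType R) (f : V -> W) (g : W -> Z) x v w :
  differentiable f x -> differentiable g (f x) -> 'D_v f x = w ->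
  is_derive x v (g \o f) ('D_w g (f x)).
Proof.
move=> df dg <-; have dgf := differentiable_comp df dg.
split; first exact: diff_derivable.
by rewrite deriveE// diff_comp//= -!deriveE.
Qed.

Lemma isd_diff (W : normedModType R) (f : V -> W) x v :
  differentiable f x -> is_derive x v f ('D_v f x).
Proof. by move=> df; split => //; exact: diff_derivable. Qed.

Lemma derive_Dl (W : normedModType R) (f : V -> W) x v w : differentiable f x ->
  'D_(v + w) f x = 'D_v f x + 'D_w f x.
Proof. by move=> df; rewrite !deriveE// linearD. Qed.

Lemma derive_Zl (W : normedModType R) (f : V -> W) x k v : differentiable f x ->
  'D_(k *: v) f x = k *: 'D_v f x.
Proof. by move=> df; rewrite !deriveE// linearZ. Qed.

Lemma derive_Nl (W : normedModType R) (f : V -> W) x v : differentiable f x ->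
  'D_(- v) f x = - 'D_v f x.
Proof. by move=> df; rewrite !deriveE// linearN. Qed.

Lemma derive_suml (W : normedModType R) (f : V -> W) x (I : Type) (r : seq I) P
    (v : I -> V) :
  differentiable f x ->
  'D_(\sum_(i <- r | P i) v i) f x = \sum_(i <- r | P i) 'D_(v i) f x.
Proof.
by move=> df; rewrite deriveE// linear_sum; apply: eq_bigr => i _; rewrite deriveE.
Qed.

End IsDerive.
Arguments isd_sum {R V I r P f x v df}.

Section RowBasis.
Variables (R : realType) (n : nat).

Lemma derive_basis (W : normedModType R) (f : 'rV[R]_n -> W) x v : differentiable f x ->
  'D_v f x = \sum_i v 0 i *: 'D_(delta_mx 0 i) f x.
Proof.
move=> df; rewrite [v in LHS]row_sum_delta derive_suml//.
by apply: eq_bigr => i _; rewrite derive_Zl.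
Qed.

Lemma isd_coord (i : 'I_n) (x v : 'rV[R]_n) :
  is_derive x v (fun y : 'rV[R]_n => y 0 i) (v 0 i).
Proof. exact: (isd_mx id x v v).2. Qed.

End RowBasis.

Section ProdDerive.
Variables (R : realType) (V W : normedModType R).

Lemma differentiable_fst (z : V * W) : differentiable fst z.
Proof. by apply: linear_differentiable => w; exact: cvg_fst. Qed.

Lemma differentiable_snd (z : V * W) : differentiable snd z.
Proof. by apply: linear_differentiable => w; exact: cvg_snd. Qed.

Lemma derive_fst (z v : V * W) : 'D_v fst z = v.1.
Proof.
rewrite deriveE; last exact: differentiable_fst.
by rewrite diff_lin// => w; exact: cvg_fst.
Qed.

Lemma derive_snd (z v : V * W) : 'D_v snd z = v.2.
Proof.
rewrite deriveE; last exact: differentiable_snd.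
by rewrite diff_lin// => w; exact: cvg_snd.
Qed.

Lemma isd_fst (Z : normedModType R) (f : V -> Z) (z v : V * W) :
  differentiable f z.1 -> is_derive z v (fun z => f z.1) ('D_(v.1) f z.1).
Proof.
move=> df; apply: (@isd_comp _ _ _ _ fst f) => //.
  exact: differentiable_fst.
exact: derive_fst.
Qed.

Lemma isd_snd (Z : normedModType R) (f : W -> Z) (z v : V * W) :
  differentiable f z.2 -> is_derive z v (fun z => f z.2) ('D_(v.2) f z.2).
Proof.
move=> df; apply: (@isd_comp _ _ _ _ snd f) => //.
  exact: differentiable_snd.
exact: derive_snd.
Qed.
End ProdDerive.

Section Ck.
Variables (R : realType) (V : normedModType R).
Implicit Types (U : set V).

(** A finite-order form of [smooth_on], suited to induction. The iterated directional derivatives up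
    to order [k] are required to be Frechet differentiable, so [Ck 0] already means differentiable
    and [Ck k] is stronger than the classical C^k. *)
Fixpoint Ck (W : normedModType R) (k : nat) U (f : V -> W) : Prop :=
  (forall x, U x -> differentiable f x) /\
  if k is k'.+1 then forall v, Ck k' U ('D_v f) else True.

Lemma Ck_differentiable (W : normedModType R) k U (f : V -> W) x :
  Ck k U f -> U x -> differentiable f x.
Proof. by case: k => [|k] [h _]; exact: h. Qed.

Lemma Ck_continuous (W : normedModType R) k U (f : V -> W) x :
  Ck k U f -> U x -> {for x, continuous f}.
Proof. by move=> h Ux; apply: differentiable_continuous; exact: Ck_differentiable h Ux. Qed.

Lemma CkS_derive (W : normedModType R) k U (f : V -> W) v :
  Ck k.+1 U f -> Ck k U ('D_v f).
Proof. by move=> [_ h]; exact: h. Qed.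

Lemma CkS (W : normedModType R) k U (f : V -> W) : Ck k.+1 U f -> Ck k U f.
Proof.
elim: k f => [|k ih] f; first by move=> [h _]; split.
by move=> [h h']; split => // v; apply: ih; exact: h'.
Qed.

Lemma Ck_sub (W : normedModType R) k U U' (f : V -> W) :
  U' `<=` U -> Ck k U f -> Ck k U' f.
Proof.
move=> UU; elim: k f => [|k ih] f [h h']; split => //.
- by move=> x /UU; exact: h.
- by move=> x /UU; exact: h.
- by move=> v; apply: ih; exact: h'.
Qed.

Lemma smooth_on_Ck (W : normedModType R) k U (f : V -> W) :
  smooth_on U f -> Ck k U f.
Proof.
elim: k f => [|k ih] f sf; split => //.
- by move=> x; exact: (sf [::]).
- by move=> x; exact: (sf [::]).
move=> v; apply: ih => s x Ux; have := sf (rcons s v) x Ux.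
by rewrite foldr_rcons.
Qed.

(** Openness of [U] turns equality on [U] into equality near each point, which passes to
    derivatives. *)
Lemma Ck_ext (W : normedModType R) k U (f g : V -> W) :
  open U -> (forall x, U x -> f x = g x) -> Ck k U f -> Ck k U g.
Proof.
move=> oU; elim: k f g => [|k ih] f g fg [h h'].
  split => // x Ux; apply: (near_eq_differentiable _ (h _ Ux)).
  by apply: filterS (open_nbhs_nbhs (conj oU Ux)) => y; exact: fg.
have nfg x : U x -> \near x, f x = g x.
  by move=> Ux; apply: filterS (open_nbhs_nbhs (conj oU Ux)) => y; exact: fg.
split=> [x Ux|v].
  by apply: (near_eq_differentiable _ (h _ Ux)); exact: nfg.
by apply: ih (h' v) => x Ux; apply: near_eq_derive; exact: nfg.
Qed.

Lemma Ck_cst (W : normedModType R) k U (c : W) : Ck k U (fun=> c).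
Proof.
elim: k c => [|k ih] c; (split; first by move=> x _; exact: differentiable_cst) => //.
by move=> v; rewrite (_ : 'D_v _ = (fun=> 0))//; apply/funext => x; rewrite derive_cst.
Qed.

Lemma Ck_add k U (f g : V -> R) : open U ->
  Ck k U f -> Ck k U g -> Ck k U (fun x => f x + g x).
Proof.
move=> oU; elim: k f g => [|k ih] f g [hf hf'] [hg hg']; split => //.
- by move=> x Ux; apply: differentiableD; [exact: hf|exact: hg].
- by move=> x Ux; apply: differentiableD; [exact: hf|exact: hg].
move=> v; apply: (Ck_ext oU _ (ih _ _ (hf' v) (hg' v))) => x Ux.
apply/esym; apply: (@derive_val _ _ _ x v); apply: isd_add; apply: isd_diff; [exact: hf|exact: hg].
Qed.

Lemma Ck_opp k U (f : V -> R) : open U ->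
  Ck k U f -> Ck k U (fun x => - f x).
Proof.
move=> oU; elim: k f => [|k ih] f [hf hf']; split => //.
- by move=> x Ux; apply: differentiableN; exact: hf.
- by move=> x Ux; apply: differentiableN; exact: hf.
move=> v; apply: (Ck_ext oU _ (ih _ (hf' v))) => x Ux.
by apply/esym; apply: (@derive_val _ _ _ x v); apply: isd_opp; apply: isd_diff; exact: hf.
Qed.

Lemma Ck_mul k U (f g : V -> R) : open U ->
  Ck k U f -> Ck k U g -> Ck k U (fun x => f x * g x).
Proof.
move=> oU; elim: k f g => [|k ih] f g hf hg.
  by split => // x Ux; apply: differentiableM; [exact: hf.1|exact: hg.1].
split; first by move=> x Ux; apply: differentiableM; [exact: hf.1|exact: hg.1].
move=> v; have := Ck_add oU (ih _ _ (hf.2 v) (CkS hg)) (ih _ _ (CkS hf) (hg.2 v)).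
apply: Ck_ext => // x Ux.
by apply/esym; apply: (@derive_val _ _ _ x v); apply: isd_mul; apply: isd_diff; [exact: hf.1|exact: hg.1].
Qed.

Lemma Ck_scale k U (c : R) (f : V -> R) : open U ->
  Ck k U f -> Ck k U (fun x => c * f x).
Proof. by move=> oU h; apply: Ck_mul => //; exact: Ck_cst. Qed.

Lemma Ck_sub2 k U (f g : V -> R) : open U ->
  Ck k U f -> Ck k U g -> Ck k U (fun x => f x - g x).
Proof. by move=> oU hf hg; apply: Ck_add => //; exact: Ck_opp. Qed.

Lemma Ck_inv k U (f : V -> R) : open U -> (forall x, U x -> f x != 0) ->
  Ck k U f -> Ck k U (fun x => (f x)^-1).
Proof.
move=> oU f0; elim: k f f0 => [|k ih] f f0 hf.
  by split => // x Ux; apply: differentiableV; [exact: hf.1|exact: f0].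
split; first by move=> x Ux; apply: differentiableV; [exact: hf.1|exact: f0].
move=> v; have hi := ih _ f0 (CkS hf).
have := Ck_mul oU (Ck_opp oU (hf.2 v)) (Ck_mul oU hi hi).
apply: Ck_ext => // x Ux.
apply/esym; apply: (@derive_val _ _ _ x v).
rewrite -invfM -expr2; apply: isd_inv; first exact: f0.
by apply: isd_diff; exact: hf.1.
Qed.

Lemma Ck_sum k U (I : Type) (r : seq I) (P : pred I) (f : I -> V -> R) : open U ->
  (forall i, P i -> Ck k U (f i)) -> Ck k U (fun x => \sum_(i <- r | P i) f i x).
Proof.
move=> oU h; rewrite (_ : (fun x => _) = \sum_(i <- r | P i) f i); last first.
  by apply/funext => x; rewrite fct_sumE.
by elim/big_ind : _; [exact: Ck_cst|by move=> *; exact: Ck_add|exact: h].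
Qed.

Arguments Ck_sum {k U I r P f}.

Lemma Ck_prod k U (I : Type) (r : seq I) (P : pred I) (f : I -> V -> R) : open U ->
  (forall i, P i -> Ck k U (f i)) -> Ck k U (fun x => \prod_(i <- r | P i) f i x).
Proof.
move=> oU h; elim: r => [|i r ih].
  rewrite (_ : (fun x => _) = (fun=> 1)); first exact: Ck_cst.
  by apply/funext => x; rewrite big_nil.
case Pi : (P i).
  apply: (Ck_ext oU _ (Ck_mul oU (h i Pi) ih)) => x _.
  by rewrite big_cons Pi.
by apply: (Ck_ext oU _ ih) => x _; rewrite big_cons Pi.
Qed.

Arguments Ck_prod {k U I r P f}.

Lemma Ck_mx k U m n (M : V -> 'M[R]_(m, n)) : open U ->
  Ck k U M -> forall i j, Ck k U (fun x => M x i j).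
Proof.
move=> oU; elim: k M => [|k ih] M [h h'] i j; split => //.
- move=> x Ux; apply: (@differentiable_comp _ _ _ _ M (fun N : 'M[R]_(m, n) => N i j)).
    exact: h.
  exact: differentiable_coord.
- move=> x Ux; apply: (@differentiable_comp _ _ _ _ M (fun N : 'M[R]_(m, n) => N i j)).
    exact: h.
  exact: differentiable_coord.
move=> v; apply: (Ck_ext oU _ (ih _ (h' v) i j)) => x Ux.
by rewrite derive_mx ?mxE//; apply: diff_derivable; exact: h.
Qed.

End Ck.
Arguments Ck_sum {R V k U I r P f}.
Arguments Ck_prod {R V k U I r P f}.

(** * One-dimensional tests and symmetry of second derivatives *)

Section Lines.
Variables (R : realType) (V : normedModType R).
Implicit Types (f : V -> R) (x v : V).

Lemma isd_line f x v t : differentiable f (x + t *: v) ->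
  is_derive t 1 (fun s : R => f (x + s *: v)) ('D_v f (x + t *: v)).
Proof.
move=> df; pose l : R -> V := fun s => x + s *: v.
have dl : is_diff t l (fun s => s *: v).
  have := @is_diffD _ _ _ _ _ _ _ t (is_diff_cst x t) (is_diff_scalel t v).
  by rewrite /l (_ : 0 + _ = (fun s => s *: v))//; apply/funext => s /=; rewrite !fctE add0r.
apply: (@isd_comp _ _ _ _ l f) => //.
by rewrite deriveE// diff_val scale1r.
Qed.

Lemma line_MVT f x v :
  (forall t, 0 <= t <= 1 -> differentiable f (x + t *: v)) ->
  exists2 t, 0 < t < 1 & f (x + v) - f x = 'D_v f (x + t *: v).
Proof.
move=> df; pose g (s : R) := f (x + s *: v).
have [||t t01] := @MVT R g (fun s => 'D_v f (x + s *: v)) 0 1 ltr01.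
- move=> t; rewrite in_itv/= => /andP[t0 t1]; apply: isd_line.
  by apply: df; rewrite !ltW.
- apply: derivable_within_continuous => t; rewrite in_itv/= => t01.
  by have [] := isd_line (df t t01).
rewrite /g scale1r scale0r addr0 subr0 mulr1 => e.
by exists t => //; move: t01; rewrite in_itv.
Qed.

Lemma derive_at_max f x v (U : set V) : open U -> U x ->
  differentiable f x -> (forall y, U y -> f y <= f x) -> 'D_v f x = 0.
Proof.
move=> oU Ux df fmax.
(* One inequality in every direction suffices, since the derivative is odd in the direction. A
   positive derivative would make the difference quotient positive at the small step [t] below. *)
suff h w : 'D_w f x <= 0.
  by apply/eqP; rewrite eq_le h/= -oppr_le0 -derive_Nl.
rewrite leNgt; apply/negP => k0.
have dw : derivable f x w by exact: diff_derivable.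
have /cvgrPdist_lt/(_ _ k0)/nbhs_ballP[e1 /= e10 he1] := dw.
have cl : {for 0, continuous (fun h : R => h *: w + x)}.
  by apply: cvgD; [exact: scalel_continuous|exact: cvg_cst].
have /nbhs_ballP[e2 /= e20 he2] : \forall h \near (0:R), U (h *: w + x).
  by apply: cl; rewrite scale0r add0r; exact: open_nbhs_nbhs.
pose t := Num.min e1 e2 / 2.
have m0 : 0 < Num.min e1 e2 by rewrite lt_min e10 e20.
have t0 : 0 < t by rewrite divr_gt0.
have tm : t < Num.min e1 e2 by rewrite /t ltr_pdivrMr// ltr_pMr// ltr1n.
have Bt e : Num.min e1 e2 <= e -> ball 0 e t.
  by move=> me; rewrite /ball/= sub0r normrN gtr0_norm// (lt_le_trans tm).
have := he1 t; rewrite gt_eqF// => /(_ (Bt e1 _) isT); rewrite ge_min lexx => /(_ isT).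
rewrite ltr_norml => /andP[_]; rewrite ltrBlDr -ltrBlDl subrr.
rewrite /GRing.scale/= pmulr_rgt0 ?invr_gt0// subr_gt0 ltNge fmax//.
by apply: he2; apply: Bt; rewrite ge_min lexx orbT.
Qed.

(** If the second derivative were positive, ['D_v f], which vanishes at [x], would be positive at
    small positive times, and the mean value theorem would push [f] above its maximum. *)
Lemma derive2_at_max f x v (U : set V) : open U -> U x ->
  (forall y, U y -> differentiable f y) -> differentiable ('D_v f) x ->
  (forall y, U y -> f y <= f x) -> 'D_v ('D_v f) x <= 0.
Proof.
move=> oU Ux df ddf fmax; rewrite leNgt; apply/negP => k0.
have D0 := derive_at_max v oU Ux (df _ Ux) fmax.
have dv : derivable ('D_v f) x v by exact: diff_derivable.
have /cvgrPdist_lt/(_ _ k0) := dv; rewrite -/(derive _ _ _) => hk.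
have cl : {for 0, continuous (fun h : R => x + h *: v)}.
  by apply: cvgD; [exact: cvg_cst|exact: scalel_continuous].
have hU : \forall h \near (0:R), U (x + h *: v).
  by apply: cl; rewrite scale0r addr0; exact: open_nbhs_nbhs.
move: hk => /nbhs_ballP[e1 /= e10 he1].
move: hU => /nbhs_ballP[e2 /= e20 he2].
pose t := Num.min e1 e2 / 2.
have m0 : 0 < Num.min e1 e2 by rewrite lt_min e10 e20.
have t0 : 0 < t by rewrite divr_gt0.
have tm : t < Num.min e1 e2 by rewrite /t ltr_pdivrMr// ltr_pMr// ltr1n.
have t1 : t < e1 by rewrite (lt_le_trans tm)// ge_min lexx.
have t2 : t < e2 by rewrite (lt_le_trans tm)// ge_min lexx orbT.
have US s : 0 <= s <= 1 -> U (x + (s * t) *: v).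
  move=> /andP[s0 s1]; apply: he2; have st0 := mulr_ge0 s0 (ltW t0).
  rewrite /ball/= sub0r normrN ger0_norm//.
  by rewrite (le_lt_trans _ t2)// ler_piMl// ltW.
have [|s /andP[s0 s1]] := @line_MVT f x (t *: v).
  by move=> q q01; rewrite scalerA; apply/df/US.
have Uxt : U (x + t *: v) by have := US 1; rewrite mul1r; apply; rewrite ler01 lexx.
have := fmax _ Uxt; rewrite -subr_le0 => /[swap] ->.
rewrite scalerA derive_Zl; last by apply/df/US; rewrite !ltW.
have st0 : 0 < s * t by rewrite mulr_gt0.
rewrite pmulr_rle0// leNgt => /negP; apply.
have := he1 (s * t); rewrite /ball/= sub0r normrN gtr0_norm//.
have -> : s * t < e1 by rewrite (lt_trans _ t1)// gtr_pMl.
move=> /(_ isT); rewrite gt_eqF// => /(_ isT).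
rewrite D0 subr0 ltr_norml => /andP[_].
rewrite ltrBlDr -ltrBlDl subrr => h.
by move: h; rewrite /GRing.scale/= pmulr_rgt0 ?invr_gt0// addrC.
Qed.

Lemma derive_scale2 f x (U : set V) v w (h k : R) : open U -> U x ->
  Ck 1 U f -> 'D_(h *: w) ('D_(k *: v) f) x = h * k * 'D_w ('D_v f) x.
Proof.
move=> oU Ux [df ddf].
have -> : 'D_(h *: w) ('D_(k *: v) f) x = 'D_(h *: w) (fun y => k *: 'D_v f y) x.
  apply: near_eq_derive; apply: filterS (open_nbhs_nbhs (conj oU Ux)) => y Uy.
  by rewrite derive_Zl//; exact: df.
have dd : differentiable ('D_v f) x by exact: (ddf v).1.
rewrite (@deriveZ _ _ _ ('D_v f) k x (h *: w)); last exact: diff_derivable.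
by rewrite derive_Zl// /GRing.scale/= mulrA (mulrC k).
Qed.

(** Two mean value theorems: in direction [v] for the increment of [f] by [w], then in direction [w]
    for ['D_v f]. The left-hand side is symmetric in [v] and [w], which is what [derive_schwarz]
    exploits. *)
Lemma second_difference f x v w (U : set V) : open U -> Ck 1 U f ->
  (forall s t, 0 <= s <= 1 -> 0 <= t <= 1 -> U (x + s *: v + t *: w)) ->
  exists s t, [/\ 0 <= s <= 1, 0 <= t <= 1 &
    f (x + v + w) - f (x + v) - (f (x + w) - f x) =
    'D_w ('D_v f) (x + s *: v + t *: w)].
Proof.
move=> oU Cf hU.
have U1 s : 0 <= s <= 1 -> U (x + s *: v + w).
  by move=> s01; have := hU s 1 s01; rewrite scale1r; apply; rewrite ler01 lexx.
have U0 s : 0 <= s <= 1 -> U (x + s *: v).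
  by move=> s01; have := hU s 0 s01; rewrite scale0r addr0; apply; rewrite lexx ler01.
pose g p := f (p + w) - f p.
have dg s : 0 <= s <= 1 ->
    is_derive (x + s *: v) v g ('D_v f (x + s *: v + w) - 'D_v f (x + s *: v)).
  move=> s01; apply: isd_add; last first.
    by apply: isd_opp; apply: isd_diff; exact: Cf.1 (U0 _ s01).
  have dtr : is_diff (x + s *: v) (fun p => p + w) id.
    have := @is_diffD _ _ _ _ _ _ _ _ (is_diff_id (x + s *: v)) (is_diff_cst w (x + s *: v)).
    by rewrite addr0.
  apply: (@isd_comp _ _ _ _ (fun p => p + w) f); first exact: ex_diff.
    exact: Cf.1 (U1 _ s01).
  by rewrite deriveE ?diff_val//; exact: ex_diff.
have [|s /andP[s0 s1] es] := @line_MVT g x v.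
  move=> s s01; apply: differentiableB.
    apply: (@differentiable_comp _ _ _ _ (fun p => p + w) f).
      by apply: differentiableD.
    exact: Cf.1 (U1 _ s01).
  exact: Cf.1 (U0 _ s01).
have s01 : 0 <= s <= 1 by rewrite !ltW.
have [|t /andP[t0 t1] et] := @line_MVT ('D_v f) (x + s *: v) w.
  by move=> t t01; exact: (Cf.2 v).1 (hU _ _ s01 t01).
exists s, t; split; rewrite ?ltW//.
by rewrite -et -(isd_val (dg s s01)) -es.
Qed.

Lemma subrACA (a b c d : R) : a - b - (c - d) = a - c - (b - d).
Proof. by ring. Qed.

Lemma dist_half_le (a p q e : R) : `|p - a| < e / 2 -> `|q - a| < e / 2 -> `|p - q| <= e.
Proof.
move=> pa qa; rewrite (le_trans (ler_distD a _ _))// [leRHS]splitr.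
by rewrite lerD// ?ltW// distrC.
Qed.

Lemma derive_schwarz f x v w (U : set V) : open U -> U x -> Ck 2 U f ->
  'D_v ('D_w f) x = 'D_w ('D_v f) x.
Proof.
move=> oU Ux Cf.
have c1 : {for x, continuous ('D_v ('D_w f))}.
  by apply: (Ck_continuous (CkS_derive v (CkS_derive w Cf))).
have c2 : {for x, continuous ('D_w ('D_v f))}.
  by apply: (Ck_continuous (CkS_derive w (CkS_derive v Cf))).
apply/eqP; rewrite -subr_eq0 -normr_le0; apply/ler_addgt0Pl => e e0; rewrite addr0.
have e20 : 0 < e / 2 by rewrite divr_gt0.
have /cvgrPdist_lt/(_ _ e20)/nbhs_ballP[r1 /= r10 h1] := c1.
have /cvgrPdist_lt/(_ _ e20)/nbhs_ballP[r2 /= r20 h2] := c2.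
have /nbhs_ballP[r3 /= r30 h3] := open_nbhs_nbhs (conj oU Ux).
pose r := Num.min r1 (Num.min r2 r3).
have r0 : 0 < r by rewrite !lt_min r10 r20.
have d0 : 0 < `|v| + `|w| + 1 by rewrite ltr_wpDl// addr_ge0.
(* The parallelogram with sides [h *: v] and [h *: w] fits into the ball of radius [r]; the [+ 1]
   covers the case v = w = 0. *)
have [h h0 hr] : exists2 h, 0 < h & h * (`|v| + `|w| + 1) = r.
  by exists (r / (`|v| + `|w| + 1)); [rewrite divr_gt0|rewrite divfK// gt_eqF].
have hb s t : 0 <= s <= 1 -> 0 <= t <= 1 -> ball x r (x + s *: (h *: v) + t *: (h *: w)).
  move=> /andP[s0 s1] /andP[t0 t1].
  rewrite -ball_normE/= !opprD !addrA subrr sub0r -opprD normrN.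
  apply: (@le_lt_trans _ _ (h * `|v| + h * `|w|)).
    apply: (le_trans (ler_normD _ _)); rewrite !normrZ (ger0_norm s0) (ger0_norm t0).
    rewrite (gtr0_norm h0).
    by apply: lerD; rewrite ler_piMl// mulr_ge0// ltW.
  by rewrite -hr -mulrDr ltr_pM2l// ltrDl.
have bU y : ball x r y -> [/\ U y, ball x r1 y & ball x r2 y].
  move=> xry; split; last 2 first.
  - by apply: le_ball xry; rewrite /r ge_min lexx.
  - by apply: le_ball xry; rewrite /r !ge_min lexx !orbT.
  by apply: h3; apply: le_ball xry; rewrite /r !ge_min lexx !orbT.
have [|s [t [s01 t01 est]]] := @second_difference f x (h *: v) (h *: w) U oU (CkS Cf).
  by move=> s t s01 t01; have [] := bU _ (hb s t s01 t01).
have [|s' [t' [s01' t01' est']]] := @second_difference f x (h *: w) (h *: v) U oU (CkS Cf).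
  by move=> s' t' s01' t01'; rewrite addrAC; have [] := bU _ (hb t' s' t01' s01').
have [U1 _ b2] := bU _ (hb s t s01 t01).
have [U2 b1 _] := bU _ (hb t' s' t01' s01').
rewrite (derive_scale2 _ _ _ _ oU U1 (CkS Cf)) in est.
rewrite (addrAC x (s' *: _)) (derive_scale2 _ _ _ _ oU U2 (CkS Cf)) in est'.
have hh0 : h * h != 0 by rewrite mulf_neq0// gt_eqF.
(* The two mixed derivatives, taken at two different points of the parallelogram, are the same
   second difference divided by h^2. *)
have e12 : 'D_w ('D_v f) (x + s *: (h *: v) + t *: (h *: w)) =
    'D_v ('D_w f) (x + t' *: (h *: v) + s' *: (h *: w)).
  rewrite (addrAC x (h *: w)) in est'.
  apply: (mulfI hh0); apply: (etrans (esym est)); apply: (etrans _ est'); exact: subrACA.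
have {}h2 := h2 _ b2; rewrite /= e12 in h2.
exact: dist_half_le (h1 _ b1) h2.
Qed.

End Lines.

Section Products.
Variables (R : realType) (V W : normedModType R).

Lemma open_fst (U : set V) : open U -> open [set z : V * W | U z.1].
Proof. by move=> oU; apply: (open_comp _ oU) => z _; exact: cvg_fst. Qed.

Lemma open_snd (U : set W) : open U -> open [set z : V * W | U z.2].
Proof. by move=> oU; apply: (open_comp _ oU) => z _; exact: cvg_snd. Qed.

Lemma Ck_fst (Z : normedModType R) k (U : set V) (f : V -> Z) : open U ->
  Ck k U f -> Ck k [set z : V * W | U z.1] (fun z => f z.1).
Proof.
move=> oU.
have dc (g : V -> Z) (z : V * W) : differentiable g z.1 -> differentiable (fun z : V * W => g z.1) z.
  move=> dg; apply: (@differentiable_comp _ _ _ _ fst g) => //.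
  exact: differentiable_fst.
elim: k f => [|k ih] f [hf hf']; split => //.
- by move=> z Uz; apply: dc; exact: hf.
- by move=> z Uz; apply: dc; exact: hf.
move=> v; apply: (Ck_ext (open_fst oU) _ (ih _ (hf' v.1))) => z Uz.
by apply/esym; apply: (@derive_val _ _ _ z v); apply: isd_fst; exact: hf.
Qed.

Lemma Ck_snd (Z : normedModType R) k (U : set W) (f : W -> Z) : open U ->
  Ck k U f -> Ck k [set z : V * W | U z.2] (fun z => f z.2).
Proof.
move=> oU.
have dc (g : W -> Z) (z : V * W) : differentiable g z.2 -> differentiable (fun z : V * W => g z.2) z.
  move=> dg; apply: (@differentiable_comp _ _ _ _ snd g) => //.
  exact: differentiable_snd.
elim: k f => [|k ih] f [hf hf']; split => //.
- by move=> z Uz; apply: dc; exact: hf.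
- by move=> z Uz; apply: dc; exact: hf.
move=> v; apply: (Ck_ext (open_snd oU) _ (ih _ (hf' v.2))) => z Uz.
by apply/esym; apply: (@derive_val _ _ _ z v); apply: isd_snd; exact: hf.
Qed.

End Products.

Section CkMatrix.
Variables (R : realType).

Lemma Ck_coord n k (U : set 'rV[R]_n) (i : 'I_n) : Ck k U (fun y : 'rV[R]_n => y 0 i).
Proof.
have E v : 'D_v (fun y : 'rV[R]_n => y 0 i) = (fun=> v 0 i).
  by apply/funext => x; apply: (@derive_val _ _ _ x v); exact: isd_coord.
case: k => [|k]; split => //.
- by move=> x _; exact: differentiable_coord.
- by move=> x _; exact: differentiable_coord.
by move=> v; rewrite E; exact: Ck_cst.
Qed.

Variable (V : normedModType R).

Lemma Ck_det n k (U : set V) (M : V -> 'M[R]_n) : open U ->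
  (forall i j, Ck k U (fun x => M x i j)) -> Ck k U (fun x => \det (M x)).
Proof.
move=> oU h; rewrite /determinant; apply: Ck_sum => // s _.
by apply: Ck_mul => //; [exact: Ck_cst|exact: Ck_prod].
Qed.

(** Cramer's rule: the entries of the inverse are rational functions of those of [M]. *)
Lemma Ck_invmx n k (U : set V) (M : V -> 'M[R]_n) : open U ->
  (forall x, U x -> M x \in unitmx) ->
  (forall i j, Ck k U (fun x => M x i j)) ->
  forall i j, Ck k U (fun x => invmx (M x) i j).
Proof.
move=> oU uM h i j.
have : Ck k U (fun x => (\det (M x))^-1 * cofactor (M x) j i).
  apply: Ck_mul => //.
    apply: Ck_inv => //; last exact: Ck_det.
    by move=> x /uM; rewrite unitmxE unitfE.
  apply: Ck_mul => //; first exact: Ck_cst.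
  apply: Ck_det => // k1 k2.
  rewrite (_ : (fun x => _) = (fun x => M x (lift j k1) (lift i k2)))//.
  by apply/funext => x; rewrite !mxE.
apply: Ck_ext => // x Ux.
by rewrite /invmx uM// !mxE.
Qed.

End CkMatrix.

(** * The strong maximum principle *)

Section Dot.
Variables (R : realType) (n : nat).
Implicit Types (u v w : 'rV[R]_n).

Definition dot u v : R := \sum_i u 0 i * v 0 i.

Lemma dotE u v : dot u v = (u *m v^T) 0 0.
Proof. by rewrite mxE; apply: eq_bigr => i _; rewrite mxE. Qed.

Lemma dotC u v : dot u v = dot v u.
Proof. by apply: eq_bigr => i _; rewrite mulrC. Qed.

Lemma dotDl u v w : dot (u + v) w = dot u w + dot v w.
Proof. by rewrite !dotE mulmxDl mxE. Qed.

Lemma dotDr u v w : dot u (v + w) = dot u v + dot u w.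
Proof. by rewrite !(dotC u) dotDl. Qed.

Lemma dotZl k u v : dot (k *: u) v = k * dot u v.
Proof. by rewrite !dotE -scalemxAl mxE. Qed.

Lemma dotZr k u v : dot u (k *: v) = k * dot u v.
Proof. by rewrite !(dotC u) dotZl. Qed.

Lemma dotNl u v : dot (- u) v = - dot u v.
Proof. by rewrite !dotE mulNmx mxE. Qed.

Lemma dotNr u v : dot u (- v) = - dot u v.
Proof. by rewrite !(dotC u) dotNl. Qed.

Lemma dot0l u : dot 0 u = 0.
Proof. by rewrite dotE mul0mx mxE. Qed.

Lemma dot0r u : dot u 0 = 0.
Proof. by rewrite dotC dot0l. Qed.

Lemma dot_mulmx u v (A : 'M[R]_n) : dot (u *m A) v = dot u (v *m A^T).
Proof. by rewrite !dotE trmx_mul trmxK mulmxA. Qed.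

Lemma dot_deltar u i : dot u (delta_mx 0 i) = u 0 i.
Proof.
rewrite /dot (bigD1 i)//= big1 ?addr0 ?mxE ?eqxx ?mulr1// => j ji.
by rewrite mxE eqxx/= (negbTE ji) mulr0.
Qed.

Lemma dot_deltal u i : dot (delta_mx 0 i) u = u 0 i.
Proof. by rewrite dotC dot_deltar. Qed.

Lemma dot_suml I (r : seq I) (P : pred I) (F : I -> 'rV[R]_n) v :
  dot (\sum_(i <- r | P i) F i) v = \sum_(i <- r | P i) dot (F i) v.
Proof. by rewrite dotE mulmx_suml summxE; apply: eq_bigr => i _; rewrite dotE. Qed.

Lemma dot_ge0 u : 0 <= dot u u.
Proof. by apply: sumr_ge0 => i _; rewrite -expr2 sqr_ge0. Qed.

Lemma dot_eq0 u : (dot u u == 0) = (u == 0).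
Proof.
apply/idP/eqP => [|->]; last by rewrite dot0l.
rewrite psumr_eq0 => [/allP h|i _]; last by rewrite -expr2 sqr_ge0.
apply/rowP => i; rewrite mxE; have := h i (mem_index_enum _).
by rewrite /= mulf_eq0 orbb => /eqP.
Qed.

Lemma dot_gt0 u : (0 < dot u u) = (u != 0).
Proof. by rewrite lt_neqAle dot_ge0 andbT eq_sym dot_eq0. Qed.

Lemma coord_sqr_le_dot u i : u 0 i ^+ 2 <= dot u u.
Proof.
rewrite /dot (bigD1 i)//= expr2 lerDl; apply: sumr_ge0 => j _.
by rewrite -expr2 sqr_ge0.
Qed.

Lemma dot_mulmxE u v (A : 'M[R]_n) : dot (u *m A) v = \sum_i \sum_j A i j * u 0 i * v 0 j.
Proof.
rewrite /dot exchange_big; apply: eq_bigr => j _ /=.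
rewrite mxE mulr_suml; apply: eq_bigr => i _.
by rewrite (mulrC (u 0 i)).
Qed.

End Dot.

Section PosDef.
Variables (R : realType).

(** Cholesky factorisation by induction on the size: the Schur complement of the first diagonal
    entry is again positive definite, and a factor of it extends to a factor of [A]. *)
Lemma posdef_decomposition n (A : 'M[R]_n) : A^T = A ->
  (forall v : 'rV_n, v != 0 -> 0 < dot (v *m A) v) -> exists D : 'M[R]_n, A = D^T *m D.
Proof.
elim: n A => [|n ih] A symA posA; first by exists 0; apply/matrixP => -[].
rewrite -[n.+1]/(1 + n)%N in A symA posA *.
have [p [q [q' [M EA]]]] : exists p q q' M, block_mx p q q' M = A.
  by exists (ulsubmx A), (ursubmx A), (dlsubmx A), (drsubmx A); rewrite submxK.
have [sp [qq sM]] : p^T = p /\ (q' = q^T /\ M^T = M).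
  move: symA; rewrite -{1 2}EA tr_block_mx => /eq_block_mx[a1 _ a3 a4].
  by split; [exact: a1|split; [exact/esym|exact: a4]].
pose P := p 0 0.
have pP : p = P%:M by apply/matrixP => i j; rewrite !ord1 mxE eqxx.
have dA (c : R) (v : 'rV_n) : dot (row_mx c%:M v *m A) (row_mx c%:M v) =
    c ^+ 2 * P + 2 * c * dot q v + dot (v *m M) v.
  rewrite dotE -EA mul_row_block tr_row_mx mul_row_col tr_scalar_mx qq pP.
  rewrite -!scalar_mxM mulmxDl mul_mx_scalar mul_scalar_mx !mulmxDl.
  have e00D (B C : 'M[R]_1) : (B + C) 0 0 = B 0 0 + C 0 0 by rewrite mxE.
  have e00Z k (B : 'M[R]_1) : (k *: B) 0 0 = k * B 0 0 by rewrite mxE.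
  rewrite !mul_mx_scalar -scalemxAl !e00D !e00Z -!dotE (dotC v).
  by rewrite [_%:M _ _]mxE eqxx mulr1n; ring.
have P0 : 0 < P.
  have := posA (row_mx 1%:M 0); rewrite dA mul0mx !dot0r mulr0 !addr0 expr1n mul1r; apply.
  apply/eqP => /(congr1 lsubmx); rewrite row_mxKl linear0 => /matrixP/(_ 0 0).
  by rewrite !mxE eqxx => /eqP; rewrite oner_eq0.
have [|v v0|D ED] := ih (M - P^-1 *: (q^T *m q)).
- by rewrite linearB/= linearZ/= trmx_mul trmxK sM.
(* This first coordinate minimises the form for given [v], and the minimum is the value of the Schur
   complement at [v]. *)
- have := posA (row_mx (- dot q v / P)%:M v); rewrite dA.
  have -> : dot (v *m (M - P^-1 *: (q^T *m q))) v =
     (- dot q v / P) ^+ 2 * P + 2 * (- dot q v / P) * dot q v + dot (v *m M) v.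
    rewrite mulmxBr dotDl dotNl -scalemxAr dotZl mulmxA.
    rewrite (_ : v *m q^T = (dot q v)%:M); last first.
      by apply/matrixP => i j; rewrite !ord1 [in RHS]mxE eqxx mulr1n dotC dotE.
    by rewrite mul_scalar_mx dotZl; field; rewrite gt_eqF.
  apply; apply/eqP => /(congr1 rsubmx); rewrite row_mxKr linear0 => /eqP.
  by rewrite (negbTE v0).
pose s := Num.sqrt P.
have s0 : s != 0 by rewrite gt_eqF// sqrtr_gt0.
have ss : s * s = P by rewrite -expr2 sqr_sqrtr// ltW.
exists (block_mx s%:M (s^-1 *: q) 0 D).
rewrite -EA tr_block_mx mulmx_block !tr_scalar_mx !trmx0 !mulmx0 !mul0mx !addr0.
rewrite mul_scalar_mx scale_scalar_mx ss -pP mul_scalar_mx scalerA mulfV// scale1r.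
rewrite linearZ/= mul_mx_scalar scalerA mulfV// scale1r -qq; congr block_mx.
by rewrite qq -ED -scalemxAl -scalemxAr scalerA -invfM ss addrC subrK.
Qed.

(** With A = D^T D the double sum splits into the values of the form [H] at the rows of [D]. *)
Lemma trace_posdef_le0 n (A H : 'M[R]_n) : A^T = A ->
  (forall v : 'rV_n, v != 0 -> 0 < dot (v *m A) v) ->
  (forall d : 'rV_n, \sum_j \sum_k d 0 j * d 0 k * H j k <= 0) ->
  \sum_j \sum_k A j k * H j k <= 0.
Proof.
move=> sA pA hH; have [D ->] := posdef_decomposition sA pA.
rewrite (_ : \sum_j _ = \sum_m \sum_j \sum_k D m j * D m k * H j k); last first.
  rewrite [RHS]exchange_big; apply: eq_bigr => j _; rewrite [RHS]exchange_big; apply: eq_bigr => k _.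
  by rewrite mxE mulr_suml; apply: eq_bigr => m _; rewrite !mxE.
apply: sumr_le0 => m _; apply: le_trans (hH (row m D)).
by apply: ler_sum => j _; apply: ler_sum => k _; rewrite !mxE.
Qed.

End PosDef.

Section SecondDerivativeTest.
Variables (R : realType) (n : nat).
Implicit Types (u : 'rV[R]_n -> R).
Notation e_ i := (delta_mx 0 i : 'rV[R]_n).

Lemma derive2_basis u (U : set 'rV[R]_n) x d : open U -> U x -> Ck 2 U u ->
  'D_d ('D_d u) x = \sum_j \sum_k d 0 j * d 0 k * 'D_(e_ j) ('D_(e_ k) u) x.
Proof.
move=> oU Ux Cu.
have -> : 'D_d ('D_d u) x = 'D_d (fun y => \sum_k d 0 k * 'D_(e_ k) u y) x.
  apply: near_eq_derive; apply: filterS (open_nbhs_nbhs (conj oU Ux)) => y Uy.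
  by rewrite derive_basis//; exact: Cu.1.
have dd k : differentiable ('D_(e_ k) u) x by exact: (Cu.2 _).1.
rewrite derive_basis; last first.
  apply: (@Ck_differentiable _ _ _ 0 U) Ux; apply: (Ck_sum oU) => k _.
  by apply: Ck_scale => //; exact: (CkS (CkS_derive _ Cu)).
apply: eq_bigr => j _; rewrite /GRing.scale/=.
have h : is_derive x (e_ j) (fun y => \sum_k d 0 k * 'D_(e_ k) u y)
    (\sum_k d 0 k * 'D_(e_ j) ('D_(e_ k) u) x).
  by apply: isd_sum => k _; apply: isd_scale; exact: isd_diff.
by rewrite (isd_val h) mulr_sumr; apply: eq_bigr => k _; rewrite mulrA.
Qed.

Lemma trace_hessian_at_max u (U : set 'rV[R]_n) x (A : 'M[R]_n) : open U -> U x -> Ck 2 U u ->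
  (forall y, U y -> u y <= u x) -> A^T = A ->
  (forall v : 'rV_n, v != 0 -> 0 < dot (v *m A) v) ->
  \sum_j \sum_k A j k * 'D_(e_ j) ('D_(e_ k) u) x <= 0.
Proof.
move=> oU Ux Cu umax sA pA.
have := @trace_posdef_le0 _ _ A (\matrix_(j, k) 'D_(e_ j) ('D_(e_ k) u) x) sA pA.
under eq_bigr => j _ do under eq_bigr => k _ do rewrite mxE.
apply=> d; under eq_bigr => j _ do under eq_bigr => k _ do rewrite mxE.
rewrite -(derive2_basis _ oU Ux Cu); apply: (derive2_at_max oU Ux) => //.
  exact: Cu.1.
exact: (Cu.2 _).1.
Qed.

End SecondDerivativeTest.

(** * The comparison function of Hopf's argument *)

Section Barrier.
Variables (R : realType) (n : nat) (q : 'rV[R]_n) (C : R) (m : nat).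
Notation e_ i := (delta_mx 0 i : 'rV[R]_n).
Let N (x : 'rV[R]_n) := dot (x - q) (x - q).

Let isd_coordB i x w : is_derive x w (fun y : 'rV[R]_n => (y - q) 0 i) (w 0 i).
Proof.
rewrite (_ : (fun y : 'rV[R]_n => _) = (fun y : 'rV[R]_n => y 0 i + - q 0 i)); last first.
  by apply/funext => y; rewrite !mxE.
by rewrite -[w 0 i]addr0; apply: (isd_add (isd_coord _ _ _) (isd_cst _ _ _)).
Qed.

Lemma isd_sqdist x w : is_derive x w N (2 * dot (x - q) w).
Proof.
rewrite /N /dot mulr_sumr; apply: isd_sum => i _.
have h := isd_coordB i x w.
by have := isd_mul h h; rewrite (_ : _ + _ = 2 * ((x - q) 0 i * w 0 i))//; ring.
Qed.

Lemma Ck_sqdist k U : open U -> Ck k U N.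
Proof.
move=> oU; rewrite /N /dot; apply: (Ck_sum oU) => i _.
have h : Ck k U (fun y : 'rV[R]_n => (y - q) 0 i).
  rewrite (_ : (fun y : 'rV[R]_n => _) = (fun y : 'rV[R]_n => y 0 i + - q 0 i)); last first.
    by apply/funext => y; rewrite !mxE.
  by apply: (Ck_add oU (Ck_coord _ _ _)); exact: Ck_cst.
exact: Ck_mul.
Qed.

(** A high power replaces the usual exponential: the derivatives stay polynomial, and a large [m]
    plays the role of a large constant in the exponent. The shift by 2 leaves a factor (C - N)^m in
    the second derivatives. *)
Definition barrier x := (C - N x) ^+ m.+2.

Lemma Ck_exp (V : normedModType R) k (U : set V) f j : open U -> Ck k U f -> Ck k U (fun x => (f x : R) ^+ j).
Proof.
move=> oU h; elim: j => [|j ih].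
  by rewrite (_ : (fun x => _) = (fun=> 1)); [exact: Ck_cst|apply/funext => x; rewrite expr0].
by rewrite (_ : (fun x => _) = (fun x => f x * f x ^+ j)); [exact: Ck_mul|apply/funext => x; rewrite exprS].
Qed.

Lemma Ck_barrier k U : open U -> Ck k U barrier.
Proof.
move=> oU; apply: (Ck_exp _ oU); apply: (Ck_add oU); first exact: Ck_cst.
by apply: (Ck_opp oU); exact: Ck_sqdist.
Qed.

Let isd_CN x w : is_derive x w (fun x => C - N x) (- (2 * dot (x - q) w)).
Proof.
by rewrite -[- _]add0r; apply: (isd_sub (isd_cst _ _ _) (isd_sqdist _ _)).
Qed.

Lemma derive_barrier w x :
  'D_w barrier x = - (2 * m.+2%:R) * (C - N x) ^+ m.+1 * dot (x - q) w.
Proof.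
apply: isd_val; have := isd_exp m.+2 (isd_CN x w); rewrite /=.
by congr is_derive; ring.
Qed.

Lemma derive2_barrier w w' x : 'D_w' ('D_w barrier) x =
  2 * m.+2%:R * (C - N x) ^+ m *
   (2 * m.+1%:R * (dot (x - q) w * dot (x - q) w') - (C - N x) * dot w w').
Proof.
rewrite (_ : 'D_w barrier =
  (fun x => - (2 * m.+2%:R) * (C - N x) ^+ m.+1 * dot (x - q) w)); last first.
  by apply/funext => y; exact: derive_barrier.
apply: isd_val.
have h : is_derive x w' (fun y => dot (y - q) w) (dot w w').
  rewrite /dot; apply: isd_sum => i _.
  have := isd_mul (isd_coordB i x w') (isd_cst x w' (w 0 i)).
  by rewrite mulr0 addr0 mulrC.
have := isd_mul (isd_mul (isd_cst x w' (- (2 * m.+2%:R))) (isd_exp m.+1 (isd_CN x w'))) h.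
by congr is_derive; rewrite /= exprS; ring.
Qed.

End Barrier.

Section StrongMaximum.
Variables (R : realType) (n : nat).
Notation e_ i := (delta_mx 0 i : 'rV[R]_n).
Implicit Types (x y z q p w : 'rV[R]_n).

(** The norm of row vectors is the sup norm; this compares it with the Euclidean length, in which
    touching balls are measured. *)
Lemma norm_sqr_le_dot p : `|p| ^+ 2 <= dot p p.
Proof.
rewrite [`|p|]/Num.Def.normr/=.
have [->|/mx_norm_neq0[[i j] ->]] := eqVneq (mx_norm p) 0.
  by rewrite expr0n/= dot_ge0.
by rewrite /= ord1 real_normK ?num_real//; exact: coord_sqr_le_dot.
Qed.

Lemma continuous_sqdist q : continuous (fun x : 'rV[R]_n => dot (x - q) (x - q)).
Proof. by move=> x; apply: (@Ck_continuous _ _ _ 0 setT) => //; apply: Ck_sqdist; exact: openT. Qed.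

Lemma closed_sqdist_le q r : closed [set x : 'rV[R]_n | dot (x - q) (x - q) <= r].
Proof.
apply: (@closed_comp _ _ (fun x : 'rV[R]_n => dot (x - q) (x - q)) [set t | t <= r]).
  by move=> x _; exact: continuous_sqdist.
exact: closed_le.
Qed.

Lemma open_sqdist_lt q r : open [set x : 'rV[R]_n | dot (x - q) (x - q) < r].
Proof.
apply: (@open_comp _ _ (fun x : 'rV[R]_n => dot (x - q) (x - q)) [set t | t < r]).
  by move=> x _; exact: continuous_sqdist.
exact: open_lt.
Qed.

Lemma ler_sqr_bound (t r : R) : t ^+ 2 <= r -> t <= r + 1.
Proof. by move=> h; nra. Qed.

Lemma compact_sqdist_le q r : compact [set x : 'rV[R]_n | dot (x - q) (x - q) <= r].
Proof.
apply: bounded_closed_compact; last exact: closed_sqdist_le.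
exists (`|q| + `|r| + 1); split; first exact: num_real.
move=> t lt x /= xr; apply: le_trans (ltW lt).
suff h : `|x - q| <= `|r| + 1.
  by rewrite -(subrK q x) (le_trans (ler_normD _ _))// addrC -addrA lerD2l.
have xq : `|x - q| ^+ 2 <= `|r| by rewrite (le_trans (norm_sqr_le_dot _))// (le_trans xr)// ler_norm.
by apply: ler_sqr_bound.
Qed.

Lemma dot_bound p w (b c : R) : (forall i, `|p 0 i| <= b) -> (forall i, `|w 0 i| <= c) ->
  `|dot p w| <= n%:R * (b * c).
Proof.
move=> hp hw; rewrite (le_trans (ler_norm_sum _ _ _))//.
rewrite (@le_trans _ _ (\sum_(i < n) b * c))//; last by rewrite sumr_const card_ord mulr_natl.
by apply: ler_sum => i _; rewrite normrM ler_pM.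
Qed.

(** The final arithmetic of [strong_maximum]: [X], [Y], [Z] are the traces against [A] of the
    Hessians of u + e g, u and the barrier g, and [T] is the drift term of g. *)
Lemma hopf_contradiction (X Y Z T e : R) :
  0 < e -> X <= 0 -> X = Y + e * Z -> T < Z -> - e * T <= Y -> false.
Proof.
move=> e0 X0 XE TZ TY; have : e * T < e * Z by rewrite ltr_pM2l.
by lra.
Qed.

(** Hopf's touching-ball argument. If [u] is smaller at some [q] near [x0], the point [z] of the
    maximum set closest to [q] lies on a ball inside which [u] is below its maximum. Adding a small
    multiple of a barrier creates an interior maximum near [z], which the inequality forbids. No
    continuity of [V] enters, only its bound. *)
Lemma strong_maximum (U : set 'rV[R]_n) (u : 'rV[R]_n -> R)
    (A : 'rV[R]_n -> 'M[R]_n) (V : 'rV[R]_n -> 'rV[R]_n) (x0 : 'rV[R]_n) (theta b : R) :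
  open U -> U x0 -> Ck 2 U u -> (forall x, U x -> u x <= u x0) ->
  0 < theta ->
  (forall x, U x -> (A x)^T = A x /\ forall w, theta * dot w w <= dot (w *m A x) w) ->
  (forall x, U x -> \tr (A x) <= b) ->
  (forall x, U x -> forall i, `|V x 0 i| <= b) ->
  (forall x, U x -> \sum_i V x 0 i * 'D_(e_ i) u x <=
     \sum_j \sum_k A x j k * 'D_(e_ j) ('D_(e_ k) u) x) ->
  \forall x \near x0, u x = u x0.
Proof.
move=> oU Ux0 Cu umax th0 Apos Atr Vb pde.
have /nbhs_ballP[r0 /= r00 hr0] := open_nbhs_nbhs (conj oU Ux0).
pose rho := r0 / 2.
have rho0 : 0 < rho by rewrite divr_gt0.
have BU x : dot (x - x0) (x - x0) <= rho ^+ 2 -> U x.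
  move=> h; apply: hr0; rewrite -ball_normE/= distrC.
  rewrite (@le_lt_trans _ _ rho)//; last by rewrite /rho ltr_pdivrMr// ltr_pMr// ltr1n.
  by rewrite -(@ler_pXn2r _ 2) ?nnegrE// ?(ltW rho0)// (le_trans (norm_sqr_le_dot _)).
(* With [q] within rho/4 of [x0], the point [z] lies within rho/2 of [x0], and the small ball about
   [z] still lies in [U]. *)
suff main q : dot (q - x0) (q - x0) < (rho / 4) ^+ 2 -> u q = u x0.
  apply: filterS (open_nbhs_nbhs (conj (@open_sqdist_lt x0 ((rho / 4) ^+ 2)) _)) => [q /main//|].
  by rewrite /= subrr dot0l exprn_gt0// divr_gt0.
move=> hq; apply/eqP; apply: contraT => uq.
have cu x : U x -> {for x, continuous u} by move=> Ux; exact: Ck_continuous Cu Ux.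
have Dsum p p' : dot (p + p') (p + p') <= 2 * dot p p + 2 * dot p' p'.
  have := dot_ge0 (p - p'); rewrite !dotDl !dotDr !dotNl !dotNr (dotC p' p); lra.
pose E := [set x | dot (x - x0) (x - x0) <= rho ^+ 2] `&` [set x | u x = u x0].
have cE : compact E.
  apply: (@subclosed_compact _ _ [set x | dot (x - x0) (x - x0) <= rho ^+ 2]).
  - move=> x clx.
    have Bx : dot (x - x0) (x - x0) <= rho ^+ 2.
      by apply: (@closed_sqdist_le x0 (rho ^+ 2)); move: clx; apply: closure_subset => y [].
    split => //=; apply/eqP; apply: contraT => ux.
    have : nbhs x [set y | u y != u x0].
      apply: (cu x (BU _ Bx) [set t | t != u x0]); apply: open_nbhs_nbhs; split => //.
    by move=> /clx[y [[_ /= ->]]]; rewrite /= eqxx.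
  - exact: compact_sqdist_le.
  - by move=> x [].
have [z /set_mem[zB uz] zmin] : exists2 z, z \in E &
    forall t, t \in E -> dot (z - q) (z - q) <= dot (t - q) (t - q).
  apply: EVT_min_rV => //; last by apply: continuous_subspaceT => x; exact: continuous_sqdist.
  by exists x0; split => //=; rewrite subrr dot0l exprn_ge0// ltW.
have {zmin}zmin t : dot (t - x0) (t - x0) <= rho ^+ 2 -> u t = u x0 ->
    dot (z - q) (z - q) <= dot (t - q) (t - q).
  by move=> h1 h2; apply: zmin; rewrite inE.
(* [q'] is the midpoint of [q] and [z]: the ball of centre [q'] through [z] lies in the ball of
   centre [q] through [z] and meets its boundary only at [z]. *)
pose d := 2^-1 *: (z - q); pose q' := q + d; pose s := dot d d.
have zq : dot (z - q) (z - q) = 4 * s by rewrite /s dotZl dotZr; field.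
have zq' : z - q' = d.
  by rewrite /q' /d; apply/rowP => i; rewrite !mxE; field.
have s0 : 0 < s.
  rewrite dot_gt0; apply: contra uq; rewrite /d scaler_eq0 invr_eq0 pnatr_eq0/= subr_eq0.
  by move=> /eqP <-; rewrite uz.
have s4 : 4 * s < (rho / 4) ^+ 2.
  rewrite -zq (le_lt_trans _ hq)//.
  rewrite (@le_trans _ _ (dot (x0 - q) (x0 - q)))//.
    by apply: zmin => //; rewrite subrr dot0l exprn_ge0// ltW.
  by rewrite -opprB dotNl dotNr opprK.
have rho2 : (rho / 4) ^+ 2 = rho ^+ 2 / 16 by field.
rewrite rho2 in hq s4.
have BzU x : dot (x - z) (x - z) <= s / 4 -> U x.
  move=> h; apply: BU.
  have -> : x - x0 = (x - z) + ((z - q) + (q - x0)) by rewrite !addrA !subrK.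
  have := Dsum (x - z) ((z - q) + (q - x0)); have := Dsum (z - q) (q - x0); rewrite zq; lra.
have inside x : dot (x - q') (x - q') <= s -> x != z -> u x < u x0.
  move=> h xz.
  (* Parallelogram law. It makes [x] strictly closer to [q] than [z] is, so [x] cannot belong to the
     maximum set. *)
  have par : dot (x - q) (x - q) + dot (x - z) (x - z) = 2 * dot (x - q') (x - q') + 2 * s.
    have -> : x - q = (x - q') + d by rewrite /q' opprD addrA subrK.
    have -> : x - z = (x - q') - d by rewrite -zq' opprB addrA subrK.
    by rewrite !dotDl !dotDr !dotNl !dotNr -/s; ring.
  have xz0 : 0 < dot (x - z) (x - z) by rewrite dot_gt0 subr_eq0.
  have Bx : dot (x - x0) (x - x0) <= rho ^+ 2.
    have -> : x - x0 = (x - q) + (q - x0) by rewrite addrA subrK.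
    by have := Dsum (x - q) (q - x0); lra.
  rewrite lt_neqAle umax ?andbT; last exact: BU.
  by apply/eqP => ux; have := zmin x Bx ux; lra.
(* On the ball |x - z|^2 <= s/4 the squared distance to [q'] is at most 5 s/2, so C - |x - q'|^2
   stays positive there. *)
pose C := 4 * s.
have Np x : dot (x - z) (x - z) <= s / 4 -> s / 4 <= dot (x - q') (x - q') <= 5 / 2 * s.
  move=> h; have := Dsum (x - z) d; have := Dsum (x - q') (z - x).
  have -> : x - q' + (z - x) = d by rewrite -zq' addrC addrA subrK.
  have -> : x - z + d = x - q' by rewrite -zq' addrA subrK.
  have -> : dot (z - x) (z - x) = dot (x - z) (x - z) by rewrite -opprB dotNl dotNr opprK.
  by rewrite -/s; lra.
pose c := 3 * s + 1.
pose M0 := 4 * s * `|b| + 4 * s * (n%:R * (`|b| * c)).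
have c0 : 0 <= c by rewrite /c; lra.
have M00 : 0 <= M0 by rewrite /M0 addr_ge0// !mulr_ge0// ltW.
(* The term 2 (m+1) p.A p of the Hessian of the barrier, at least (m+1) theta s/2, must beat the
   trace and drift terms, which are bounded together by [M0]. *)
have [m hm] : exists m : nat, M0 < m.+1%:R * (theta * s / 2).
  have ts0 : 0 < theta * s / 2 by rewrite divr_gt0// mulr_gt0.
  have Mt0 : 0 <= M0 / (theta * s / 2) by rewrite divr_ge0// ltW.
  exists (Num.bound (M0 / (theta * s / 2))); rewrite -ltr_pdivrMr//.
  by rewrite (lt_trans (archi_boundP Mt0))// ltr_nat.
pose g := barrier q' C m.
have gpde x : dot (x - z) (x - z) <= s / 4 ->
    \sum_i V x 0 i * 'D_(e_ i) g x <
    \sum_j \sum_k A x j k * 'D_(e_ j) ('D_(e_ k) g) x.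
  move=> Bx; have Ux := BzU _ Bx; have /andP[N1 N2] := Np _ Bx.
  set p := x - q' in N1 N2 *; set k := C - dot p p.
  have k0 : 0 < k by rewrite /k /C; lra.
  have k4 : k <= 4 * s by rewrite /k /C; lra.
  have -> : \sum_i V x 0 i * 'D_(e_ i) g x = - (2 * m.+2%:R * k ^+ m) * (k * dot (V x) p).
    rewrite /dot !mulr_sumr; apply: eq_bigr => i _.
    by rewrite /g derive_barrier -/p -/k dot_deltar exprS; ring.
  have -> : \sum_j \sum_k A x j k * 'D_(e_ j) ('D_(e_ k) g) x =
      2 * m.+2%:R * k ^+ m * (2 * m.+1%:R * dot (p *m A x) p - k * \tr (A x)).
    rewrite dot_mulmxE /mxtrace !mulr_sumr -sumrB mulr_sumr; apply: eq_bigr => j _.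
    rewrite !mulr_sumr.
    rewrite (_ : k * A x j j = \sum_i k * (A x j i * (i == j)%:R)); last first.
      rewrite (bigD1 j)//= eqxx mulr1 big1 ?addr0// => i /negbTE ->.
      by rewrite !mulr0.
    rewrite -sumrB mulr_sumr; apply: eq_bigr => i _.
    have dd : dot (e_ i) (e_ j) = (i == j)%:R by rewrite dot_deltar mxE eqxx/= eq_sym.
    rewrite /g derive2_barrier -/p -/k dd !dot_deltar.
    by ring.
  have G0 : 0 < 2 * m.+2%:R * k ^+ m by rewrite !mulr_gt0// exprn_gt0.
  rewrite mulNr -mulrN ltr_pM2l//.
  have Ap := (Apos x Ux).2 p.
  have tA : k * \tr (A x) <= 4 * s * `|b|.
    rewrite (@le_trans _ _ (k * `|b|))//.
      by rewrite ler_pM2l// (le_trans (Atr _ Ux))// ler_norm.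
    by rewrite ler_wpM2r.
  have Vp : k * `|dot (V x) p| <= 4 * s * (n%:R * (`|b| * c)).
    apply: ler_pM => //; first exact: ltW.
    apply: dot_bound => i; first by rewrite (le_trans (Vb _ Ux i))// ler_norm.
    have := ler_sqr_bound (t := `|p 0 i|) (r := 3 * s); apply.
    rewrite real_normK ?num_real// (le_trans (coord_sqr_le_dot _ _))//; lra.
  have Vp' : - (k * dot (V x) p) <= k * `|dot (V x) p|.
    by rewrite -mulrN ler_pM2l// -normrN ler_norm.
  have th1 : theta * (s / 4) <= dot (p *m A x) p.
    by rewrite (le_trans _ Ap)// ler_pM2l.
  have : m.+1%:R * (theta * s / 2) <= 2 * m.+1%:R * dot (p *m A x) p.
    rewrite (_ : m.+1%:R * (theta * s / 2) = 2 * m.+1%:R * (theta * (s / 4))); last by field.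
    by rewrite ler_wpM2l// mulr_ge0.
  by move: hm; rewrite /M0; lra.
pose S := [set x | dot (x - q') (x - q') <= s] `&` [set x | dot (x - z) (x - z) = s / 4].
have SU x : S x -> U x by move=> [_ /= h]; apply: BzU; rewrite h.
(* The part of the small sphere about [z] inside the touching ball is compact and avoids [z], so [u]
   stays below its maximum by a fixed amount. *)
have [delta d0 hdelta] : exists2 delta, 0 < delta & forall x, S x -> u x <= u x0 - delta.
  have [S0|/set0P/negP/negPn/eqP S0] := pselect (S !=set0); last first.
    by exists 1 => // x; rewrite S0.
  have cS : compact S.
    apply: (@subclosed_compact _ _ [set x | dot (x - q') (x - q') <= s]) => //.
    - apply: closedI; first exact: closed_sqdist_le.
      apply: (@closed_comp _ _ (fun x => dot (x - z) (x - z)) [set t | t = s / 4]).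
        by move=> x _; exact: continuous_sqdist.
      exact: closed_eq.
    - exact: compact_sqdist_le.
    - by move=> x [].
  have [y /set_mem Sy ymax] : exists2 y, y \in S & forall t, t \in S -> u t <= u y.
    apply: EVT_max_rV => //; apply: continuous_in_subspaceT => x /set_mem/SU.
    exact: cu.
  exists (u x0 - u y).
    rewrite subr_gt0; apply: inside; first exact: Sy.1.
    apply/eqP => yz; have := Sy.2; rewrite /= yz subrr dot0l.
    by move: s0; lra.
  by move=> x Sx; rewrite opprB addrC subrK; apply: ymax; rewrite inE.
pose Kb := C ^+ m.+2.
have C0 : 0 < C by rewrite /C; lra.
have Kb0 : 0 < Kb by rewrite exprn_gt0.
pose eps := delta / (Kb + 1).
have eps0 : 0 < eps by rewrite divr_gt0// addr_gt0.
have epsK : eps * Kb < delta.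
  by rewrite /eps mulrAC ltr_pdivrMr ?addr_gt0// ltr_pM2l// ltrDl.
pose w x := u x + eps * g x.
pose W := [set x | dot (x - z) (x - z) < s / 4].
have WU x : W x -> U x by move=> /ltW; exact: BzU.
have oW : open W by exact: open_sqdist_lt.
have Cg k : Ck k U g by exact: Ck_barrier.
have Cw : Ck 2 U w := Ck_add oU Cu (Ck_scale eps oU (Cg 2%N)).
have [y /set_mem/= By ymax] : exists2 y, y \in [set x | dot (x - z) (x - z) <= s / 4] &
    forall t, t \in [set x | dot (x - z) (x - z) <= s / 4] -> w t <= w y.
  apply: EVT_max_rV.
  - by exists z => /=; rewrite subrr dot0l divr_ge0// ltW.
  - exact: compact_sqdist_le.
  - by apply: continuous_in_subspaceT => x /set_mem/BzU; exact: Ck_continuous Cw.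
have {}ymax t : dot (t - z) (t - z) <= s / 4 -> w t <= w y by move=> h; apply: ymax; rewrite inE.
have gz : g z = (C - s) ^+ m.+2 by rewrite /g /barrier zq'.
(* A maximum of [w] on the boundary sphere is excluded: inside the touching ball [eps] times the
   barrier cannot make up for [delta], and outside it the barrier is smaller than at [z]. *)
have Wy : W y.
  rewrite /W/= lt_neqAle By andbT; apply/eqP => yE.
  have := ymax z; rewrite subrr dot0l => /(_ (divr_ge0 (ltW s0) _)).
  rewrite ler0n => /(_ isT); apply/negP; rewrite -ltNge.
  have /andP[N1 N2] := Np y By.
  have [Ns|Ns] := leP (dot (y - q') (y - q')) s.
    have uy := hdelta y (conj Ns yE).
    have gy : g y <= Kb.
      by rewrite /g /barrier /Kb ler_pXn2r ?nnegrE ?(ltW C0)// /C; lra.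
    have gz0 : 0 <= g z by rewrite gz exprn_ge0// /C; lra.
    have := ler_wpM2l (ltW eps0) gy; have := mulr_ge0 (ltW eps0) gz0.
    by rewrite /w uz; lra.
  have gyz : g y < g z.
    by rewrite gz /g /barrier ltr_pXn2r ?nnegrE// /C; lra.
  have := umax y (BzU _ By); rewrite -(ltr_pM2l eps0) in gyz.
  by rewrite /w uz; lra.
have Uy := WU _ Wy.
have ymaxW x : W x -> w x <= w y by move=> /ltW; exact: ymax.
have dw j x : U x -> 'D_(e_ j) w x = 'D_(e_ j) u x + eps * 'D_(e_ j) g x.
  move=> Ux; apply: isd_val; apply: isd_add; first by apply: isd_diff; exact: Cu.1.
  by apply: isd_scale; apply: isd_diff; exact: (Cg 0%N).1.
have tr0 := trace_hessian_at_max oW Wy (Ck_sub WU Cw) ymaxW (Apos y Uy).1 _.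
have {}tr0 : \sum_j \sum_k A y j k * 'D_(e_ j) ('D_(e_ k) w) y <= 0.
  apply: tr0 => v v0; rewrite (lt_le_trans _ ((Apos y Uy).2 v))// mulr_gt0//.
  by rewrite dot_gt0.
have ddw j k : 'D_(e_ j) ('D_(e_ k) w) y =
    'D_(e_ j) ('D_(e_ k) u) y + eps * 'D_(e_ j) ('D_(e_ k) g) y.
  transitivity ('D_(e_ j) (fun x => 'D_(e_ k) u x + eps * 'D_(e_ k) g x) y).
    by apply: near_eq_derive; apply: filterS (open_nbhs_nbhs (conj oU Uy)) => x Ux; exact: dw.
  apply: isd_val; apply: isd_add; first by apply: isd_diff; exact: (CkS_derive _ Cu).1.
  by apply: isd_scale; apply: isd_diff; exact: (CkS_derive _ (Cg 1%N)).1.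
have d1 j : 'D_(e_ j) u y = - (eps * 'D_(e_ j) g y).
  apply/eqP; rewrite -addr_eq0 -dw//; apply/eqP.
  by apply: (derive_at_max _ oW Wy _ ymaxW); exact: Cw.1.
have TY := pde y Uy; have TZ := gpde y By.
have TE : \sum_i V y 0 i * 'D_(e_ i) u y = - eps * \sum_i V y 0 i * 'D_(e_ i) g y.
  by rewrite mulr_sumr; apply: eq_bigr => i _; rewrite d1; ring.
have XE : \sum_j \sum_k A y j k * 'D_(e_ j) ('D_(e_ k) w) y =
  \sum_j \sum_k A y j k * 'D_(e_ j) ('D_(e_ k) u) y +
   eps * \sum_j \sum_k A y j k * 'D_(e_ j) ('D_(e_ k) g) y.
  rewrite mulr_sumr -big_split; apply: eq_bigr => j _.
  rewrite mulr_sumr -big_split; apply: eq_bigr => k _ /=.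
  by rewrite ddw mulrDr (mulrCA (A y j k)).
rewrite TE in TY; exact: (hopf_contradiction eps0 tr0 XE TZ TY).
Qed.

End StrongMaximum.

(** * The spray of a Randers metric *)

Section MatrixCalculus.
Variables (R : realType) (V : normedModType R).
Implicit Types (x v : V).

Lemma differentiable_mx m n (M : V -> 'M[R]_(m, n)) x :
  (forall i j, differentiable (fun y => M y i j) x) -> differentiable M x.
Proof.
move=> h; rewrite (_ : M = \sum_i \sum_j (fun y => M y i j *: delta_mx i j)); last first.
  apply/funext => y; rewrite [LHS]matrix_sum_delta fct_sumE; apply: eq_bigr => i _.
  by rewrite fct_sumE.
apply: differentiable_sum => i; apply: differentiable_sum => j.
exact: differentiableZl.
Qed.

Lemma Ck_entries k (U : set V) m n (M : V -> 'M[R]_(m, n)) : open U ->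
  (forall i j, Ck k U (fun y => M y i j)) -> Ck k U M.
Proof.
move=> oU; elim: k M => [|k ih] M h.
  by split => // x Ux; apply: differentiable_mx => i j; exact: (h i j).1.
have dM x : U x -> differentiable M x.
  by move=> Ux; apply: differentiable_mx => i j; exact: (h i j).1.
split => // v; apply: ih => i j; apply: (Ck_ext oU _ (CkS_derive v (h i j))) => x Ux.
by rewrite derive_mx ?mxE//; apply: diff_derivable; exact: dM.
Qed.

Lemma Ck_mulmx k (U : set V) m n p (M : V -> 'M[R]_(m, n)) (N : V -> 'M[R]_(n, p)) :
  open U -> Ck k U M -> Ck k U N -> Ck k U (fun x => M x *m N x).
Proof.
move=> oU hM hN; apply: (Ck_entries oU) => i j.
rewrite (_ : (fun y => _) = (fun y => \sum_l M y i l * N y l j)); last first.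
  by apply/funext => y; rewrite mxE.
by apply: (Ck_sum oU) => l _; apply: (Ck_mul oU); exact: Ck_mx.
Qed.

Lemma Ck_trmx k (U : set V) m n (M : V -> 'M[R]_(m, n)) :
  open U -> Ck k U M -> Ck k U (fun x => (M x)^T).
Proof.
move=> oU hM; apply: (Ck_entries oU) => i j.
rewrite (_ : (fun y => _) = (fun y => M y j i)); first exact: Ck_mx.
by apply/funext => y; rewrite mxE.
Qed.

Lemma Ck_addmx k (U : set V) m n (M N : V -> 'M[R]_(m, n)) :
  open U -> Ck k U M -> Ck k U N -> Ck k U (fun x => M x + N x).
Proof.
move=> oU hM hN; apply: (Ck_entries oU) => i j.
rewrite (_ : (fun y => _) = (fun y => M y i j + N y i j)).
  by apply: (Ck_add oU); exact: Ck_mx.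
by apply/funext => y; rewrite mxE.
Qed.

Lemma Ck_scalemx k (U : set V) m n (f : V -> R) (M : V -> 'M[R]_(m, n)) :
  open U -> Ck k U f -> Ck k U M -> Ck k U (fun x => f x *: M x).
Proof.
move=> oU hf hM; apply: (Ck_entries oU) => i j.
rewrite (_ : (fun y => _) = (fun y => f y * M y i j)).
  by apply: (Ck_mul oU); [|exact: Ck_mx].
by apply/funext => y; rewrite mxE.
Qed.

Lemma Ck_dot k (U : set V) n (f g : V -> 'rV[R]_n) :
  open U -> Ck k U f -> Ck k U g -> Ck k U (fun x => dot (f x) (g x)).
Proof.
by move=> oU hf hg; apply: (Ck_sum oU) => l _; apply: (Ck_mul oU); exact: Ck_mx.
Qed.

Lemma Ck_invmx_mx n k (U : set V) (M : V -> 'M[R]_n) : open U ->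
  (forall x, U x -> M x \in unitmx) -> Ck k U M -> Ck k U (fun x => invmx (M x)).
Proof.
move=> oU uM hM; apply: (Ck_entries oU); apply: Ck_invmx => // i j; exact: Ck_mx.
Qed.

Lemma isd_mulmx m n p (M : V -> 'M[R]_(m, n)) (N : V -> 'M[R]_(n, p)) x v dM dN :
  is_derive x v M dM -> is_derive x v N dN ->
  is_derive x v (fun z => M z *m N z) (dM *m N x + M x *m dN).
Proof.
move=> /isd_mx hM /isd_mx hN; apply/isd_mx => i j.
rewrite (_ : (fun y => _) = (fun y => \sum_l M y i l * N y l j)); last first.
  by apply/funext => y; rewrite mxE.
rewrite !mxE -big_split; apply: isd_sum => l _.
exact: isd_mul.
Qed.

Lemma isd_addmx m n (M N : V -> 'M[R]_(m, n)) x v dM dN :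
  is_derive x v M dM -> is_derive x v N dN ->
  is_derive x v (fun z => M z + N z) (dM + dN).
Proof. exact: is_deriveD. Qed.

Lemma isd_oppmx m n (M : V -> 'M[R]_(m, n)) x v dM :
  is_derive x v M dM -> is_derive x v (fun z => - M z) (- dM).
Proof. exact: is_deriveN. Qed.

Lemma isd_trmx m n (M : V -> 'M[R]_(m, n)) x v dM :
  is_derive x v M dM -> is_derive x v (fun z => (M z)^T) dM^T.
Proof.
move=> /isd_mx hM; apply/isd_mx => i j.
rewrite (_ : (fun y => _) = (fun y => M y j i)); first by rewrite mxE.
by apply/funext => y; rewrite mxE.
Qed.

Lemma isd_scalemx m n (f : V -> R) (M : V -> 'M[R]_(m, n)) x v df dM :
  is_derive x v f df -> is_derive x v M dM ->
  is_derive x v (fun z => f z *: M z) (df *: M x + f x *: dM).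
Proof.
move=> hf /isd_mx hM; apply/isd_mx => i j.
rewrite (_ : (fun y => _) = (fun y => f y * M y i j)).
  by rewrite !mxE; exact: isd_mul.
by apply/funext => y; rewrite mxE.
Qed.

Lemma isd_dot n (f g : V -> 'rV[R]_n) x v df dg :
  is_derive x v f df -> is_derive x v g dg ->
  is_derive x v (fun z => dot (f z) (g z)) (dot df (g x) + dot (f x) dg).
Proof.
move=> /isd_mx hf /isd_mx hg; rewrite /dot -big_split; apply: isd_sum => i _.
exact: isd_mul.
Qed.

(** Cramer's rule gives the existence of the derivative, and differentiating M^-1 M = 1 gives its
    value. *)
Lemma isd_invmx n (U : set V) (M : V -> 'M[R]_n) x v : open U -> U x ->
  (forall y, U y -> M y \in unitmx) -> Ck 0 U M ->
  is_derive x v (fun z => invmx (M z)) (- (invmx (M x) *m 'D_v M x *m invmx (M x))).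
Proof.
move=> oU Ux uM CM.
have dM : is_derive x v M ('D_v M x) by apply: isd_diff; exact: CM.1.
have CI := Ck_invmx_mx oU uM CM.
have dI : is_derive x v (fun z => invmx (M z)) ('D_v (fun z => invmx (M z)) x).
  by apply: isd_diff; exact: CI.1.
have E : 'D_v (fun z => invmx (M z)) x *m M x + invmx (M x) *m 'D_v M x = 0.
  rewrite -(isd_val (isd_mulmx dI dM)) -(derive_cst (1%:M : 'M[R]_n) x v).
  apply: near_eq_derive; apply: filterS (open_nbhs_nbhs (conj oU Ux)) => y Uy.
  by rewrite mulVmx// uM.
have -> : - (invmx (M x) *m 'D_v M x *m invmx (M x)) = 'D_v (fun z => invmx (M z)) x.
  move/eqP: E; rewrite addr_eq0 => /eqP E.
  by rewrite -mulNmx -E mulmxK// uM.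
exact: dI.
Qed.

End MatrixCalculus.

Lemma row_mul_tr (R : realType) n (p w : 'rV[R]_n) : p *m w^T = (dot p w)%:M.
Proof. by apply/matrixP => i j; rewrite !ord1 -dotE [in RHS]mxE eqxx mulr1n. Qed.

Section PosDefUnit.
Variables (R : realType) (n : nat).

Lemma posdef_unitmx (A : 'M[R]_n) :
  (forall v : 'rV_n, v != 0 -> 0 < dot (v *m A) v) -> A \in unitmx.
Proof.
move=> pA; rewrite -row_free_unit -kermx_eq0; apply: contraT => /rowV0Pn[v /sub_kermxP vA v0].
by have := pA v v0; rewrite vA dot0l ltxx.
Qed.

Lemma invmx_sym (A : 'M[R]_n) : A^T = A -> (invmx A)^T = invmx A.
Proof. by move=> h; rewrite trmx_inv h. Qed.

Lemma posdef_invmx (A : 'M[R]_n) : A^T = A ->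
  (forall v : 'rV_n, v != 0 -> 0 < dot (v *m A) v) ->
  forall v : 'rV_n, v != 0 -> 0 < dot (v *m invmx A) v.
Proof.
move=> sA pA v v0; have uA := posdef_unitmx pA.
have := pA (v *m invmx A); rewrite mulmxKV// dotC; apply.
by apply: contra v0 => /eqP h; rewrite -(mulmxKV uA v) h mul0mx.
Qed.

(** [w] below is the part of [u] orthogonal to [v]; its squared length times that of [v] is the
    difference of the two sides. *)
Lemma dot_cauchy (A : 'M[R]_n) u v : A^T = A ->
  (forall v : 'rV_n, v != 0 -> 0 < dot (v *m A) v) ->
  dot (u *m A) v ^+ 2 <= dot (u *m A) u * dot (v *m A) v.
Proof.
move=> sA pA; have [->|v0] := eqVneq v 0; first by rewrite !dot0r mulr0 expr0n.
have V0 := pA v v0.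
pose w := u - (dot (u *m A) v / dot (v *m A) v) *: v.
have w0 : 0 <= dot (w *m A) w.
  have [->|/pA/ltW//] := eqVneq w 0; by rewrite dot0r.
have vu : dot (v *m A) u = dot (u *m A) v by rewrite dot_mulmx sA dotC.
have : dot (w *m A) w * dot (v *m A) v = dot (u *m A) u * dot (v *m A) v - dot (u *m A) v ^+ 2.
  rewrite /w mulmxBl -scalemxAl !dotDl !dotDr !dotNl !dotNr !dotZl !dotZr vu.
  by field; rewrite gt_eqF.
by rewrite -subr_ge0 => <-; rewrite mulr_ge0// ltW.
Qed.

End PosDefUnit.

Definition slit (R : realType) n (U : set 'rV[R]_n) : set ('rV[R]_n * 'rV[R]_n) :=
  [set z | U z.1 /\ z.2 != 0].

(** A Randers metric seen in one chart. The bound |b| < 1 is not among the fields: it follows from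
    [rd_ge0] and [rd_gpos], see [bnorm2_lt1]. *)
Record randers_data (R : realType) n (U : set 'rV[R]_n) (a : 'rV[R]_n -> 'M[R]_n)
    (b : 'rV[R]_n -> 'rV[R]_n) (L : 'rV[R]_n * 'rV[R]_n -> R) : Prop := RandersData {
  rd_open : open U;
  rd_Ca : forall k, Ck k U a;
  rd_Cb : forall k, Ck k U b;
  rd_CL : forall k, Ck k (slit U) L;
  rd_sym : forall x, U x -> (a x)^T = a x;
  rd_pos : forall x, U x -> forall v, v != 0 -> 0 < dot (v *m a x) v;
  rd_LE : forall x y, U x -> L (x, y) = Num.sqrt (dot (y *m a x) y) + dot (b x) y;
  rd_ge0 : forall z, 0 <= L z;
  rd_gpos : forall z, slit U z -> forall v, v != 0 ->
    0 < dot (v *m fundamental_tensor L z) v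
}.

Section RandersSpray.
Variables (R : realType) (n : nat).
Notation V := 'rV[R]_n.
Notation e_ i := (delta_mx 0 i : V).
Variables (U : set V) (a : V -> 'M[R]_n) (b : V -> V) (L : V * V -> R).
Hypothesis HD : randers_data U a b L.
Let oU := rd_open HD.
Let Ca := rd_Ca HD.
Let Cb := rd_Cb HD.
Let asym := rd_sym HD.
Let apos := rd_pos HD.
Let CL := rd_CL HD.
Let LE := rd_LE HD.
Let gpos := rd_gpos HD.
Let slit := slit U.

Definition metric_inverse (x : V) : 'M[R]_n := invmx (a x).
Local Notation h := metric_inverse.
Definition db (x : V) : 'M[R]_n := \matrix_(k, l) ('D_(e_ k) b x) 0 l.
(** As [db] has the direction of differentiation as its row index, this is the transpose of the
    usual s_ij = (b_{i;j} - b_{j;i})/2, and [y *m curl x] is s_{i0}. *)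
Definition curl (x : V) : 'M[R]_n := 2^-1 *: (db x - (db x)^T).
Definition grad_form (x v w : V) : V := \row_l dot (v *m 'D_(e_ l) a x) w.
Definition christoffel (x v w : V) : V :=
  2^-1 *: ((v *m 'D_w a x + w *m 'D_v a x - grad_form x v w) *m h x).
Definition Gbar (z : V * V) : V := 2^-1 *: christoffel z.1 z.2 z.2.
Definition S (x y : V) : V := y *m curl x *m h x.
(* In the usual Randers notation [S], [sform], [rform], [eform] and [Pf] are s^i_0, s_j,
   r_00, e_00 and P, so that the spray is Gbar^i + P y^i + alpha s^i_0. *)
Definition sform (x : V) : V := - (b x *m h x *m curl x).
(** Defined as L - beta rather than as a square root, so that smoothness is inherited from [L];
    [alphaE] recovers the root on nonzero vectors. *)
Definition alpha (z : V * V) : R := L z - dot (b z.1) z.2.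
Definition rform (z : V * V) : R := dot ('D_(z.2) b z.1) z.2 - 2 * dot (Gbar z) (b z.1).
Definition eform (z : V * V) : R := rform z + 2 * dot (b z.1) z.2 * dot (sform z.1) z.2.
Definition Pf (z : V * V) : R := eform z / (2 * L z) - dot (sform z.1) z.2.
Definition Gspray (z : V * V) : V := Gbar z + Pf z *: z.2 + alpha z *: S z.1 z.2.

Lemma open_slit : open slit.
Proof.
rewrite (_ : slit = [set z | U z.1] `&` [set z | z.2 != 0])//.
apply: openI; first exact: open_fst.
apply: (@open_snd _ _ _ [set y : V | y != 0]).
rewrite (_ : [set y : V | y != 0] = ~` [set y | dot (y - 0) (y - 0) <= 0]).
  by apply: closed_openC; exact: closed_sqdist_le.
by apply/seteqP; split => y /=; rewrite subr0 -dot_gt0 ltNge => /negP.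
Qed.

Lemma aunit x : U x -> a x \in unitmx.
Proof. by move=> Ux; apply: posdef_unitmx; exact: apos. Qed.

Lemma hsym x : U x -> (h x)^T = h x.
Proof. by move=> Ux; apply: invmx_sym; exact: asym. Qed.

Lemma mulmxha x : U x -> h x *m a x = 1%:M.
Proof. by move=> Ux; rewrite mulVmx// aunit. Qed.

Lemma hK x (v : V) : U x -> v *m h x *m a x = v.
Proof. by move=> Ux; rewrite -mulmxA mulmxha// mulmx1. Qed.

Lemma differentiable_a x : U x -> differentiable a x.
Proof. exact: (Ca 0).1. Qed.

Lemma differentiable_b x : U x -> differentiable b x.
Proof. exact: (Cb 0).1. Qed.

Lemma differentiable_L z : slit z -> differentiable L z.
Proof. exact: (CL 0).1. Qed.

Lemma Dasym x v : U x -> ('D_v a x)^T = 'D_v a x.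
Proof.
move=> Ux; have d := isd_diff v (differentiable_a Ux).
rewrite -(isd_val (isd_trmx d)); apply: near_eq_derive.
by apply: filterS (open_nbhs_nbhs (conj oU Ux)) => y Uy; rewrite asym.
Qed.

Lemma alphaE z : slit z -> alpha z = Num.sqrt (dot (z.2 *m a z.1) z.2).
Proof. by case: z => x y [/= Ux y0]; rewrite /alpha LE//= addrK. Qed.

Lemma alpha_gt0 z : slit z -> 0 < alpha z.
Proof. by move=> sz; rewrite alphaE// sqrtr_gt0; apply: apos; case: sz. Qed.

Lemma alpha_sqr z : slit z -> alpha z ^+ 2 = dot (z.2 *m a z.1) z.2.
Proof. by move=> sz; rewrite alphaE// sqr_sqrtr// ltW//; apply: apos; case: sz. Qed.

Lemma Ck_alpha k : Ck k slit alpha.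
Proof.
have sub : slit `<=` [set z | U z.1] by move=> z [].
apply: (Ck_sub2 open_slit (CL k)); apply: (Ck_dot open_slit).
  by apply: (Ck_sub sub); apply: Ck_fst.
apply: (@Ck_sub _ _ _ _ [set z | [set: V] z.2]) => //.
apply: (@Ck_snd R V V V k setT id openT).
by apply: (Ck_entries openT) => i j; rewrite ord1; exact: Ck_coord.
Qed.

Lemma isd_snd_id (z v : V * V) : is_derive z v snd v.2.
Proof. by have := isd_diff v (differentiable_snd z); rewrite derive_snd. Qed.

Lemma isd_alpha z v : slit z -> is_derive z v alpha
  ((dot (z.2 *m 'D_(v.1) a z.1) z.2 + 2 * dot (z.2 *m a z.1) v.2) / (2 * alpha z)).
Proof.
move=> sz; have [Uz z0] := sz; have al0 : alpha z != 0 by rewrite gt_eqF// alpha_gt0.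
have da := isd_diff v ((Ck_alpha 0).1 z sz).
have d1 := isd_mul da da.
have hy := isd_snd_id z v.
have d2 := isd_dot (isd_mulmx hy (isd_fst v (differentiable_a Uz))) hy.
have E : 'D_v alpha z * alpha z + alpha z * 'D_v alpha z =
   dot (z.2 *m 'D_(v.1) a z.1) z.2 + 2 * dot (z.2 *m a z.1) v.2.
  transitivity ('D_v (fun w : V * V => dot (w.2 *m a w.1) w.2) z).
    rewrite -(isd_val d1); apply: near_eq_derive.
    apply: filterS (open_nbhs_nbhs (conj open_slit sz)) => w sw.
    by rewrite -expr2 alpha_sqr.
  by rewrite (isd_val d2) dotDl (dot_mulmx v.2) asym// (dotC v.2); ring.
apply: (is_derive_eq da); rewrite -E.
by field.
Qed.

Lemma isd_L z v : slit z -> is_derive z v L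
  ((dot (z.2 *m 'D_(v.1) a z.1) z.2 + 2 * dot (z.2 *m a z.1) v.2) / (2 * alpha z) +
   (dot ('D_(v.1) b z.1) z.2 + dot (b z.1) v.2)).
Proof.
move=> sz; have [Uz z0] := sz.
have hb := isd_dot (isd_fst v (differentiable_b Uz)) (isd_snd_id z v).
have := isd_add (isd_alpha v sz) hb.
by rewrite (_ : (fun w => _) = L)//; apply/funext => w; rewrite /alpha subrK.
Qed.

Definition ell (z : V * V) : V := (alpha z)^-1 *: (z.2 *m a z.1) + b z.1.

Lemma derive_Ly z w : slit z -> 'D_(0, w) L z = dot (ell z) w.
Proof.
move=> sz; rewrite (isd_val (isd_L (0, w) sz))/= !derive0 mulmx0 !dot0l !add0r.
rewrite /ell dotDl dotZl; congr (_ + _).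
by field; rewrite gt_eqF// alpha_gt0.
Qed.

Definition Lx v (z : V * V) : R :=
  dot (z.2 *m 'D_v a z.1) z.2 / (2 * alpha z) + dot ('D_v b z.1) z.2.

Lemma derive_Lx z v : slit z -> 'D_(v, 0) L z = Lx v z.
Proof.
by move=> sz; rewrite (isd_val (isd_L (v, 0) sz))/= !dot0r mulr0 !addr0.
Qed.

Lemma isd_alpha_y z w : slit z -> is_derive z (0, w) alpha (dot (z.2 *m a z.1) w / alpha z).
Proof.
move=> sz; apply: is_derive_eq (isd_alpha (0, w) sz) _.
rewrite /= derive0 mulmx0 dot0l add0r; field.
by rewrite gt_eqF// alpha_gt0.
Qed.

Lemma isd_fst_y (Z : normedModType R) (f : V -> Z) z w :
  differentiable f z.1 -> is_derive z ((0, w) : V * V) (fun z => f z.1) 0.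
Proof. by move=> df; have := isd_fst (0, w) df; rewrite /= derive0. Qed.

Lemma isd_ell_y z w : slit z -> is_derive z (0, w) ell
  ((alpha z)^-1 *: (w *m a z.1) -
   (dot (z.2 *m a z.1) w / alpha z ^+ 3) *: (z.2 *m a z.1)).
Proof.
move=> sz; have [Uz z0] := sz; have al0 : alpha z != 0 by rewrite gt_eqF// alpha_gt0.
have h1 := isd_inv al0 (isd_alpha_y w sz).
have h2 := isd_mulmx (isd_snd_id z (0, w)) (isd_fst_y w (differentiable_a Uz)).
have := isd_addmx (isd_scalemx h1 h2) (isd_fst_y w (differentiable_b Uz)).
move=> hh; apply: (is_derive_eq hh).
rewrite /= mulmx0 !addr0; move: (z.2 *m a z.1) (w *m a z.1) => et wa.
by apply/rowP => j; rewrite !mxE; field.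
Qed.

Lemma derive_sqF z v : slit z -> 'D_v (sqF L) z = 2 * L z * 'D_v L z.
Proof.
move=> sz; have := isd_exp 2 (isd_diff v (differentiable_L sz)).
by move=> /isd_val; rewrite /= expr1.
Qed.

(** This is g = F_y F_y + F F_yy, where [ell] is F_y and the vertical Hessian of F is that of
    [alpha], because beta is linear in y. *)
Lemma fundamental_tensorE z : slit z -> fundamental_tensor L z =
  (ell z)^T *m ell z + (L z / alpha z) *:
    (a z.1 - (alpha z ^- 2) *: ((z.2 *m a z.1)^T *m (z.2 *m a z.1))).
Proof.
move=> sz; have [Uz z0] := sz; have al0 : alpha z != 0 by rewrite gt_eqF// alpha_gt0.
apply/matrixP => i j; rewrite mxE.
have -> : 'D_(dy R i) ('D_(dy R j) (sqF L)) z =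
    'D_(0, e_ i) (fun w => 2 * (L w * ell w 0 j)) z.
  apply: near_eq_derive; apply: filterS (open_nbhs_nbhs (conj open_slit sz)) => w sw.
  by rewrite derive_sqF// derive_Ly// dot_deltar mulrA.
have dL : is_derive z (0, e_ i) L (ell z 0 i).
  by have := isd_diff (0, e_ i) (differentiable_L sz); rewrite derive_Ly// dot_deltar.
have de := (isd_mx _ _ _ _).2 (isd_ell_y (e_ i) sz) 0 j.
rewrite (isd_val (isd_scale 2 (isd_mul dL de))).
move: (ell z) (z.2 *m a z.1) al0 => l et al0.
rewrite -rowE !mxE !big_ord1 !mxE dot_deltar; field.
exact: al0.
Qed.

Implicit Types (x y v w p : V) (z : V * V).

Lemma sum_Da x v p w : U x ->
  \sum_k v 0 k * dot (p *m 'D_(e_ k) a x) w = dot (p *m 'D_v a x) w.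
Proof.
move=> Ux; rewrite (derive_basis v (differentiable_a Ux)) mulmx_sumr dot_suml.
by apply: eq_bigr => k _; rewrite -scalemxAr dotZl.
Qed.

Lemma sum_Db x v w : U x -> \sum_k v 0 k * dot ('D_(e_ k) b x) w = dot ('D_v b x) w.
Proof.
move=> Ux; rewrite (derive_basis v (differentiable_b Ux)) dot_suml.
by apply: eq_bigr => k _; rewrite dotZl.
Qed.

Lemma sum_Lx v z : U z.1 -> \sum_k v 0 k * Lx (e_ k) z = Lx v z.
Proof.
move=> Uz; rewrite /Lx.
under eq_bigr => k _ do rewrite mulrDr mulrA.
by rewrite big_split/= -mulr_suml (sum_Da v z.2 z.2 Uz) (sum_Db v z.2 Uz).
Qed.

Lemma mul_db x v : U x -> v *m db x = 'D_v b x.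
Proof.
move=> Ux; apply/rowP => l; rewrite (derive_basis v (differentiable_b Ux)) mxE summxE.
by apply: eq_bigr => k _; rewrite !mxE.
Qed.

Lemma mul_dbT x v l : (v *m (db x)^T) 0 l = dot ('D_(e_ l) b x) v.
Proof. by rewrite mxE; apply: eq_bigr => k _; rewrite !mxE mulrC. Qed.

Lemma CDa k v : Ck k U ('D_v a).
Proof. exact: CkS_derive (Ca k.+1). Qed.

Lemma CDb k v : Ck k U ('D_v b).
Proof. exact: CkS_derive (Cb k.+1). Qed.

Lemma isd_Lx_y z v w : slit z -> is_derive z (0, w) (Lx v)
  (dot (z.2 *m 'D_v a z.1) w / alpha z
   - dot (z.2 *m 'D_v a z.1) z.2 * dot (z.2 *m a z.1) w / (2 * alpha z ^+ 3)
   + dot ('D_v b z.1) w).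
Proof.
move=> sz; have [Uz z0] := sz; have al0 : alpha z != 0 by rewrite gt_eqF// alpha_gt0.
have al20 : 2 * alpha z != 0 by rewrite mulf_neq0// pnatr_eq0.
have hy := isd_snd_id z (0, w).
have hA := isd_fst_y w ((CDa 0 v).1 _ Uz).
have hB := isd_fst_y w ((CDb 0 v).1 _ Uz).
have h1 := isd_dot (isd_mulmx hy hA) hy.
have h2 := @isd_inv _ _ (fun z => 2 * alpha z) _ _ _ al20 (isd_scale 2 (isd_alpha_y w sz)).
have hh := isd_add (isd_mul h1 h2) (isd_dot hB hy).
apply: (is_derive_eq hh).
rewrite /= mulmx0 addr0 dot0l add0r (dot_mulmx w) Dasym// (dotC w).
by field.
Qed.

Lemma grad_form_dot x y v : U x -> dot (grad_form x y y) v = dot (y *m 'D_v a x) y.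
Proof.
move=> Ux; rewrite -sum_Da//; apply: eq_bigr => l _.
by rewrite [_ 0 l]mxE mulrC.
Qed.

Lemma curl_antisym x : (curl x)^T = - curl x.
Proof. by rewrite /curl linearZ/= linearB/= trmxK -scalerN opprB. Qed.

Lemma curl_dot x y : dot (y *m curl x) y = 0.
Proof.
have : dot (y *m curl x) y = - dot (y *m curl x) y.
  by rewrite {1}dot_mulmx curl_antisym mulmxN dotNr dotC.
by move=> h; lra.
Qed.

Lemma S_a x y : U x -> S x y *m a x = y *m curl x.
Proof. by move=> Ux; rewrite /S hK. Qed.

Lemma dot_S_b x y : U x -> dot (S x y) (b x) = dot (sform x) y.
Proof.
move=> Ux; rewrite /S dot_mulmx hsym// dot_mulmx curl_antisym mulmxN dotNr.
by rewrite /sform dotNl dotC.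
Qed.

Lemma Gbar_a z : U z.1 -> Gbar z *m a z.1 =
  2^-1 *: (z.2 *m 'D_(z.2) a z.1) - 4^-1 *: grad_form z.1 z.2 z.2.
Proof.
move=> Uz; rewrite /Gbar /christoffel -!scalemxAl hK//.
move: (_ *m _) (grad_form _ _ _) => A B.
by apply/rowP => i; rewrite !mxE; field.
Qed.

Lemma dot_S_ya x y : U x -> dot (y *m a x) (S x y) = 0.
Proof. by move=> Ux; rewrite dotC -{1}(asym Ux) -dot_mulmx S_a// curl_dot. Qed.

Lemma dot_Gspray_ya z : slit z -> dot (Gspray z) (z.2 *m a z.1) =
  4^-1 * dot (z.2 *m 'D_(z.2) a z.1) z.2 + Pf z * alpha z ^+ 2.
Proof.
move=> sz; have [Uz z0] := sz.
rewrite /Gspray !dotDl (dotZl (Pf z)) (dotZl (alpha z)) (dotC (S _ _)) dot_S_ya// mulr0 addr0.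
rewrite (dotC z.2) -alpha_sqr//; congr (_ + _).
rewrite -{1}(asym Uz) -dot_mulmx Gbar_a// dotDl dotNl !dotZl grad_form_dot//.
by field.
Qed.

Lemma L_alpha z : L z = alpha z + dot (b z.1) z.2.
Proof. by rewrite /alpha subrK. Qed.

(* Euler's identity g_z(z.2, z.2) = F^2, read off the explicit tensor. *)
Lemma L_neq0 z : slit z -> L z != 0.
Proof.
move=> sz; have [Uz z0] := sz; have := gpos sz z0.
apply: contraTneq => L0.
have -> : fundamental_tensor L z = (ell z)^T *m ell z.
  by rewrite fundamental_tensorE// L0 mul0r scale0r addr0.
have el : dot z.2 (ell z) = 0.
  rewrite dotC /ell dotDl dotZl -alpha_sqr// expr2 mulKf ?gt_eqF ?alpha_gt0//.
  by rewrite -L_alpha.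
by rewrite mulmxA row_mul_tr el mul_scalar_mx scale0r dot0l ltxx.
Qed.

(** F is constant along the flow of its spray: y^i F_{x^i} = 2 G^i F_{y^i}. The coefficient [Pf] is
    exactly the one for which this holds. *)
Lemma dot_Gspray_ell z : slit z -> 2 * dot (Gspray z) (ell z) = Lx z.2 z.
Proof.
move=> sz; have L0 := L_neq0 sz; have [Uz z0] := sz; have al0 : alpha z != 0 by rewrite gt_eqF// alpha_gt0.
rewrite /ell dotDr dotZr dot_Gspray_ya// /Gspray !dotDl (dotZl (Pf z)) (dotZl (alpha z)) (dotC z.2) dot_S_b//.
rewrite /Lx /Pf /eform /rform (L_alpha z).
rewrite (L_alpha z) in L0; field.
by rewrite L0 al0.
Qed.

(** The candidate [Gspray] is tested in the linear system that defines the spray, so the inverse of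
    the fundamental tensor never has to be computed. *)
Lemma spray_source z : slit z ->
  \row_l (\sum_k 'D_(dy R l) ('D_(dx R k) (sqF L)) z * z.2 0 k - 'D_(dx R l) (sqF L) z) =
  4 *: (Gspray z *m fundamental_tensor L z).
Proof.
move=> sz; have L0 := L_neq0 sz; have [Uz z0] := sz; have al0 : alpha z != 0 by rewrite gt_eqF// alpha_gt0.
rewrite fundamental_tensorE//; set et := z.2 *m a z.1.
rewrite mulmxDr mulmxA -scalemxAr mulmxBr -scalemxAr (mulmxA _ et^T).
rewrite !row_mul_tr !mul_scalar_mx {}/et dot_Gspray_ya//.
have -> : dot (Gspray z) (ell z) = 2^-1 * Lx z.2 z.
  by rewrite -dot_Gspray_ell// mulrA mulVf ?mul1r// pnatr_eq0.
have -> : Gspray z *m a z.1 = 2^-1 *: (z.2 *m 'D_(z.2) a z.1) - 4^-1 *: grad_form z.1 z.2 z.2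
   + Pf z *: (z.2 *m a z.1) + alpha z *: (z.2 *m curl z.1).
  by rewrite /Gspray !mulmxDl Gbar_a// -!scalemxAl S_a.
apply/rowP => l; rewrite mxE.
have -> : \sum_k 'D_(dy R l) ('D_(dx R k) (sqF L)) z * z.2 0 k =
  2 * ell z 0 l * Lx z.2 z + 2 * L z * (
  dot (z.2 *m 'D_(z.2) a z.1) (e_ l) / alpha z
   - dot (z.2 *m 'D_(z.2) a z.1) z.2 * dot (z.2 *m a z.1) (e_ l) / (2 * alpha z ^+ 3)
   + dot ('D_(z.2) b z.1) (e_ l)).
  have E k : 'D_(dy R l) ('D_(dx R k) (sqF L)) z =
      2 * (ell z 0 l * Lx (e_ k) z + L z * (dot (z.2 *m 'D_(e_ k) a z.1) (e_ l) / alpha z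
   - dot (z.2 *m 'D_(e_ k) a z.1) z.2 * dot (z.2 *m a z.1) (e_ l) / (2 * alpha z ^+ 3)
   + dot ('D_(e_ k) b z.1) (e_ l))).
    have dL : is_derive z (0, e_ l) L (ell z 0 l).
      by have := isd_diff (0, e_ l) (differentiable_L sz); rewrite derive_Ly// dot_deltar.
    rewrite -(isd_val (isd_scale 2 (isd_mul dL (isd_Lx_y (e_ k) (e_ l) sz)))).
    apply: near_eq_derive; apply: filterS (open_nbhs_nbhs (conj open_slit sz)) => w sw.
    by rewrite derive_sqF// derive_Lx// mulrA.
  pose c := 2 * L z * (dot (z.2 *m a z.1) (e_ l) / (2 * alpha z ^+ 3)).
  transitivity (\sum_k (2 * ell z 0 l * (z.2 0 k * Lx (e_ k) z) +
     (2 * L z / alpha z * (z.2 0 k * dot (z.2 *m 'D_(e_ k) a z.1) (e_ l)) +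
     (- c * (z.2 0 k * dot (z.2 *m 'D_(e_ k) a z.1) z.2) +
      2 * L z * (z.2 0 k * dot ('D_(e_ k) b z.1) (e_ l)))))).
    by apply: eq_bigr => k _; rewrite E /c; field.
  rewrite !big_split/= -!mulr_sumr sum_Lx// !sum_Da// sum_Db// /c.
  by field.
have -> : 'D_(dx R l) (sqF L) z =
   2 * L z * (grad_form z.1 z.2 z.2 0 l / (2 * alpha z) + (z.2 *m (db z.1)^T) 0 l).
  by rewrite derive_sqF// derive_Lx// /Lx mul_dbT [grad_form _ _ _ _ _]mxE.
rewrite !dot_deltar -mul_db// /curl -scalemxAr mulmxBr.
rewrite L_alpha in L0 *.
move: (z.2 *m db z.1) (z.2 *m (db z.1)^T) (z.2 *m 'D_(z.2) a z.1) (grad_form _ _ _) => B1 B2 A1 A2.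
rewrite /ell; move: (z.2 *m a z.1) => et; rewrite !mxE.
by field.
Qed.

Lemma sprayE z i : slit z -> spray L i z = Gspray z 0 i.
Proof.
move=> sz; have [Uz z0] := sz.
have gu := posdef_unitmx (gpos sz).
have gs : (fundamental_tensor L z)^T = fundamental_tensor L z.
  rewrite fundamental_tensorE// linearD/= trmx_mul trmxK linearZ/= linearB/= linearZ/=.
  by rewrite trmx_mul trmxK asym.
rewrite /spray; have := congr1 (fun r : V => (4^-1 *: (r *m invmx (fundamental_tensor L z))) 0 i)
  (spray_source sz).
rewrite -scalemxAl mulmxK// scalerA mulVf ?scale1r ?pnatr_eq0// => <-.
rewrite [RHS]mxE; congr (4^-1 * _); rewrite mxE; apply: eq_bigr => l _.
by rewrite [in RHS]mxE [RHS]mulrC -{1}(invmx_sym gs) [in LHS]mxE.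
Qed.

End RandersSpray.

(** * The Ricci curvature of a Randers metric *)

Section MoreCk.
Variable (R : realType).

Lemma Ck_oppmx k (W : normedModType R) (A : set W) p q (M : W -> 'M[R]_(p, q)) :
  open A -> Ck k A M -> Ck k A (fun x => - M x).
Proof.
move=> oA hM; apply: (Ck_entries oA) => i j.
rewrite (_ : (fun y => _) = (fun y => - M y i j)).
  by apply: (Ck_opp oA); exact: Ck_mx.
by apply/funext => y; rewrite mxE.
Qed.

Lemma Ck_constscalemx k (W : normedModType R) (A : set W) p q c (M : W -> 'M[R]_(p, q)) :
  open A -> Ck k A M -> Ck k A (fun x => c *: M x).
Proof. by move=> oA hM; apply: (Ck_scalemx oA _ hM); exact: Ck_cst. Qed.

Lemma isd_cstW (V W : normedModType R) (x v : V) (c : W) : is_derive x v (fun _ => c) 0.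
Proof. exact: is_derive_cst. Qed.

Lemma isd_mulmx0r (V : normedModType R) m n p (M : V -> 'M[R]_(m, n)) (N : V -> 'M[R]_(n, p)) x v dM :
  is_derive x v M dM -> is_derive x v N 0 ->
  is_derive x v (fun z => M z *m N z) (dM *m N x).
Proof. by move=> hM hN; apply: (is_derive_eq (isd_mulmx hM hN)); rewrite mulmx0 addr0. Qed.

Lemma isd_mulmxl (V : normedModType R) m n p (c : 'M[R]_(m, n)) (N : V -> 'M[R]_(n, p)) x v dN :
  is_derive x v N dN -> is_derive x v (fun z => c *m N z) (c *m dN).
Proof. by move=> hN; apply: (is_derive_eq (isd_mulmx (isd_cstW x v c) hN)); rewrite mul0mx add0r. Qed.

Lemma isd_scalemxl (V : normedModType R) m n (c : R) (N : V -> 'M[R]_(m, n)) x v dN :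
  is_derive x v N dN -> is_derive x v (fun z => c *: N z) (c *: dN).
Proof. by move=> hN; apply: (is_derive_eq (isd_scalemx (isd_cst x v c) hN)); rewrite scale0r add0r. Qed.

Lemma isd_dotl (V : normedModType R) n (f : V -> 'rV[R]_n) (c : 'rV[R]_n) x v df :
  is_derive x v f df -> is_derive x v (fun z => dot (f z) c) (dot df c).
Proof. by move=> hf; apply: (is_derive_eq (isd_dot hf (isd_cstW x v c))); rewrite dot0r addr0. Qed.

End MoreCk.

Section DirectionalField.
Variables (R : realType) (n : nat).
Notation V := 'rV[R]_n.
Notation e_ i := (delta_mx 0 i : V).
Variables (U : set V) (p q : nat) (f : V -> 'M[R]_(p, q)).
Hypothesis oU : open U.
Hypothesis Cf : forall k, Ck k U f.
Implicit Types (z : V * V) (w : V).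

Let Df_sum z i j : U z.1 ->
  ('D_(z.2) f z.1) i j = \sum_k z.2 0 k * ('D_(e_ k) f z.1) i j.
Proof.
move=> Uz; rewrite (derive_basis _ ((Cf 0).1 _ Uz)) summxE.
by apply: eq_bigr => k _; rewrite mxE.
Qed.

Lemma Ck_snd_coord k (W : set (V * V)) l : Ck k W (fun z : V * V => z.2 0 l).
Proof.
apply: (@Ck_sub _ _ _ _ [set z | [set: V] z.2]) => //.
by apply: (@Ck_snd R V V R k setT (fun y : V => y 0 l) openT); exact: Ck_coord.
Qed.

Lemma Ck_snd_id k (W : set (V * V)) : open W -> Ck k W (fun z : V * V => z.2).
Proof. by move=> oW; apply: (Ck_entries oW) => i j; rewrite ord1; exact: Ck_snd_coord. Qed.

Lemma Ck_directional k : Ck k [set z : V * V | U z.1] (fun z => 'D_(z.2) f z.1).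
Proof.
have oW := @open_fst R V V _ oU.
apply: (Ck_entries oW) => i j.
have h : Ck k [set z : V * V | U z.1] (fun z => \sum_k z.2 0 k * ('D_(e_ k) f z.1) i j).
  apply: (Ck_sum oW) => l _; apply: (Ck_mul oW); first exact: Ck_snd_coord.
  apply: (Ck_mx oW); apply: (@Ck_fst R V V _ k U ('D_(e_ l) f) oU).
  exact: CkS_derive (Cf k.+1).
by apply: (Ck_ext oW _ h) => z Uz; exact: (esym (Df_sum i j Uz)).
Qed.

Lemma isd_directional z w : U z.1 ->
  is_derive z (0, w) (fun z => 'D_(z.2) f z.1) ('D_w f z.1).
Proof.
move=> Uz; apply/isd_mx => i j.
have oW := @open_fst R V V _ oU.
have -> : ('D_w f z.1) i j = \sum_k (w 0 k * ('D_(e_ k) f z.1) i j + z.2 0 k * 0).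
  rewrite (derive_basis _ ((Cf 0).1 _ Uz)) summxE.
  by apply: eq_bigr => k _; rewrite mxE mulr0 addr0.
have h : is_derive z (0, w) (fun z : V * V => \sum_k z.2 0 k * ('D_(e_ k) f z.1) i j)
    (\sum_k (w 0 k * ('D_(e_ k) f z.1) i j + z.2 0 k * 0)).
  apply: isd_sum => k _; apply: isd_mul.
    exact: ((isd_mx _ _ _ _).2 (isd_snd_id z (0, w)) 0 k).
  have := isd_fst_y w ((CkS_derive (e_ k) (Cf 1)).1 _ Uz).
  by move=> /isd_mx/(_ i j); rewrite mxE.
apply: near_eq_is_derive h.
by apply: filterS (open_nbhs_nbhs (conj oW Uz)) => z' Uz'; exact: (esym (Df_sum i j Uz')).
Qed.

End DirectionalField.

Section Parity.
Variables (R : realType) (n : nat).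
Notation V := 'rV[R]_n.
Implicit Types (z v : V * V).

Definition flip z : V * V := (z.1, - z.2).

Lemma derive_flip (f : V * V -> R) z v : 'D_v f (flip z) = 'D_(flip v) (f \o flip) z.
Proof.
rewrite /derive; set A := (fun h => _); set B := (fun h => _).
suff -> : A = B by []; apply/funext => h; rewrite /A /B /=.
suff -> : h *: v + flip z = flip (h *: flip v + z) by [].
by rewrite /flip/= opprD scalerN opprK.
Qed.

End Parity.

(** * Traces of the vertical Jacobian of the spray *)

Section TraceAlgebra.
Variables (R : realType) (n : nat).
Implicit Types (A N s : 'M[R]_n) (p q y S : 'rV[R]_n).

Lemma trace_rank1 p y A : \tr (A *m (p^T *m y)) = dot (y *m A) p.
Proof.
rewrite mulmxA mxtrace_mulC mulmxA row_mul_tr /mxtrace big_ord1 mxE eqxx mulr1n.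
by [].
Qed.

Variables (N s : 'M[R]_n) (p q y S : 'rV[R]_n) (P al : R).
Hypotheses (yp : dot y p = P) (yq : dot y q = al) (Sq : dot S q = 0)
  (trs : \tr s = 0) (ys : y *m s = S).
(** In the application [p] and [q] are the vertical gradients of [Pf] and [alpha], so [K] is the
    vertical Jacobian of Pf y + alpha S. The hypotheses on [y] are Euler's relations; those on [S]
    and [s] come from the antisymmetry of the curl. *)
Let K := p^T *m y + (P%:M + (q^T *m S + al *: s)).

Let trK A : \tr (A *m K) = dot (y *m A) p + (P * \tr A + (dot (S *m A) q + al * \tr (A *m s))).
Proof.
rewrite /K !mulmxDr !linearD/= !trace_rank1 mul_mx_scalar linearZ/=.
by rewrite -scalemxAr linearZ.
Qed.

Lemma trace_spray_jacobian : \tr (N + K) = \tr N + (n%:R + 1) * P.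
Proof.
have := trK 1%:M; rewrite !mul1mx !mulmx1 yp Sq trs mxtrace1 => h.
by rewrite linearD/= h; congr (_ + _); ring.
Qed.

Lemma trace_spray_jacobian2 : \tr ((N + K) *m (N + K)) =
  \tr (N *m N) + 2 * (dot (y *m N) p + P * \tr N + dot (S *m N) q + al * \tr (N *m s))
  + ((n%:R + 3) * P ^+ 2 + 4 * al * dot S p + 2 * al * dot (S *m s) q + al ^+ 2 * \tr (s *m s)).
Proof.
have yK : y *m K = (2 * P) *: y + (2 * al) *: S.
  rewrite /K !mulmxDr !mulmxA !row_mul_tr !mul_scalar_mx mul_mx_scalar -scalemxAr ys yp yq.
  by move: y S => y' S'; apply/rowP => i; rewrite !mxE; ring.
have SK : S *m K = dot S p *: y + (P *: S + al *: (S *m s)).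
  rewrite /K !mulmxDr !mulmxA !row_mul_tr !mul_scalar_mx mul_mx_scalar -scalemxAr Sq.
  by rewrite scale0r add0r.
have tK : \tr K = (n%:R + 1) * P.
  have := trK 1%:M; rewrite !mul1mx !mulmx1 yp Sq trs mxtrace1 => ->.
  by ring.
rewrite (mulmxDl N K) (mulmxDr N N K) (mulmxDr K N K) !mxtraceD (mxtrace_mulC K N) !trK.
rewrite (mxtrace_mulC K s) trK.
rewrite yK SK tK trs ys !dotDl !dotZl yp yq Sq.
move: (dot (y *m N) p) (\tr N) (dot (S *m N) q) (\tr (N *m s)) (\tr (N *m N)) (dot S p) (dot (S *m s) q) (\tr (s *m s)).
by move=> *; ring.
Qed.

End TraceAlgebra.

Section RicciFormula.
Variables (R : realType) (n : nat).
Notation V := 'rV[R]_n.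
Notation e_ i := (delta_mx 0 i : V).
Variables (U : set V) (a : V -> 'M[R]_n) (b : V -> V) (L : V * V -> R).
Hypothesis HD : randers_data U a b L.
Let oU := rd_open HD.
Let Ca := rd_Ca HD.
Let Cb := rd_Cb HD.
Let asym := rd_sym HD.
Local Notation slit := (slit U).
Local Notation h := (metric_inverse a).
Local Notation alpha := (alpha b L).
Local Notation Gbar := (Gbar a).
Local Notation christoffel := (christoffel a).
Local Notation S := (S a b).
Local Notation sform := (sform a b).
Local Notation curl := (curl b).
Local Notation rform := (rform a b).
Local Notation eform := (eform a b).
Local Notation Pf := (Pf a b L).
Local Notation Gs := (Gspray a b L).
Implicit Types (x y v w : V) (z : V * V).
Let oS : open slit := open_slit HD.

Let subU : slit `<=` [set z : V * V | U z.1]. Proof. by move=> z []. Qed.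

Lemma Ck_slit_fst (Z : normedModType R) k (f : V -> Z) :
  Ck k U f -> Ck k slit (fun z => f z.1).
Proof. by move=> Cf; apply: (Ck_sub subU); exact: (@Ck_fst R V V Z k U f oU Cf). Qed.

Let Cy k : Ck k slit (fun z : V * V => z.2) := Ck_snd_id k oS.

Lemma Ck_metric_inverse k : Ck k U h.
Proof. by apply: (Ck_invmx_mx oU) => //; exact: (aunit HD). Qed.

Lemma Ck_db k : Ck k U (db b).
Proof.
apply: (Ck_entries oU) => i j.
rewrite (_ : (fun y => _) = (fun x => ('D_(e_ i) b x) 0 j)); last first.
  by apply/funext => x; rewrite mxE.
by apply: (Ck_mx oU); exact: CkS_derive (Cb k.+1).
Qed.

Lemma Ck_curl k : Ck k U curl.
Proof.
apply: (Ck_constscalemx _ oU); apply: (Ck_addmx oU (Ck_db k)).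
by apply: (Ck_oppmx oU); apply: (Ck_trmx oU); exact: Ck_db.
Qed.

Lemma Ck_sform k : Ck k U sform.
Proof.
apply: (Ck_oppmx oU); apply: (Ck_mulmx oU _ (Ck_curl k)).
exact: (Ck_mulmx oU (Cb k) (Ck_metric_inverse k)).
Qed.

Lemma Ck_S k : Ck k slit (fun z => S z.1 z.2).
Proof.
apply: (Ck_mulmx oS _ (Ck_slit_fst (Ck_metric_inverse k))).
exact: (Ck_mulmx oS (Cy k) (Ck_slit_fst (Ck_curl k))).
Qed.

Lemma Ck_Day k : Ck k slit (fun z => 'D_(z.2) a z.1).
Proof. by apply: (Ck_sub subU); exact: Ck_directional. Qed.

Lemma Ck_Dby k : Ck k slit (fun z => 'D_(z.2) b z.1).
Proof. by apply: (Ck_sub subU); exact: Ck_directional. Qed.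

Lemma Ck_grad_form k : Ck k slit (fun z => grad_form a z.1 z.2 z.2).
Proof.
apply: (Ck_entries oS) => i j.
rewrite (_ : (fun z => _) = (fun z : V * V => dot (z.2 *m 'D_(e_ j) a z.1) z.2)); last first.
  by apply/funext => z; rewrite mxE.
apply: (Ck_dot oS _ (Cy k)); apply: (Ck_mulmx oS (Cy k)).
apply: (@Ck_slit_fst _ k ('D_(e_ j) a)).
exact: (CkS_derive _ (Ca k.+1)).
Qed.

Lemma Ck_Gbar k : Ck k slit Gbar.
Proof.
apply: (Ck_constscalemx _ oS); apply: (Ck_constscalemx _ oS).
apply: (Ck_mulmx oS _ (Ck_slit_fst (Ck_metric_inverse k))).
have C1 := Ck_mulmx oS (Cy k) (Ck_Day k).
by apply: (Ck_addmx oS (Ck_addmx oS C1 C1)); apply: (Ck_oppmx oS); exact: Ck_grad_form.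
Qed.

Lemma Ck_beta k : Ck k slit (fun z => dot (b z.1) z.2).
Proof. exact: (Ck_dot oS (Ck_slit_fst (Cb k)) (Cy k)). Qed.

Lemma Ck_s0 k : Ck k slit (fun z => dot (sform z.1) z.2).
Proof. exact: (Ck_dot oS (Ck_slit_fst (Ck_sform k)) (Cy k)). Qed.

Lemma Ck_rform k : Ck k slit rform.
Proof.
apply: (Ck_sub2 oS (Ck_dot oS (Ck_Dby k) (Cy k))); apply: (Ck_scale _ oS).
exact: (Ck_dot oS (Ck_Gbar k) (Ck_slit_fst (Cb k))).
Qed.

Lemma Ck_eform k : Ck k slit eform.
Proof.
apply: (Ck_add oS (Ck_rform k)); apply: (Ck_mul oS _ (Ck_s0 k)).
by apply: (Ck_scale _ oS); exact: Ck_beta.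
Qed.

Lemma Ck_Pf k : Ck k slit Pf.
Proof.
apply: (Ck_sub2 oS _ (Ck_s0 k)); apply: (Ck_mul oS (Ck_eform k)).
apply: (Ck_inv oS); last by apply: (Ck_scale _ oS); exact: rd_CL HD k.
by move=> z sz; rewrite mulf_neq0 ?pnatr_eq0//; exact: (L_neq0 HD).
Qed.

Lemma Ck_Gs k : Ck k slit Gs.
Proof.
apply: (Ck_addmx oS _ (Ck_scalemx oS (Ck_alpha HD k) (Ck_S k))).
exact: (Ck_addmx oS (Ck_Gbar k) (Ck_scalemx oS (Ck_Pf k) (Cy k))).
Qed.

Lemma derive_sum_x (W : normedModType R) (f : V * V -> W) z v : differentiable f z ->
  'D_((v, 0) : V * V) f z = \sum_j v 0 j *: 'D_((e_ j, 0) : V * V) f z.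
Proof.
move=> df; have -> : ((v, 0) : V * V) = \sum_j v 0 j *: ((e_ j, 0) : V * V).
  rewrite [v in LHS]row_sum_delta.
  elim/big_rec2 : _ => [//|j p q _ <-].
  by rewrite [RHS]/GRing.add/=/add_pair/= scaler0 addr0.
by rewrite derive_suml//; apply: eq_bigr => j _; rewrite derive_Zl.
Qed.

Lemma derive_sum_y (W : normedModType R) (f : V * V -> W) z v : differentiable f z ->
  'D_((0, v) : V * V) f z = \sum_j v 0 j *: 'D_((0, e_ j) : V * V) f z.
Proof.
move=> df; have -> : ((0, v) : V * V) = \sum_j v 0 j *: ((0, e_ j) : V * V).
  rewrite [v in LHS]row_sum_delta.
  elim/big_rec2 : _ => [//|j p q _ <-].
  by rewrite [RHS]/GRing.add/=/add_pair/= scaler0 addr0.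
by rewrite derive_suml//; apply: eq_bigr => j _; rewrite derive_Zl.
Qed.

Definition Gc i z : R := Gs z 0 i.
(** The vertical divergence of the spray. After taking the trace, the second derivatives of the
    spray in the Riemann curvature occur only as first derivatives of [tau]. *)
Definition tau z : R := \sum_i 'D_((0, e_ i) : V * V) (Gc i) z.

Lemma Ck_Gc k i : Ck k slit (Gc i).
Proof. exact: (Ck_mx oS (Ck_Gs k)). Qed.

Lemma Ck_tau k : Ck k slit tau.
Proof. by apply: (Ck_sum oS) => i _; exact: CkS_derive (Ck_Gc k.+1 i). Qed.

Lemma derive_spray i (v : V * V) z : slit z -> 'D_v (spray L i) z = 'D_v (Gc i) z.
Proof.
move=> sz; apply: near_eq_derive; apply: filterS (open_nbhs_nbhs (conj oS sz)) => z' sz'.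
exact: (sprayE HD).
Qed.

Lemma derive2_spray i (v w : V * V) z : slit z ->
  'D_v ('D_w (spray L i)) z = 'D_v ('D_w (Gc i)) z.
Proof.
move=> sz; apply: near_eq_derive; apply: filterS (open_nbhs_nbhs (conj oS sz)) => z' sz'.
exact: derive_spray.
Qed.

Lemma derive_tau (v : V * V) z : slit z -> 'D_v tau z = \sum_i 'D_v ('D_((0, e_ i) : V * V) (Gc i)) z.
Proof.
move=> sz; apply: isd_val; apply: isd_sum => i _; apply: isd_diff.
exact: (CkS_derive _ (Ck_Gc 1 i)).1.
Qed.

Lemma riemann_trace z : slit z ->
  \sum_i riemann_curvature L i i z =
  2 * \sum_i 'D_((e_ i, 0) : V * V) (Gc i) z - 'D_((z.2, 0) : V * V) tau z
  + 2 * 'D_((0, Gs z) : V * V) tau z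
  - \sum_i \sum_j 'D_((0, e_ j) : V * V) (Gc i) z * 'D_((0, e_ i) : V * V) (Gc j) z.
Proof.
move=> sz; have dt : differentiable tau z by exact: (Ck_tau 0).1.
rewrite (derive_sum_x z.2 dt) (derive_sum_y (Gs z) dt) !mulr_sumr.
have E1 : \sum_j z.2 0 j *: 'D_((e_ j, 0) : V * V) tau z =
    \sum_i \sum_j z.2 0 j * 'D_(dx R j) ('D_(dy R i) (spray L i)) z.
  rewrite exchange_big; apply: eq_bigr => j _.
  by rewrite derive_tau// scaler_sumr; apply: eq_bigr => i _; rewrite derive2_spray.
have E2 : \sum_j 2 * (Gs z 0 j *: 'D_((0, e_ j) : V * V) tau z) =
    \sum_i 2 * \sum_j spray L j z * 'D_(dy R j) ('D_(dy R i) (spray L i)) z.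
  transitivity (\sum_i \sum_j 2 * (spray L j z * 'D_(dy R j) ('D_(dy R i) (spray L i)) z)).
    rewrite exchange_big; apply: eq_bigr => j _; rewrite -mulr_sumr; congr (2 * _).
    rewrite derive_tau// scaler_sumr; apply: eq_bigr => i _.
    by rewrite derive2_spray// (sprayE HD).
  by apply: eq_bigr => i _; rewrite mulr_sumr.
rewrite E1 E2 -!sumrB -big_split -sumrB; apply: eq_bigr => i _ /=.
rewrite /riemann_curvature derive_spray//; congr (_ - _).
by apply: eq_bigr => j _; rewrite !derive_spray.
Qed.

Lemma grad_formDr x v w w' : U x ->
  grad_form a x v (w + w') = grad_form a x v w + grad_form a x v w'.
Proof. by move=> Ux; apply/rowP => l; rewrite !mxE dotDr. Qed.

Lemma grad_formZr x v k w : grad_form a x v (k *: w) = k *: grad_form a x v w.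
Proof. by apply/rowP => l; rewrite !mxE dotZr. Qed.

Let half_comm (A B C : V) (H : 'M[R]_n) :
  2^-1 *: ((A + B - C) *m H) = 2^-1 *: ((B + A - C) *m H).
Proof. by rewrite (addrC A). Qed.

Lemma christoffelC x v w : U x -> christoffel x v w = christoffel x w v.
Proof.
move=> Ux; have E : grad_form a x v w = grad_form a x w v.
  by apply/rowP => l; rewrite !mxE dot_mulmx (Dasym HD)// dotC.
by rewrite /christoffel E; exact: half_comm.
Qed.

Let half_add (A B C A' B' C' : V) (H : 'M[R]_n) :
  2^-1 *: ((A + A' + (B + B') - (C + C')) *m H) =
  2^-1 *: ((A + B - C) *m H) + 2^-1 *: ((A' + B' - C') *m H).
Proof.
rewrite -scalerDr -mulmxDl; congr (_ *: (_ *m _)).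
by rewrite opprD (addrACA A) (addrACA (A + B)).
Qed.

Let half_scale k (A B C : V) (H : 'M[R]_n) :
  2^-1 *: ((k *: A + k *: B - k *: C) *m H) = k *: (2^-1 *: ((A + B - C) *m H)).
Proof. by rewrite -scalerDr -scalerBr -scalemxAl !scalerA mulrC. Qed.

Lemma christoffelDr x v w w' : U x ->
  christoffel x v (w + w') = christoffel x v w + christoffel x v w'.
Proof.
move=> Ux; have E : 'D_(w + w') a x = 'D_w a x + 'D_w' a x.
  by rewrite derive_Dl//; exact: (Ca 0).1.
by rewrite /christoffel grad_formDr// E (mulmxDr v) (mulmxDl w w'); exact: half_add.
Qed.

Lemma christoffelZr x v k w : U x -> christoffel x v (k *: w) = k *: christoffel x v w.
Proof.
move=> Ux; have E : 'D_(k *: w) a x = k *: 'D_w a x.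
  by rewrite derive_Zl//; exact: (Ca 0).1.
by rewrite /christoffel grad_formZr E -(scalemxAr k v) -(scalemxAl k w); exact: half_scale.
Qed.

(** The nonlinear connection of [alpha]: by [isd_Gbar_y] it is the vertical Jacobian of [Gbar]. *)
Definition mN x y : 'M[R]_n := \matrix_(j, i) christoffel x y (e_ j) 0 i.

Lemma mul_mN x y w : U x -> w *m mN x y = christoffel x y w.
Proof.
move=> Ux; rewrite [w in RHS]row_sum_delta.
rewrite (big_morph (christoffel x y) (fun v w => christoffelDr y v w Ux) (id1 := 0)); last first.
  by have := christoffelZr y 0 0 Ux; rewrite !scale0r.
apply/rowP => i; rewrite mxE summxE; apply: eq_bigr => j _.
by rewrite christoffelZr// !mxE.
Qed.

(** Compatibility of the connection with the metric, in the one contraction that the divergence of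
    the spray requires. *)
Lemma christoffel_metric x v w : U x ->
  dot (christoffel x v w *m a x) w = 2^-1 * dot (w *m 'D_v a x) w.
Proof.
move=> Ux; rewrite /christoffel -scalemxAl (hK HD)// dotZl !dotDl dotNl.
have -> : dot (grad_form a x v w) w = dot (v *m 'D_w a x) w.
  rewrite -(sum_Da HD)//; apply: eq_bigr => l _.
  by rewrite [_ 0 l]mxE mulrC.
by rewrite addrAC subrr add0r.
Qed.

Lemma Gbar_mN z : U z.1 -> z.2 *m mN z.1 z.2 = 2 *: Gbar z.
Proof. by move=> Uz; rewrite mul_mN// /Gbar scalerA mulfV ?scale1r// pnatr_eq0. Qed.

Definition smx x : 'M[R]_n := curl x *m h x.

Lemma mul_smx x w : w *m smx x = S x w.
Proof. by rewrite mulmxA. Qed.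

Lemma trace_smx x : U x -> \tr (smx x) = 0.
Proof.
move=> Ux; have : \tr (smx x) = - \tr (smx x).
  rewrite -{1}mxtrace_tr trmx_mul (hsym HD)// curl_antisym mulmxN linearN/=.
  by rewrite mxtrace_mulC.
by move=> hh; lra.
Qed.

Lemma isd_S_y z w : U z.1 -> is_derive z ((0, w) : V * V) (fun z => S z.1 z.2) (S z.1 w).
Proof.
move=> Uz.
have hc := isd_fst_y w ((Ck_curl 0).1 _ Uz); have hh := isd_fst_y w ((Ck_metric_inverse 0).1 _ Uz).
exact: (isd_mulmx0r (isd_mulmx0r (isd_snd_id z (0, w)) hc) hh).
Qed.

Lemma isd_christoffel_y z v w : U z.1 ->
  is_derive z ((0, w) : V * V) (fun z => christoffel z.1 z.2 v) (christoffel z.1 w v).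
Proof.
move=> Uz; have hy := isd_snd_id z (0, w).
have hv := isd_fst_y w ((CkS_derive v (Ca 1)).1 _ Uz).
have hh := isd_fst_y w ((Ck_metric_inverse 0).1 _ Uz).
have h2 := isd_mulmxl v (isd_directional oU Ca w Uz).
have h3 : is_derive z ((0, w) : V * V) (fun z => grad_form a z.1 z.2 v) (grad_form a z.1 w v).
  apply/isd_mx => i j.
  rewrite (_ : (fun z => _) = (fun z : V * V => dot (z.2 *m 'D_(e_ j) a z.1) v)); last first.
    by apply/funext => z'; rewrite mxE.
  have hj := isd_fst_y w ((CkS_derive (e_ j) (Ca 1)).1 _ Uz).
  by apply: (is_derive_eq (isd_dotl v (isd_mulmx0r hy hj))); rewrite mxE.
have hs := isd_addmx (isd_addmx (isd_mulmx0r hy hv) h2) (isd_oppmx h3).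
exact: (isd_scalemxl 2^-1 (isd_mulmx0r hs hh)).
Qed.

Lemma isd_Gbar_y z w : U z.1 ->
  is_derive z ((0, w) : V * V) Gbar (christoffel z.1 z.2 w).
Proof.
move=> Uz; have hy := isd_snd_id z (0, w).
have hh := isd_fst_y w ((Ck_metric_inverse 0).1 _ Uz).
have h1 := isd_mulmx hy (isd_directional oU Ca w Uz).
have h3 : is_derive z ((0, w) : V * V) (fun z => grad_form a z.1 z.2 z.2)
    (2 *: grad_form a z.1 z.2 w).
  apply/isd_mx => i j.
  rewrite (_ : (fun z => _) = (fun z : V * V => dot (z.2 *m 'D_(e_ j) a z.1) z.2)); last first.
    by apply/funext => z'; rewrite mxE.
  have hj := isd_fst_y w ((CkS_derive (e_ j) (Ca 1)).1 _ Uz).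
  have hd := isd_dot (isd_mulmx0r hy hj) hy.
  apply: (is_derive_eq hd); rewrite /= mxE mxE (dot_mulmx w) (Dasym HD)// (dotC w).
  by rewrite mulr_natl mulr2n.
have hs := isd_addmx (isd_addmx h1 h1) (isd_oppmx h3).
have hG := isd_scalemxl 2^-1 (isd_scalemxl 2^-1 (isd_mulmx0r hs hh)).
apply: (is_derive_eq hG).
rewrite /christoffel; congr (_ *: _); rewrite scalemxAl; congr (_ *m _).
move: (w *m 'D_(z.2) a z.1) (z.2 *m 'D_w a z.1) (grad_form _ _ _ _) => A B C.
by apply/rowP => i; rewrite !mxE; field.
Qed.

Definition Ntr z : R := \tr (mN z.1 z.2).

Lemma isd_Ntr_y z w : U z.1 -> is_derive z ((0, w) : V * V) Ntr (\tr (mN z.1 w)).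
Proof.
move=> Uz; rewrite /Ntr /mxtrace; apply: isd_sum => i _.
rewrite (_ : (fun z => _) = (fun z => christoffel z.1 z.2 (e_ i) 0 i)); last first.
  by apply/funext => z'; rewrite mxE.
rewrite mxE.
exact: ((isd_mx _ _ _ _).2 (isd_christoffel_y (e_ i) w Uz) 0 i).
Qed.

(** Differentiate f(x, (1 + t) y) at t = 0; homogeneity is assumed for positive factors only, and 1
    + t is positive near 0. *)
Lemma euler (f : V * V -> R) k z :
  (forall l, 0 < l -> f (z.1, l *: z.2) = l ^+ k * f z) -> 'D_((0, z.2) : V * V) f z = k%:R * f z.
Proof.
move=> hf; pose g (t : R) := (1 + t) ^+ k * f z.
have hg : is_derive (0 : R) (1 : R) g (k%:R * f z).
  have h1 : is_derive (0 : R) (1 : R) (fun t : R => 1 + t) 1.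
    by have := isd_add (isd_cst (0 : R) (1 : R) 1) (is_derive_id (0 : R) (1 : R)); rewrite add0r.
  have := isd_mul (isd_exp k h1) (isd_cst (0 : R) (1 : R) (f z)).
  by rewrite mulr0 addr0 mulr1 addr0 expr1n mulr1.
rewrite -(isd_val hg) -derive1E.
have -> : 'D_((0, z.2) : V * V) f z = derive1 (fun t : R => f (t *: ((0, z.2) : V * V) + z)) 0.
  rewrite /derive /derive1; set A := (fun h => _); set B := (fun h => _).
  by suff -> : A = B by []; apply/funext => t; rewrite /A /B /= addr0 scale0r add0r.
rewrite !derive1E; apply: near_eq_derive.
near=> t; have t1 : 0 < 1 + t.
  rewrite -ltrBlDl sub0r; near: t; apply: (lt_nbhsr (_ : -1 < 0 :> R)).
  by rewrite oppr_lt0.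
rewrite /g -hf//; congr (f _).
suff -> : t *: ((0, z.2) : V * V) + z = (t *: 0 + z.1, t *: z.2 + z.2).
  by rewrite scaler0 add0r scalerDl scale1r addrC.
by case: z {hf g hg}.
Unshelve. all: by end_near. Qed.

Lemma slit_scale z l : slit z -> 0 < l -> slit (z.1, l *: z.2).
Proof. by move=> [Uz z0] l0; split => //=; rewrite scaler_eq0 gt_eqF. Qed.

Lemma alpha_hom z l : slit z -> 0 < l -> alpha (z.1, l *: z.2) = l * alpha z.
Proof.
move=> sz l0; rewrite (alphaE HD (slit_scale sz l0)) (alphaE HD sz)/=.
rewrite -scalemxAl dotZl dotZr mulrA -expr2 sqrtrM ?sqr_ge0// sqrtr_sqr gtr0_norm//.
Qed.

Lemma Gbar_hom z l : U z.1 -> Gbar (z.1, l *: z.2) = l ^+ 2 *: Gbar z.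
Proof.
move=> Uz; rewrite /Gbar/= christoffelZr// christoffelC// christoffelZr//.
by rewrite !scalerA; congr (_ *: _); ring.
Qed.

Lemma rform_hom z l : U z.1 -> rform (z.1, l *: z.2) = l ^+ 2 * rform z.
Proof.
move=> Uz; rewrite /rform Gbar_hom//= derive_Zl; last exact: (Cb 0).1.
rewrite !dotZl dotZr; move: (dot _ _) (dot _ _) => A B; ring.
Qed.

Lemma eform_hom z l : U z.1 -> eform (z.1, l *: z.2) = l ^+ 2 * eform z.
Proof.
move=> Uz; rewrite /eform rform_hom//= !dotZr.
move: (rform z) (dot _ _) (dot _ _) => A B C; ring.
Qed.

Lemma Pf_hom z l : slit z -> 0 < l -> Pf (z.1, l *: z.2) = l ^+ 1 * Pf z.
Proof.
move=> sz l0; have [Uz z0] := sz; have L0 := L_neq0 HD sz.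
rewrite /Pf eform_hom// (L_alpha b L (z.1, l *: z.2)) alpha_hom//= !dotZr.
rewrite (L_alpha b) in L0 *.
move: (eform z) (alpha z) (dot (b z.1) z.2) (dot _ _) L0 => e al be s0 L0.
have -> : 2 * (l * al + l * s0) = l * (2 * (al + s0)) by ring.
by field; rewrite L0 gt_eqF.
Qed.

Lemma Pf_euler z : slit z -> 'D_((0, z.2) : V * V) Pf z = Pf z.
Proof. by move=> sz; rewrite (@euler _ 1) ?mul1r// => l l0; exact: Pf_hom. Qed.

Definition gradP z : V := \row_j 'D_((0, e_ j) : V * V) Pf z.

Lemma derive_Pf_y z w : slit z -> 'D_((0, w) : V * V) Pf z = dot w (gradP z).
Proof.
move=> sz; rewrite derive_sum_y; last exact: (Ck_Pf 0).1.
by apply: eq_bigr => j _; rewrite mxE.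
Qed.

Definition grad_alpha z : V := (alpha z)^-1 *: (z.2 *m a z.1).

Definition jacG z : 'M[R]_n := \matrix_(j, i) 'D_((0, e_ j) : V * V) (Gc i) z.

Lemma jacGE z : slit z -> jacG z = mN z.1 z.2 + ((gradP z)^T *m z.2 +
  ((Pf z)%:M + ((grad_alpha z)^T *m S z.1 z.2 + alpha z *: smx z.1))).
Proof.
move=> sz; have [Uz z0] := sz.
apply/matrixP => j i.
have dP := isd_diff ((0, e_ j) : V * V) ((Ck_Pf 0).1 _ sz).
have h1 := isd_scalemx dP (isd_snd_id z ((0, e_ j) : V * V)).
have h2 := isd_scalemx (isd_alpha_y HD (e_ j) sz) (isd_S_y (e_ j) Uz).
have h3 := isd_addmx (isd_addmx (isd_Gbar_y (e_ j) Uz) h1) h2.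
have mNji : mN z.1 z.2 j i = christoffel z.1 z.2 (e_ j) 0 i by rewrite mxE.
have gPj : 'D_((0, e_ j) : V * V) Pf z = gradP z 0 j by rewrite mxE.
have aj : dot (z.2 *m a z.1) (e_ j) / alpha z = grad_alpha z 0 j.
  by rewrite dot_deltar mulrC [RHS]mxE.
rewrite [LHS]mxE (isd_val ((isd_mx _ _ _ _).2 h3 0 i)) -(mul_smx z.1 (e_ j)) -rowE aj gPj.
have rowpr (M1 M2 M3 M4 M5 : V) : (M1 + (M2 + M3) + (M4 + M5)) 0 i =
   M1 0 i + (M2 0 i + M3 0 i) + (M4 0 i + M5 0 i) by rewrite !mxE.
have matpr (M1 M2 M3 M4 M5 : 'M[R]_n) : (M1 + (M2 + (M3 + (M4 + M5)))) j i =
   M1 j i + (M2 j i + (M3 j i + (M4 j i + M5 j i))) by rewrite !mxE.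
rewrite rowpr matpr mNji.
move: (christoffel _ _ _) (S z.1 z.2) (smx z.1) (Pf z) (grad_alpha z) (gradP z) (alpha z) => c1 S1 s1 P1 q p al1.
by rewrite !mxE !big_ord1 !mxE eqxx/= (eq_sym j) mulr_natr; ring.
Qed.

Lemma trace_jacG z : slit z -> tau z = \tr (jacG z).
Proof. by move=> sz; apply: eq_bigr => i _; rewrite mxE. Qed.

Lemma dot_y_gradP z : slit z -> dot z.2 (gradP z) = Pf z.
Proof. by move=> sz; rewrite -derive_Pf_y// Pf_euler. Qed.

Lemma dot_y_grad_alpha z : slit z -> dot z.2 (grad_alpha z) = alpha z.
Proof.
move=> sz; rewrite /grad_alpha dotZr dotC -(alpha_sqr HD sz) expr2 mulKf//.
by rewrite gt_eqF// (alpha_gt0 HD).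
Qed.

Lemma dot_S_grad_alpha z : slit z -> dot (S z.1 z.2) (grad_alpha z) = 0.
Proof. by move=> sz; rewrite /grad_alpha dotZr dotC (dot_S_ya HD) ?mulr0//; case: sz. Qed.

Lemma tauE z : slit z -> tau z = Ntr z + (n%:R + 1) * Pf z.
Proof.
move=> sz; have [Uz z0] := sz; rewrite trace_jacG// jacGE//.
apply: trace_spray_jacobian; [exact: dot_y_gradP|exact: dot_S_grad_alpha|exact: trace_smx].
Qed.

(** Read off from [tauE], as the difference of two functions already known to be smooth. *)
Lemma differentiable_Ntr z : slit z -> differentiable Ntr z.
Proof.
move=> sz; have C : Ck 0 slit (fun z => tau z - (n%:R + 1) * Pf z).
  exact: (Ck_sub2 oS (Ck_tau 0) (Ck_scale (n%:R + 1) oS (Ck_Pf 0))).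
apply: near_eq_differentiable (C.1 _ sz).
apply: filterS (open_nbhs_nbhs (conj oS sz)) => z' sz'.
by rewrite tauE// addrK.
Qed.

Lemma derive_tauE z (v : V * V) : slit z -> 'D_v tau z = 'D_v Ntr z + (n%:R + 1) * 'D_v Pf z.
Proof.
move=> sz; transitivity ('D_v (fun z => Ntr z + (n%:R + 1) * Pf z) z).
  apply: near_eq_derive; apply: filterS (open_nbhs_nbhs (conj oS sz)) => z' sz'.
  exact: tauE.
apply: isd_val; apply: isd_add; first by apply: isd_diff; exact: differentiable_Ntr.
by apply: isd_scale; apply: isd_diff; exact: (Ck_Pf 0).1.
Qed.

(** The covariant divergence s^i_{0;i}; the two traces are its Christoffel terms. *)
Definition Delta z : R :=
  \sum_i 'D_((e_ i, 0) : V * V) (fun z => S z.1 z.2 0 i) z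
  + \tr (mN z.1 (S z.1 z.2)) - \tr (mN z.1 z.2 *m smx z.1).

(** The terms built from [Gbar] and [Ntr] alone form the Ricci curvature of [alpha]. From it are
    subtracted 2 t_00 and alpha^2 t^i_i, where t is the square of the endomorphism s^i_j. *)
Definition Rbar z : R :=
  2 * \sum_i 'D_((e_ i, 0) : V * V) (fun z => Gbar z 0 i) z
  - 'D_((z.2, 0) : V * V) Ntr z + 2 * 'D_((0, Gbar z) : V * V) Ntr z
  - \tr (mN z.1 z.2 *m mN z.1 z.2)
  - 2 * dot (S z.1 z.2 *m smx z.1) (z.2 *m a z.1)
  - dot (z.2 *m a z.1) z.2 * \tr (smx z.1 *m smx z.1).

Lemma divergence_spray z : slit z ->
  \sum_i 'D_((e_ i, 0) : V * V) (Gc i) z =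
  \sum_i 'D_((e_ i, 0) : V * V) (fun z => Gbar z 0 i) z + 'D_((z.2, 0) : V * V) Pf z
  + dot (christoffel z.1 z.2 (S z.1 z.2)) (grad_alpha z)
  + alpha z * \sum_i 'D_((e_ i, 0) : V * V) (fun z => S z.1 z.2 0 i) z.
Proof.
move=> sz; have [Uz z0] := sz.
have dal : differentiable alpha z by exact: (Ck_alpha HD 0).1.
(* Metric compatibility identifies this Christoffel term with the derivative of [alpha] along S in
   the base directions. *)
have -> : dot (christoffel z.1 z.2 (S z.1 z.2)) (grad_alpha z) =
    'D_((S z.1 z.2, 0) : V * V) alpha z.
  rewrite (isd_val (isd_alpha HD _ sz))/= dot0r mulr0 addr0 invfM mulrA.
  rewrite (mulrC (dot _ _)) -christoffel_metric// christoffelC// mulrC.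
  by rewrite /grad_alpha dotZr dot_mulmx asym.
rewrite (derive_sum_x z.2 ((Ck_Pf 0).1 _ sz)) (derive_sum_x (S z.1 z.2) dal).
rewrite mulr_sumr -!big_split; apply: eq_bigr => i _ /=.
have dP := isd_diff ((e_ i, 0) : V * V) ((Ck_Pf 0).1 _ sz).
have da := isd_diff ((e_ i, 0) : V * V) dal.
have dG := isd_diff ((e_ i, 0) : V * V) ((Ck_mx oS (Ck_Gbar 0) 0 i).1 _ sz).
have dS := isd_diff ((e_ i, 0) : V * V) ((Ck_mx oS (Ck_S 0) 0 i).1 _ sz).
have dy := (isd_mx _ _ _ _).2 (isd_snd_id z ((e_ i, 0) : V * V)) 0 i.
have hh := isd_add (isd_add dG (isd_mul dP dy)) (isd_mul da dS).
have E : Gc i = (fun z => Gbar z 0 i + Pf z * z.2 0 i + alpha z * S z.1 z.2 0 i).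
  apply/funext => z'; rewrite /Gc /Gspray.
  move: (Gbar z') (S z'.1 z'.2) (Pf z') (alpha z') => G1 S1 P1 al1.
  by rewrite !mxE.
rewrite E (isd_val hh)/= mxE mulr0 addr0 /GRing.scale/=.
by rewrite (mulrC (z.2 0 i)) (mulrC (S z.1 z.2 0 i)) !addrA.
Qed.

(** The derivatives of [Pf] assemble into one along the geodesic field (y, -2 Gbar) of [alpha] and
    one along [S]. The parity in y is then visible term by term: [Rbar] and [alpha] are even,
    [Delta] is odd, and only [Pf] is mixed. *)
Lemma ricci_formula z : slit z ->
  \sum_i riemann_curvature L i i z = Rbar z + 2 * alpha z * Delta z +
  (n%:R - 1) * (Pf z ^+ 2 - 'D_((z.2, - (2 *: Gbar z)) : V * V) Pf z +
    2 * alpha z * 'D_((0, S z.1 z.2) : V * V) Pf z).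
Proof.
move=> sz; have [Uz z0] := sz.
have dP : differentiable Pf z by exact: (Ck_Pf 0).1.
have dN := differentiable_Ntr sz.
rewrite riemann_trace// divergence_spray// !derive_tauE//.
have -> : \sum_i \sum_j 'D_((0, e_ j) : V * V) (Gc i) z * 'D_((0, e_ i) : V * V) (Gc j) z =
    \tr (jacG z *m jacG z).
  rewrite /mxtrace exchange_big; apply: eq_bigr => i _; rewrite mxE.
  by apply: eq_bigr => j _; rewrite !mxE.
rewrite jacGE// (trace_spray_jacobian2 _ (dot_y_gradP sz) (dot_y_grad_alpha sz)
  (dot_S_grad_alpha sz) (trace_smx Uz) (mul_smx z.1 z.2)).
rewrite Gbar_mN// mul_mN//.
have pairD (v w : V) : ((0, v + w) : V * V) = ((0, v) : V * V) + ((0, w) : V * V).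
  by rewrite [RHS]/GRing.add/=/add_pair/= addr0.
have DN : 'D_((0, Gs z) : V * V) Ntr z =
    'D_((0, Gbar z) : V * V) Ntr z + Pf z * Ntr z + alpha z * \tr (mN z.1 (S z.1 z.2)).
  rewrite /Gspray !pairD !derive_Dl//.
  have sc k (v : V) : 'D_((0, k *: v) : V * V) Ntr z = k * 'D_((0, v) : V * V) Ntr z.
    have -> : ((0, k *: v) : V * V) = k *: ((0, v) : V * V).
      by rewrite [RHS]/GRing.scale/=/scale_pair/= scaler0.
    by rewrite derive_Zl.
  by rewrite !sc (isd_val (isd_Ntr_y z.2 Uz)) (isd_val (isd_Ntr_y (S z.1 z.2) Uz)).
have DP : 'D_((0, Gs z) : V * V) Pf z =
    dot (Gbar z) (gradP z) + Pf z * Pf z + alpha z * dot (S z.1 z.2) (gradP z).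
  rewrite derive_Pf_y// /Gspray !dotDl (dotZl (Pf z)) (dotZl (alpha z)).
  by rewrite dot_y_gradP.
have DX : 'D_((z.2, - (2 *: Gbar z)) : V * V) Pf z =
    'D_((z.2, 0) : V * V) Pf z - 2 * dot (Gbar z) (gradP z).
  have -> : ((z.2, - (2 *: Gbar z)) : V * V) = ((z.2, 0) : V * V) + ((0, - (2 *: Gbar z)) : V * V).
    by rewrite [RHS]/GRing.add/=/add_pair/= addr0 add0r.
  by rewrite derive_Dl// (derive_Pf_y _ sz) dotNl (dotZl 2).
have dd : alpha z * dot (S z.1 z.2 *m smx z.1) (grad_alpha z) =
    dot (S z.1 z.2 *m smx z.1) (z.2 *m a z.1).
  by rewrite /grad_alpha dotZr mulrA divff ?mul1r// gt_eqF// (alpha_gt0 HD).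
rewrite DN DP DX derive_Pf_y// (dotZl 2) /Rbar -dd -(alpha_sqr HD sz) /Delta /Ntr.
set X1 := \sum_i _; set X4 := \sum_i _.
move: X1 X4 (dot (S z.1 z.2 *m smx z.1) (grad_alpha z)) => X1 X4 d.
move: (\tr (mN z.1 z.2 *m mN z.1 z.2)) (\tr (mN z.1 z.2 *m smx z.1)) (\tr (smx z.1 *m smx z.1)) => t1 t2 t3.
move: (\tr (mN z.1 z.2)) (\tr (mN z.1 (S z.1 z.2))) => t4 t5.
move: (dot (christoffel _ _ _) _) (dot (Gbar z) _) (dot (S z.1 z.2) _) => d1 d2 d3.
set D1 := 'D__ _ _; set D2 := 'D__ _ _; set D3 := 'D__ _ _.
move: D1 D2 D3 (Pf z) (alpha z) => D1 D2 D3 P al.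
by ring.
Qed.

End RicciFormula.

(** * The part of the Einstein equation that is odd in y *)

Section OddRicci.
Variables (R : realType) (n : nat).
Notation V := 'rV[R]_n.
Notation e_ i := (delta_mx 0 i : V).
Variables (U : set V) (a : V -> 'M[R]_n) (b : V -> V) (L : V * V -> R).
Hypothesis HD : randers_data U a b L.
Let oU := rd_open HD.
Let Ca := rd_Ca HD.
Let Cb := rd_Cb HD.
Let asym := rd_sym HD.
Local Notation slit := (slit U).
Local Notation h := (metric_inverse a).
Local Notation alpha := (alpha b L).
Local Notation Gbar := (Gbar a).
Local Notation christoffel := (christoffel a).
Local Notation S := (S a b).
Local Notation sform := (sform a b).
Local Notation rform := (rform a b).
Local Notation eform := (eform a b).
Local Notation Pf := (Pf a b L).
Local Notation Delta := (Delta a b).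
Local Notation Rbar := (Rbar a b).
Local Notation mN := (mN a).
Local Notation Ntr := (Ntr a).
Implicit Types (x y w : V) (z v : V * V).
Let oS : open slit := open_slit HD.

Lemma slit_flip z : slit z -> slit (flip z).
Proof. by move=> [Uz z0]; split => //=; rewrite oppr_eq0. Qed.

Lemma derive_parity (s : R) (f : V * V -> R) z v : slit z -> differentiable f z ->
  (forall z, slit z -> f (flip z) = s * f z) -> 'D_v f (flip z) = s * 'D_(flip v) f z.
Proof.
move=> sz df hf; rewrite derive_flip.
transitivity ('D_(flip v) (fun z => s * f z) z).
  by apply: near_eq_derive; apply: filterS (open_nbhs_nbhs (conj oS sz)) => z' /hf.
by apply: isd_val; apply: isd_scale; exact: isd_diff.
Qed.

Definition beta z : R := dot (b z.1) z.2.
Definition s0 z : R := dot (sform z.1) z.2.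
Definition t0 z : R := dot (sform z.1) (S z.1 z.2).
(** The geodesic vector field of [alpha] on the tangent bundle. It annihilates [alpha], so that
    differentiating [L] along it leaves only r_00. *)
Definition xi z : V * V := (z.2, - (2 *: Gbar z)).

Lemma beta_flip z : beta (flip z) = - beta z.
Proof. exact: dotNr. Qed.

Lemma s0_flip z : s0 (flip z) = - s0 z.
Proof. exact: dotNr. Qed.

Lemma S_flip z : S (flip z).1 (flip z).2 = - S z.1 z.2.
Proof. by rewrite /S /= !mulNmx. Qed.

Lemma t0_flip z : t0 (flip z) = - t0 z.
Proof. by rewrite /t0 S_flip; exact: dotNr. Qed.

Lemma christoffelNl x y w : U x -> christoffel x (- y) w = - christoffel x y w.
Proof.
by move=> Ux; rewrite (christoffelC HD)// -scaleN1r (christoffelZr HD)// (christoffelC HD)// scaleN1r.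
Qed.

Lemma mN_flip x y : U x -> mN x (- y) = - mN x y.
Proof.
move=> Ux; apply/matrixP => i j; rewrite [LHS]mxE [RHS]mxE [in RHS]mxE.
by rewrite christoffelNl// mxE.
Qed.

Lemma Gbar_flip z : U z.1 -> Gbar (flip z) = Gbar z.
Proof.
move=> Uz; rewrite /Gbar/= christoffelNl// (christoffelC HD)// christoffelNl//.
by rewrite opprK.
Qed.

Lemma alpha_flip z : slit z -> alpha (flip z) = alpha z.
Proof.
move=> sz; rewrite (alphaE HD (slit_flip sz)) (alphaE HD sz)/=.
by rewrite mulNmx dotNl dotNr opprK.
Qed.

Lemma rform_flip z : U z.1 -> rform (flip z) = rform z.
Proof.
move=> Uz; rewrite /rform Gbar_flip//= derive_Nl; last exact: (Cb 0).1.
by rewrite dotNl dotNr opprK.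
Qed.

Lemma eform_flip z : U z.1 -> eform (flip z) = eform z.
Proof.
move=> Uz; rewrite /eform rform_flip// -/(beta _) -/(s0 _) beta_flip s0_flip.
by rewrite !mulrN mulNr opprK.
Qed.

Lemma Ntr_flip z : slit z -> Ntr (flip z) = -1 * Ntr z.
Proof. by move=> [Uz _]; rewrite /Ntr/= mN_flip// linearN/= mulN1r. Qed.

Lemma flip_x w : flip ((w, 0) : V * V) = (w, 0).
Proof. by rewrite /flip/= oppr0. Qed.

Let D_Nx (f : V * V -> R) z w : differentiable f z ->
  'D_((- w, 0) : V * V) f z = - 'D_((w, 0) : V * V) f z.
Proof.
move=> df; have -> : ((- w, 0) : V * V) = (- w, - 0) by rewrite oppr0.
exact: (derive_Nl ((w, 0) : V * V) df).
Qed.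

Let D_Ny (f : V * V -> R) z w : differentiable f z ->
  'D_((0, - w) : V * V) f z = - 'D_((0, w) : V * V) f z.
Proof.
move=> df; have -> : ((0, - w) : V * V) = (- 0, - w) by rewrite oppr0.
exact: (derive_Nl ((0, w) : V * V) df).
Qed.

Let mulN1NK (c : R) : -1 * - c = c.
Proof. by rewrite mulN1r opprK. Qed.

Lemma Rbar_flip z : slit z -> Rbar (flip z) = Rbar z.
Proof.
move=> sz; have [Uz z0] := sz; have dN := differentiable_Ntr HD sz.
have h1 : 'D_(((flip z).2, 0) : V * V) Ntr (flip z) = 'D_((z.2, 0) : V * V) Ntr z.
  rewrite (derive_parity (s := -1) _ sz dN Ntr_flip) flip_x (D_Nx _ dN); exact: mulN1NK.
have h2 : 'D_((0, Gbar (flip z)) : V * V) Ntr (flip z) = 'D_((0, Gbar z) : V * V) Ntr z.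
  rewrite (Gbar_flip Uz); apply: (etrans (derive_parity (s := -1) ((0, Gbar z) : V * V) sz dN Ntr_flip)).
  have -> : flip ((0, Gbar z) : V * V) = (0, - Gbar z) by [].
  rewrite (D_Ny _ dN); exact: mulN1NK.
have h3 : mN (flip z).1 (flip z).2 *m mN (flip z).1 (flip z).2 = mN z.1 z.2 *m mN z.1 z.2.
  by rewrite (mN_flip z.2 Uz) mulNmx mulmxN opprK.
have h4 : dot (S (flip z).1 (flip z).2 *m smx a b (flip z).1) ((flip z).2 *m a (flip z).1) =
    dot (S z.1 z.2 *m smx a b z.1) (z.2 *m a z.1).
  by rewrite S_flip mulNmx [_ *m a _]mulNmx dotNl dotNr opprK.
have h5 : dot ((flip z).2 *m a (flip z).1) (flip z).2 = dot (z.2 *m a z.1) z.2.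
  by rewrite [_ *m a _]mulNmx dotNl dotNr opprK.
have h6 : \sum_i 'D_((e_ i, 0) : V * V) (fun z => Gbar z 0 i) (flip z) =
    \sum_i 'D_((e_ i, 0) : V * V) (fun z => Gbar z 0 i) z; last first.
  have key (A B C D E F A' B' C' D' E' F' G : R) : A = A' -> B = B' -> C = C' -> D = D' ->
      E = E' -> F = F' -> 2 * A - B + 2 * C - D - 2 * E - F * G =
      2 * A' - B' + 2 * C' - D' - 2 * E' - F' * G.
    by move=> -> -> -> -> -> ->.
  exact: (key _ _ _ _ _ _ _ _ _ _ _ _ _ h6 h1 h2 (congr1 mxtrace h3) h4 h5).
apply: eq_bigr => i _.
have := derive_parity (s := 1) (f := fun z => Gbar z 0 i) ((e_ i, 0) : V * V) sz.
rewrite mul1r flip_x; apply; first exact: (Ck_mx oS (Ck_Gbar HD 0) 0 i).1.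
by move=> z' [Uz' _]; rewrite (Gbar_flip Uz') mul1r.
Qed.

Lemma Delta_flip z : slit z -> Delta (flip z) = - Delta z.
Proof.
move=> sz; have [Uz z0] := sz.
have h1 : \tr (mN (flip z).1 (S (flip z).1 (flip z).2)) = - \tr (mN z.1 (S z.1 z.2)).
  by rewrite S_flip (mN_flip _ Uz) linearN.
have h2 : \tr (mN (flip z).1 (flip z).2 *m smx a b (flip z).1) = - \tr (mN z.1 z.2 *m smx a b z.1).
  by rewrite (mN_flip _ Uz) mulNmx linearN.
have key (A B C A' B' C' : R) : A = - A' -> B = - B' -> C = - C' -> A + B - C = - (A' + B' - C').
  by move=> -> -> ->; ring.
apply: (key _ _ _ _ _ _ _ h1 h2).
rewrite -sumrN; apply: eq_bigr => i _.
have := derive_parity (s := -1) (f := fun z => S z.1 z.2 0 i) ((e_ i, 0) : V * V) sz.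
rewrite mulN1r flip_x; apply; first exact: (Ck_mx oS (Ck_S HD 0) 0 i).1.
by move=> z' _; rewrite S_flip mxE mulN1r.
Qed.

Lemma xi_flip z : U z.1 -> xi (flip z) = - flip (xi z).
Proof.
by move=> Uz; rewrite /xi (Gbar_flip Uz) /flip/= opprK.
Qed.

Lemma flip_xi_flip z : U z.1 -> flip (xi (flip z)) = - xi z.
Proof. by move=> Uz; rewrite xi_flip//; case: (xi z) => p q; rewrite /flip/= opprK. Qed.

Lemma derive_xi_even (f : V * V -> R) z : slit z -> differentiable f z ->
  (forall z, slit z -> f (flip z) = f z) -> 'D_(xi (flip z)) f (flip z) = - 'D_(xi z) f z.
Proof.
move=> sz df hf; have [Uz z0] := sz.
rewrite (derive_parity (s := 1) _ sz df); last by move=> z' /hf; rewrite mul1r.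
by rewrite mul1r (flip_xi_flip Uz) (derive_Nl _ df).
Qed.

Lemma derive_xi_odd (f : V * V -> R) z : slit z -> differentiable f z ->
  (forall z, slit z -> f (flip z) = - f z) -> 'D_(xi (flip z)) f (flip z) = 'D_(xi z) f z.
Proof.
move=> sz df hf; have [Uz z0] := sz.
rewrite (derive_parity (s := -1) _ sz df); last by move=> z' /hf; rewrite mulN1r.
rewrite (flip_xi_flip Uz) (derive_Nl _ df); exact: mulN1NK.
Qed.

Lemma derive_S_even (f : V * V -> R) z : slit z -> differentiable f z ->
  (forall z, slit z -> f (flip z) = f z) ->
  'D_((0, S (flip z).1 (flip z).2) : V * V) f (flip z) = 'D_((0, S z.1 z.2) : V * V) f z.
Proof.
move=> sz df hf; rewrite (derive_parity (s := 1) _ sz df); last by move=> z' /hf; rewrite mul1r.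
by rewrite mul1r S_flip /flip/= opprK.
Qed.

Lemma derive_xi_L z : slit z -> 'D_(xi z) L z = rform z.
Proof.
move=> sz; have [Uz z0] := sz; rewrite (isd_val (isd_L HD (xi z) sz))/=.
have E : dot (z.2 *m a z.1) (Gbar z) = 4^-1 * dot (z.2 *m 'D_(z.2) a z.1) z.2.
  rewrite dotC -{1}(asym Uz) -dot_mulmx (Gbar_a HD)// dotDl dotNl !dotZl (grad_form_dot HD)//.
  by move: (dot _ _) => A; field.
rewrite !dotNr !(dotZr 2) E /rform (dotC (b z.1)).
move: (dot _ _) (dot _ _) (dot _ _) => A B C; field.
by rewrite gt_eqF// (alpha_gt0 HD).
Qed.

Lemma derive_S_L z : slit z -> 'D_((0, S z.1 z.2) : V * V) L z = s0 z.
Proof.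
move=> sz; have [Uz z0] := sz; rewrite (derive_Ly HD)//.
rewrite /ell dotDl dotZl (dot_S_ya HD)// mulr0 add0r dotC.
exact: (dot_S_b HD).
Qed.

Lemma derive_S_s0 z : slit z -> 'D_((0, S z.1 z.2) : V * V) s0 z = t0 z.
Proof.
move=> [Uz z0]; have hs := isd_fst_y (S z.1 z.2) ((Ck_sform HD 0).1 _ Uz).
rewrite (isd_val (isd_dot hs (isd_snd_id z ((0, S z.1 z.2) : V * V)))).
by rewrite dot0l add0r.
Qed.

Lemma derive_Pf z v : slit z ->
  'D_v Pf z = 'D_v eform z / (2 * L z) - eform z * 'D_v L z / (2 * L z ^+ 2) - 'D_v s0 z.
Proof.
move=> sz; have L0 := L_neq0 HD sz.
have L20 : 2 * L z != 0 by rewrite mulf_neq0// pnatr_eq0.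
have de := isd_diff v ((Ck_eform HD 0).1 _ sz).
have dL := isd_diff v ((rd_CL HD 0).1 _ sz).
have ds := isd_diff v ((Ck_s0 HD 0).1 _ sz).
have di := @isd_inv _ _ (fun z => 2 * L z) _ _ _ L20 (isd_scale 2 dL).
rewrite (isd_val (isd_sub (isd_mul de di) ds)); congr (_ - _).
move: ('D_v eform z) ('D_v L z) (eform z) (L z) L0 {L20 de dL ds di} => A B C D D0.
by field.
Qed.

(** The hypotheses are the Einstein equation at y and at -y; [X] and [Z] are the derivatives of e
    and s_0 along [xi], [Y] is that of e along [S], and [T] is t_0. The difference of the equations,
    multiplied by (al^2 - be^2)^2 / 2, has a factor [al], and the other factor contains [al] only
    through its square. *)
Lemma odd_part_identity (al be e s D T X Y Z K N Rb : R) :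
  N != 0 -> al != 0 -> al + be != 0 -> al - be != 0 ->
  Rb + 2 * al * D + N * ((e / (2 * (al + be)) - s) ^+ 2 -
    (X / (2 * (al + be)) - e * (e - 2 * be * s) / (2 * (al + be) ^+ 2) - Z) +
    2 * al * (Y / (2 * (al + be)) - e * s / (2 * (al + be) ^+ 2) - T)) =
    N * K * (al + be) ^+ 2 ->
  Rb - 2 * al * D + N * ((e / (2 * (al - be)) + s) ^+ 2 -
    (- X / (2 * (al - be)) - e * (e - 2 * be * s) / (2 * (al - be) ^+ 2) - Z) +
    2 * al * (Y / (2 * (al - be)) + e * s / (2 * (al - be) ^+ 2) + T)) =
    N * K * (al - be) ^+ 2 ->
  - (3 / 2) * e ^+ 2 * be +
  (al ^+ 2 - be ^+ 2) * (- 2 * e * s - X / 2 - Y * be) +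
  (al ^+ 2 - be ^+ 2) ^+ 2 * (2 * D / N - 2 * T - 2 * K * be) = 0.
Proof.
move=> N0 al0 Lp Lm h1 h2.
apply/eqP; rewrite -(mulrI_eq0 _ (mulfI al0)) -(mulrI_eq0 _ (mulfI N0)); apply/eqP.
move: h1 h2; set A := (X in X = _) => h1; set B := (X in X = _) => h2.
transitivity ((al ^+ 2 - be ^+ 2) ^+ 2 / 2 *
  ((A - N * K * (al + be) ^+ 2) - (B - N * K * (al - be) ^+ 2))); last first.
  by rewrite h1 h2; ring.
rewrite /A /B; field.
by rewrite N0 Lp Lm.
Qed.

Lemma odd_ricci z (K : R) : (2 <= n)%N -> slit z ->
  (forall z, slit z -> \sum_i riemann_curvature L i i z = (n%:R - 1) * K * L z ^+ 2) ->
  - (3 / 2) * eform z ^+ 2 * beta z +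
  (dot (z.2 *m a z.1) z.2 - beta z ^+ 2) *
    (- 2 * eform z * s0 z - 'D_(xi z) eform z / 2 -
     'D_((0, S z.1 z.2) : V * V) eform z * beta z) +
  (dot (z.2 *m a z.1) z.2 - beta z ^+ 2) ^+ 2 *
    (2 * Delta z / (n%:R - 1) - 2 * t0 z - 2 * K * beta z) = 0.
Proof.
move=> n2 sz HE; have [Uz z0] := sz; have sf := slit_flip sz.
have N0 : (n%:R - 1 : R) != 0.
  by rewrite subr_eq0 pnatr_eq1; case: (n) n2 => [|[]].
have al0 : alpha z != 0 by rewrite gt_eqF// (alpha_gt0 HD).
have Lp := L_neq0 HD sz; have Lm := L_neq0 HD sf.
have EL : L z = alpha z + beta z by exact: L_alpha.
have ELf : L (flip z) = alpha z - beta z.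
  by rewrite (L_alpha b) alpha_flip// -/(beta _) beta_flip.
have Ce := (Ck_eform HD 0).1.
have Cs := (Ck_s0 HD 0).1.
have e_even z' : slit z' -> eform (flip z') = eform z' by case=> Uz' _; exact: eform_flip.
have h1 := HE z sz; have h2 := HE (flip z) sf.
rewrite (ricci_formula HD sz) in h1; rewrite (ricci_formula HD sf) in h2.
rewrite -!/(xi _) in h1 h2.
rewrite !(derive_Pf _ sz) (derive_xi_L sz) (derive_S_L sz) (derive_S_s0 sz) in h1.
rewrite !(derive_Pf _ sf) (derive_xi_L sf) (derive_S_L sf) (derive_S_s0 sf) in h2.
rewrite (derive_xi_even sz (Ce _ sz) e_even) (derive_S_even sz (Ce _ sz) e_even) in h2.
rewrite (derive_xi_odd sz (Cs _ sz) (fun z _ => s0_flip z)) in h2.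
rewrite (Rbar_flip sz) (Delta_flip sz) (alpha_flip sz) (rform_flip Uz) s0_flip t0_flip in h2.
have rE : rform z = eform z - 2 * beta z * s0 z by rewrite /eform addrK.
have PE : Pf z = eform z / (2 * L z) - s0 z by [].
have PfE : Pf (flip z) = eform z / (2 * (alpha z - beta z)) + s0 z.
  by rewrite /Pf -/(s0 _) s0_flip (e_even z sz) ELf opprK.
rewrite rE PE EL in h1; rewrite rE PfE ELf (e_even z sz) in h2.
rewrite EL in Lp; rewrite ELf in Lm; rewrite -(alpha_sqr HD sz).
apply: (odd_part_identity N0 al0 Lp Lm h1).
move: h2; move: (eform z) (beta z) (alpha z) (s0 z) (t0 z) (Delta z) (Rbar z) => e be al s T D Rb.
move: ('D_(xi z) eform z) ('D_((0, S z.1 z.2) : V * V) eform z) ('D_(xi z) s0 z) => X Y Z h2.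
by rewrite -h2; ring.
Qed.

End OddRicci.

(** * Conformality of the covariant derivative of the 1-form *)

Section LinePolynomials.
Variable R : realType.

(** A nonzero difference would have the distinct roots 0, 1, 2, ... in a number exceeding its
    degree. *)
Lemma poly_ext (p q : {poly R}) : (forall t, p.[t] = q.[t]) -> p = q.
Proof.
move=> pq; apply/eqP; rewrite -subr_eq0; apply: contraT => d0.
have := @max_poly_roots _ (p - q) [seq i%:R | i <- iota 0 (size (p - q))] d0.
rewrite size_map size_iota ltnn; apply => //.
  by apply/allP => t _; rewrite rootE hornerD hornerN pq subrr.
by rewrite map_inj_uniq ?iota_uniq//; apply: mulrIn; exact: oner_neq0.
Qed.

(** A + w t^2 has no real root, so if it divides a square it divides the base. By hand: removing
    e2/w times it from the base leaves r = e1 t + d0, and comparing degrees gives r^2 = g (A + w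
    t^2) with a constant g. Then e1 d0 = 0, d0^2 = A g and e1^2 = w g, which forces g = 0. *)
Lemma quadratic_square_divisible (k A w e0 e1 e2 : R) (G : {poly R}) :
  k != 0 -> 0 < A -> 0 < w ->
  (forall t, k * (e0 + e1 * t + e2 * t ^+ 2) ^+ 2 = (A + w * t ^+ 2) * G.[t]) ->
  e1 = 0 /\ e0 * w = e2 * A.
Proof.
move=> k0 A0 w0 H; have w0' : w != 0 by rewrite gt_eqF.
pose q : {poly R} := w *: 'X^2 + A%:P.
have sq : size q = 3.
  rewrite /q size_polyDl ?size_scale ?size_polyXn// size_polyC.
  by case: (A != 0).
have [d0 d0E] : exists d0, d0 = e0 - e2 * A / w by exists (e0 - e2 * A / w).
pose r : {poly R} := e1 *: 'X + d0%:P.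
pose G2 : {poly R} := k^-1 *: G - (e2 / w) *: (2%:P * r + (e2 / w) *: q).
have E : r ^+ 2 = q * G2.
  apply: poly_ext => t.
  have q0 : A + w * t ^+ 2 != 0.
    by rewrite gt_eqF// ltr_pwDl// (mulr_ge0 (ltW w0) (sqr_ge0 t)).
  have Gt : G.[t] = k * (e0 + e1 * t + e2 * t ^+ 2) ^+ 2 / (A + w * t ^+ 2).
    by rewrite H mulrAC divff ?mul1r.
  rewrite /G2 /r /q expr2 !(hornerD, hornerN, hornerM, hornerZ, hornerXn, hornerX, hornerC) Gt d0E.
  by field; rewrite w0' k0 q0.
have sr : (size (r ^+ 2) <= 3)%N.
  apply: leq_trans (size_poly_exp_leq _ _) _ => /=.
  have : (size r <= 2)%N.
    apply: leq_trans (size_polyD _ _) _; rewrite geq_max.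
    rewrite (leq_trans (size_scale_leq _ _)) ?size_polyX//= size_polyC.
    by case: (d0 != 0).
  by case: (size r) => [|[|[|]]].
have G2c : G2 = (G2`_0)%:P.
  apply: size1_polyC; have [->|G0] := eqVneq G2 0; first by rewrite size_poly0.
  have q0 : q != 0 by rewrite -size_poly_gt0 sq.
  by move: sr; rewrite E size_mul// sq; case: (size G2) => [|[|]].
move: (G2`_0) G2c => g G2c.
have E' t : (e1 * t + d0) ^+ 2 = (w * t ^+ 2 + A) * g.
  have := congr1 (fun p : {poly R} => p.[t]) E.
  by rewrite G2c /r /q expr2 !(hornerD, hornerN, hornerM, hornerZ, hornerXn, hornerX, hornerC).
have h0 := E' 0; have h1 := E' 1; have h2 := E' (-1).
have e1d : e1 * d0 = 0.
  have -> : e1 * d0 = 4^-1 * ((e1 * 1 + d0) ^+ 2 - (e1 * -1 + d0) ^+ 2) by field.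
  by rewrite h1 h2; ring.
have gd : d0 ^+ 2 = A * g by move: h0; rewrite mulr0 expr0n/= mulr0 !add0r.
have ge : e1 ^+ 2 = w * g.
  have -> : e1 ^+ 2 = (e1 * 1 + d0) ^+ 2 - 2 * (e1 * d0) - d0 ^+ 2 by ring.
  by rewrite h1 e1d gd; ring.
have g0 : g = 0.
  move/eqP: e1d; rewrite mulf_eq0 => /orP[] /eqP hz.
    by move/eqP: ge; rewrite hz expr0n eq_sym mulf_eq0 (negbTE w0') => /eqP.
  by move/eqP: gd; rewrite hz expr0n eq_sym mulf_eq0 (gt_eqF A0) => /eqP.
move: ge gd; rewrite g0 !mulr0 => /eqP; rewrite sqrf_eq0 => /eqP -> /eqP.
rewrite sqrf_eq0 => /eqP hd; split => //; move: hd; rewrite d0E => /eqP.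
by rewrite subr_eq0 => /eqP ->; field.
Qed.

Variables (n : nat).
Notation V := 'rV[R]_n.
Variables p v : V.

(** Restricting to lines p + t v keeps all divisibility arguments among polynomials in one variable;
    [f] remains a plain function and the polynomial is only a witness. *)
Definition line_poly (f : V -> R) := exists P : {poly R}, forall t, f (p + t *: v) = P.[t].
Definition line_polymx m k (f : V -> 'M[R]_(m, k)) := forall i j, line_poly (fun y => f y i j).

Lemma line_poly_cst c : line_poly (fun=> c).
Proof. by exists c%:P => t; rewrite hornerC. Qed.

Lemma line_poly_add f g : line_poly f -> line_poly g -> line_poly (fun y => f y + g y).
Proof. by move=> [P hP] [Q hQ]; exists (P + Q) => t; rewrite hP hQ hornerD. Qed.

Lemma line_poly_mul f g : line_poly f -> line_poly g -> line_poly (fun y => f y * g y).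
Proof. by move=> [P hP] [Q hQ]; exists (P * Q) => t; rewrite hP hQ hornerM. Qed.

Lemma line_poly_opp f : line_poly f -> line_poly (fun y => - f y).
Proof. by move=> [P hP]; exists (- P) => t; rewrite hP hornerN. Qed.

Lemma line_poly_sum (I : Type) (r : seq I) (f : I -> V -> R) :
  (forall i, line_poly (f i)) -> line_poly (fun y => \sum_(i <- r) f i y).
Proof.
move=> h; elim: r => [|i r [P hP]]; first by exists 0 => t; rewrite big_nil horner0.
have [Q hQ] := h i; exists (Q + P) => t.
by rewrite big_cons hQ hP hornerD.
Qed.

Lemma line_polymx_id : line_polymx (fun y => y).
Proof.
by move=> i j; exists ((p i j)%:P + (v i j) *: 'X) => t; rewrite !mxE !hornerE mulrC.
Qed.

Lemma line_polymx_cst m k (M : 'M[R]_(m, k)) : line_polymx (fun=> M).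
Proof. by move=> i j; exact: line_poly_cst. Qed.

Lemma line_polymx_mul m k l (f : V -> 'M[R]_(m, k)) (g : V -> 'M[R]_(k, l)) :
  line_polymx f -> line_polymx g -> line_polymx (fun y => f y *m g y).
Proof.
move=> hf hg i j.
have [P hP] : line_poly (fun y => \sum_s f y i s * g y s j).
  by apply: line_poly_sum => s; apply: line_poly_mul; [exact: hf|exact: hg].
by exists P => t; rewrite mxE hP.
Qed.

Lemma line_polymx_add m k (f g : V -> 'M[R]_(m, k)) :
  line_polymx f -> line_polymx g -> line_polymx (fun y => f y + g y).
Proof.
move=> hf hg i j; have [P hP] := line_poly_add (hf i j) (hg i j).
by exists P => t; rewrite mxE hP.
Qed.

Lemma line_polymx_opp m k (f : V -> 'M[R]_(m, k)) :
  line_polymx f -> line_polymx (fun y => - f y).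
Proof.
move=> hf i j; have [P hP] := line_poly_opp (hf i j).
by exists P => t; rewrite mxE hP.
Qed.

Lemma line_polymx_scale m k c (f : V -> 'M[R]_(m, k)) :
  line_polymx f -> line_polymx (fun y => c *: f y).
Proof.
move=> hf i j; have [P hP] := line_poly_mul (line_poly_cst c) (hf i j).
by exists P => t; rewrite mxE hP.
Qed.

Lemma line_poly_dot m (f g : V -> 'rV[R]_m) :
  line_polymx f -> line_polymx g -> line_poly (fun y => dot (f y) (g y)).
Proof.
move=> hf hg; have [P hP] : line_poly (fun y => \sum_s f y 0 s * g y 0 s).
  by apply: line_poly_sum => s; apply: line_poly_mul; [exact: hf|exact: hg].
by exists P => t; rewrite -hP.
Qed.

Lemma line_polymx_derive m k (f : V -> 'M[R]_(m, k)) x : differentiable f x ->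
  line_polymx (fun y => 'D_y f x).
Proof.
move=> df i j; have [P hP] : line_poly (fun y => \sum_s y 0 s * ('D_(delta_mx 0 s) f x) i j).
  by apply: line_poly_sum => s; apply: line_poly_mul; [exact: line_polymx_id|exact: line_poly_cst].
exists P => t; rewrite -hP (derive_basis _ df) summxE.
by apply: eq_bigr => s _; rewrite mxE.
Qed.

End LinePolynomials.

Section ConformalForm.
Variables (R : realType) (n : nat).
Notation V := 'rV[R]_n.
Notation e_ i := (delta_mx 0 i : V).
Variables (U : set V) (a : V -> 'M[R]_n) (b : V -> V) (L : V * V -> R).
Hypothesis HD : randers_data U a b L.
Let oU := rd_open HD.
Let Ca := rd_Ca HD.
Let Cb := rd_Cb HD.
Let asym := rd_sym HD.
Let apos := rd_pos HD.
Local Notation slit := (slit U).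
Local Notation h := (metric_inverse a).
Local Notation Gbar := (Gbar a).
Local Notation christoffel := (christoffel a).
Local Notation S := (S a b).
Local Notation sform := (sform a b).
Local Notation rform := (rform a b).
Local Notation eform := (eform a b).
Local Notation Delta := (Delta a b).
Local Notation mN := (mN a).
Local Notation beta := (beta b).
Local Notation xi := (xi a).
Local Notation s0 := (s0 a b).
Local Notation t0 := (t0 a b).
Implicit Types (x y w : V) (z v : V * V).
Let oS : open slit := open_slit HD.

Definition bsharp x : V := b x *m h x.
Definition bnorm2 x : R := dot (bsharp x) (b x).

(** The matrix b_{j;i} + 2 b_i s_j. It is left unsymmetrised: what matters is its quadratic form,
    which is [eform], and the sum of its values at (y, w) and (w, y). *)
Definition eform_mx x : 'M[R]_n :=
  db b x - \matrix_(i, j) dot (christoffel x (e_ i) (e_ j)) (b x)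
  + 2 *: ((b x)^T *m sform x).

Lemma eform_mx_dot x w y : U x -> dot (w *m eform_mx x) y =
  dot ('D_w b x) y - dot (christoffel x w y) (b x) + 2 * (dot (b x) w * dot (sform x) y).
Proof.
move=> Ux; rewrite /eform_mx mulmxDr mulmxBr -scalemxAr mulmxA row_mul_tr mul_scalar_mx.
rewrite (mul_db HD)// !dotDl dotNl (dotZl 2) (dotZl (dot w _)) (dotC w (b _)).
congr (_ - _ + _).
rewrite -(mul_mN HD)// [y *m _]mulmx_sum_row dot_suml [LHS]/dot; apply: eq_bigr => j _.
rewrite mulrC (dotZl (y 0 j)); congr (_ * _).
have -> : row j (mN x w) = w *m mN x (e_ j).
  by rewrite rowE !(mul_mN HD)// (christoffelC HD).
rewrite [w *m mN _ _]mulmx_sum_row dot_suml [LHS]mxE; apply: eq_bigr => i _.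
by rewrite (dotZl (w 0 i)) mxE rowE (mul_mN HD)// (christoffelC HD).
Qed.

Lemma eform_mxE z : U z.1 -> eform z = dot (z.2 *m eform_mx z.1) z.2.
Proof.
move=> Uz; rewrite eform_mx_dot// /eform /rform /Gbar dotZl mulrA mulfV ?pnatr_eq0//.
by rewrite mul1r mulrA.
Qed.

Lemma Ck_christoffel k (v w : V) : Ck k U (fun x => christoffel x v w).
Proof.
have C0 u : Ck k U (fun _ : V => u : V) by exact: Ck_cst.
have Cd u : Ck k U ('D_u a) by exact: CkS_derive (Ca k.+1).
have Cg : Ck k U (fun x => grad_form a x v w).
  apply: (Ck_entries oU) => i j.
  rewrite (_ : (fun x => _) = (fun x => dot (v *m 'D_(e_ j) a x) w)); last first.
    by apply/funext => x; rewrite mxE.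
  exact: (Ck_dot oU (Ck_mulmx oU (C0 v) (Cd _)) (C0 w)).
apply: (Ck_constscalemx _ oU); apply: (Ck_mulmx oU _ (Ck_metric_inverse HD k)).
apply: (Ck_addmx oU (Ck_addmx oU (Ck_mulmx oU (C0 v) (Cd w)) (Ck_mulmx oU (C0 w) (Cd v)))).
exact: (Ck_oppmx oU Cg).
Qed.

Lemma Ck_eform_mx k : Ck k U eform_mx.
Proof.
apply: (Ck_addmx oU (Ck_addmx oU (Ck_db HD k) (Ck_oppmx oU _))).
  apply: (Ck_entries oU) => i j.
  rewrite (_ : (fun x => _) = (fun x => dot (christoffel x (e_ i) (e_ j)) (b x))); last first.
    by apply/funext => x; rewrite mxE.
  exact: (Ck_dot oU (Ck_christoffel _ _ _) (Cb k)).
apply: (Ck_constscalemx _ oU); exact: (Ck_mulmx oU (Ck_trmx oU (Cb k)) (Ck_sform HD k)).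
Qed.

Lemma derive_eform z v : U z.1 -> 'D_v eform z =
  dot (z.2 *m 'D_(v.1) eform_mx z.1) z.2 + dot (v.2 *m eform_mx z.1) z.2
  + dot (z.2 *m eform_mx z.1) v.2.
Proof.
move=> Uz; have hE := isd_fst v ((Ck_eform_mx 0).1 _ Uz).
have hy := isd_snd_id z v.
have hh := isd_dot (isd_mulmx hy hE) hy.
rewrite dotDl (addrC (dot (v.2 *m _) _)) in hh.
rewrite -(isd_val hh); apply: near_eq_derive.
have oW := @open_fst R V V _ oU.
by apply: filterS (open_nbhs_nbhs (conj oW Uz)) => z' Uz'; exact: eform_mxE.
Qed.

Lemma bnorm2_gt0 x : U x -> b x != 0 -> 0 < bnorm2 x.
Proof. by move=> Ux b0; exact: (posdef_invmx (asym Ux) (apos Ux)). Qed.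

Lemma bsharp_a x y : U x -> dot (bsharp x *m a x) y = dot (b x) y.
Proof. by move=> Ux; rewrite (hK HD). Qed.

(** F is non-negative, and nonzero on nonzero vectors; at -b^# it takes the value sqrt u - u. *)
Lemma bnorm2_lt1 x : U x -> b x != 0 -> bnorm2 x < 1.
Proof.
move=> Ux b0; have u0 := bnorm2_gt0 Ux b0.
have s0 : bsharp x != 0 by apply: contraTneq u0 => h; rewrite /bnorm2 h dot0l ltxx.
have sl : slit (x, - bsharp x) by split => //=; rewrite oppr_eq0.
have := rd_ge0 HD (x, - bsharp x); rewrite le_eqVlt eq_sym (negbTE (L_neq0 HD sl))/=.
rewrite (rd_LE HD)// mulNmx dotNl dotNr opprK bsharp_a// dotNr [dot (b x) _]dotC -/(bnorm2 x).
rewrite subr_gt0 => hu; have : bnorm2 x ^+ 2 < bnorm2 x.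
  by rewrite -[ltRHS](sqr_sqrtr (ltW u0)) ltr_pXn2r ?nnegrE ?ltW// sqrtr_gt0 u0.
by rewrite expr2 -[ltRHS]mulr1 ltr_pM2l.
Qed.

Lemma line_poly_Gbar x (p v : V) : U x -> line_polymx p v (fun y => Gbar (x, y)).
Proof.
move=> Ux; have da : differentiable a x := (Ca 0).1 _ Ux.
have Y := line_polymx_id p v.
have Da := line_polymx_mul Y (line_polymx_derive p v da).
have Dg : line_polymx p v (fun y => grad_form a x y y).
  move=> i j; have [P hP] := line_poly_dot (line_polymx_mul Y (line_polymx_cst p v ('D_(e_ j) a x))) Y.
  by exists P => t; rewrite mxE hP.
apply: line_polymx_scale; apply: line_polymx_scale.
apply: line_polymx_mul (line_polymx_cst p v (h x)).
exact: (line_polymx_add (line_polymx_add Da Da) (line_polymx_opp Dg)).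
Qed.

Lemma line_poly_S x (p v : V) : line_polymx p v (fun y => S x y).
Proof.
apply: line_polymx_mul (line_polymx_cst p v (h x)).
exact: (line_polymx_mul (line_polymx_id p v) (line_polymx_cst p v (curl b x))).
Qed.

Lemma line_poly_trace m (M : V -> 'M[R]_m) (p v : V) : line_polymx p v M ->
  line_poly p v (fun y => \tr (M y)).
Proof. by move=> hM; apply: line_poly_sum => i; exact: hM. Qed.

Lemma line_poly_mN x (p v : V) (f : V -> V) : U x -> line_polymx p v f ->
  line_polymx p v (fun y => mN x (f y)).
Proof.
move=> Ux hf i j; have [P hP] := line_polymx_mul hf (line_polymx_cst p v (mN x (e_ i))) 0 j.
by exists P => t; rewrite mxE (christoffelC HD)// -(mul_mN HD)// hP.
Qed.

Lemma derive_S_x x y i w : U x ->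
  'D_((w, 0) : V * V) (fun z => S z.1 z.2 0 i) (x, y) =
  (y *m 'D_w (smx a b) x) 0 i.
Proof.
move=> Ux; have C := Ck_mulmx oU (Ck_curl HD 0) (Ck_metric_inverse HD 0).
have hs : is_derive (x, y) ((w, 0) : V * V) (fun z => smx a b z.1) ('D_w (smx a b) x).
  exact: (@isd_fst _ _ _ _ (smx a b) (x, y) (w, 0) (C.1 _ Ux)).
have -> : (fun z => S z.1 z.2 0 i) = (fun z => (z.2 *m smx a b z.1) 0 i).
  by apply/funext => z; rewrite mul_smx.
have hh := isd_mulmx (isd_snd_id (x, y) ((w, 0) : V * V)) hs.
have := isd_val ((isd_mx _ _ _ _).2 hh 0 i); rewrite /= mul0mx add0r => <-.
exact: erefl.
Qed.

Lemma line_poly_Delta x (p v : V) : U x -> line_poly p v (fun y => Delta (x, y)).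
Proof.
move=> Ux; have Y := line_polymx_id p v; have HS := line_poly_S x p v.
apply: line_poly_add; [apply: line_poly_add|apply: line_poly_opp].
- apply: line_poly_sum => i.
  have [P hP] := line_polymx_mul Y (line_polymx_cst p v ('D_(e_ i) (smx a b) x)) 0 i.
  by exists P => t; rewrite (derive_S_x _ _ _ Ux) hP.
- exact: line_poly_trace (line_poly_mN Ux HS).
- apply: line_poly_trace; apply: line_polymx_mul; first exact: line_poly_mN.
  exact: (line_polymx_cst p v (smx a b x)).
Qed.

Lemma line_poly_derive_eform x (p v : V) (f g : V -> V) : U x ->
  line_polymx p v f -> line_polymx p v g ->
  line_poly p v (fun y => 'D_((f y, g y) : V * V) eform (x, y)).
Proof.
move=> Ux hf hg; have Y := line_polymx_id p v.
have dE : differentiable eform_mx x := (Ck_eform_mx 0).1 _ Ux.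
have DE : line_polymx p v (fun y => 'D_(f y) eform_mx x).
  move=> i j; have [P hP] : line_poly p v (fun y => \sum_s f y 0 s * ('D_(e_ s) eform_mx x) i j).
    by apply: line_poly_sum => s; apply: line_poly_mul; [exact: hf|exact: line_poly_cst].
  exists P => t; rewrite -hP (derive_basis _ dE) summxE.
  by apply: eq_bigr => s _; rewrite mxE.
have E0 := line_polymx_cst p v (eform_mx x).
have [P hP] := line_poly_add (line_poly_add (line_poly_dot (line_polymx_mul Y DE) Y)
  (line_poly_dot (line_polymx_mul hg E0) Y)) (line_poly_dot (line_polymx_mul Y E0) hg).
by exists P => t; rewrite derive_eform//; exact: hP.
Qed.

Variable K : R.
Hypothesis n2 : (2 <= n)%N.
Hypothesis HE : forall z, slit z ->
  \sum_i riemann_curvature L i i z = (n%:R - 1) * K * L z ^+ 2.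

(** The odd identity solved for beta e^2. The line has to avoid the origin because the curvature
    identity is available on nonzero vectors only, whereas divisibility needs every t. *)
Lemma odd_ricci_line x (p v : V) : U x -> (forall t, p + t *: v != 0) ->
  exists G : {poly R}, forall t, let z := (x, p + t *: v) in
    3 / 2 * beta z * eform z ^+ 2 =
    (dot (z.2 *m a x) z.2 - beta z ^+ 2) * G.[t].
Proof.
move=> Ux nz; have Y := line_polymx_id p v.
have cst := line_poly_cst p v.
have Pb : line_poly p v (fun y => beta (x, y)).
  exact: line_poly_dot (line_polymx_cst p v (b x)) Y.
have Ps : line_poly p v (fun y => s0 (x, y)).
  exact: line_poly_dot (line_polymx_cst p v (sform x)) Y.
have Pt : line_poly p v (fun y => t0 (x, y)).
  exact: line_poly_dot (line_polymx_cst p v (sform x)) (line_poly_S x p v).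
have PQ : line_poly p v (fun y => dot (y *m a x) y - beta (x, y) * beta (x, y)).
  apply: line_poly_add (line_poly_opp (line_poly_mul Pb Pb)).
  exact: line_poly_dot (line_polymx_mul Y (line_polymx_cst p v (a x))) Y.
have Pe : line_poly p v (fun y => eform (x, y)).
  have [P hP] := line_poly_dot (line_polymx_mul Y (line_polymx_cst p v (eform_mx x))) Y.
  by exists P => t; rewrite eform_mxE//; exact: hP.
have PX : line_poly p v (fun y => 'D_(xi (x, y)) eform (x, y)).
  apply: line_poly_derive_eform => //; apply: line_polymx_opp; apply: line_polymx_scale.
  exact: line_poly_Gbar.
have PY : line_poly p v (fun y => 'D_((0, S x y) : V * V) eform (x, y)).
  exact: line_poly_derive_eform (line_polymx_cst p v 0) (line_poly_S x p v).
have PD := @line_poly_Delta x p v Ux.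
have c (k : R) f : line_poly p v f -> line_poly p v (fun y => k * f y).
  by move=> hf; exact: line_poly_mul (cst k) hf.
have [G hG] := line_poly_add
  (line_poly_add (line_poly_add (line_poly_mul (c (-2) _ Pe) Ps) (c (- 2^-1) _ PX))
     (c (-1) _ (line_poly_mul PY Pb)))
  (line_poly_mul PQ (line_poly_add (line_poly_add (c (2 / (n%:R - 1)) _ PD) (c (-2) _ Pt))
     (c (-2 * K) _ Pb))).
exists G => t z.
have sz : slit z by split => //; exact: nz.
rewrite -hG -/z; have := odd_ricci HD n2 sz HE; rewrite -/z /=.
move: (eform z) (beta z) (s0 z) (t0 z) (Delta z) (dot _ _) => e be s T D q.
move: ('D__ _ _) ('D__ _ _) => X Y1 H.
apply/eqP; rewrite -subr_eq0 -oppr_eq0; apply/eqP; rewrite -H.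
by ring.
Qed.

(* On the line [b^# + t v] with [v] orthogonal to [b], the form [alpha^2 - beta^2] is
   an irreducible quadratic in [t] dividing the square of [eform]. *)
Lemma eform_conformal x : U x -> b x != 0 ->
  exists c, forall y, eform (x, y) = 2 * c * (dot (y *m a x) y - beta (x, y) ^+ 2).
Proof.
move=> Ux b0; set u := bnorm2 x.
have u0 : 0 < u := bnorm2_gt0 Ux b0; have u1 : u < 1 := bnorm2_lt1 Ux b0.
(* The value of alpha^2 - beta^2 at b^#, positive because 0 < u < 1. *)
pose A := u - u ^+ 2.
have A0 : 0 < A by rewrite /A expr2 subr_gt0 -[ltRHS]mulr1 ltr_pM2l.
pose p := bsharp x.
have pb : dot (b x) p = u by rewrite dotC.
have pap : dot (p *m a x) p = u by rewrite bsharp_a.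
pose E := eform_mx x; pose e (y : V) := dot (y *m E) y.
pose B (v : V) := dot (p *m E) v + dot (v *m E) p.
have eD l (v : V) : e (l *: p + v) = l ^+ 2 * e p + l * B v + e v.
  rewrite /e /B mulmxDl -scalemxAl !dotDl !dotDr !(dotZl l) !(dotZr l).
  by move: (dot _ _) (dot _ _) (dot _ _) (dot _ _) => *; ring.
have qD l (v : V) : dot (b x) v = 0 -> dot ((l *: p + v) *m a x) (l *: p + v) =
    l ^+ 2 * u + dot (v *m a x) v.
  move=> bv; rewrite mulmxDl -scalemxAl !dotDl !dotDr !(dotZl l) !(dotZr l) pap.
  rewrite (dot_mulmx v) (asym Ux) (dotC v) !bsharp_a// bv.
  by ring.
(* On the line, beta is the constant u and alpha^2 - beta^2 is A + t^2 |v|^2. The conclusions remove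
   the cross term of e and fix the ratio of its values at [v] and at b^#; since every y is l b^# +
   v, this determines e. *)
have key (v : V) : dot (b x) v = 0 -> B v = 0 /\ e p * dot (v *m a x) v = e v * A.
  move=> bv; have [->|v0] := eqVneq v 0.
    by rewrite /B /e !mul0mx !dot0l !dot0r mulr0 mul0r addr0.
  have w0 : 0 < dot (v *m a x) v := apos Ux v0.
  have bl t : beta (x, p + t *: v) = u by rewrite /beta/= dotDr pb dotZr bv mulr0 addr0.
  have nz t : p + t *: v != 0.
    apply: contraTneq u0 => h0; have := bl t; rewrite h0 /beta/= dot0r => <-.
    by rewrite ltxx.
  have [G hG] := odd_ricci_line Ux nz.
  apply: (@quadratic_square_divisible _ (3 / 2 * u) A (dot (v *m a x) v) _ _ _ G) => //.
    by rewrite mulf_neq0 ?gt_eqF// divr_gt0.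
  move=> t; have := hG t; rewrite /= bl eform_mxE//= -/E -/(e _).
  have -> : p + t *: v = 1 *: p + t *: v by rewrite scale1r.
  rewrite qD; last by rewrite dotZr bv mulr0.
  have Bt : B (t *: v) = B v * t by rewrite /B -scalemxAl (dotZr t) (dotZl t) -mulrDr mulrC.
  have et : e (t *: v) = e v * t ^+ 2.
    by rewrite /e -scalemxAl (dotZl t) (dotZr t) mulrA mulrC expr2.
  rewrite eD Bt et -scalemxAl (dotZl t) (dotZr t) expr1n !mul1r => ->.
  by rewrite /A; ring.
exists (e p / (2 * A)) => y; rewrite eform_mxE//= -/E -/(e _).
pose l := dot (b x) y / u; pose v := y - l *: p.
have bv : dot (b x) v = 0.
  by rewrite /v dotDr dotNr dotZr pb /l mulfVK ?gt_eqF// subrr.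
have yE : y = l *: p + v by rewrite /v addrC subrK.
have by' : beta (x, y) = l * u by rewrite /beta/= /l mulfVK// gt_eqF.
have [B0 ev] := key v bv.
rewrite by' yE eD B0 qD//.
have -> : e v = e p * dot (v *m a x) v / A by rewrite ev mulfK// gt_eqF.
have A0' : A != 0 by rewrite gt_eqF.
have -> : l ^+ 2 * u + dot (v *m a x) v - (l * u) ^+ 2 = l ^+ 2 * A + dot (v *m a x) v.
  by rewrite /A; ring.
move: A A0' {A0 key} (e p) (dot (v *m a x) v) {ev B0} => A A0' ep w.
by field.
Qed.

End ConformalForm.

(** * The elliptic equation for the norm of the 1-form *)

Section ConformalFactor.
Variables (R : realType) (n : nat).
Notation V := 'rV[R]_n.
Notation e_ i := (delta_mx 0 i : V).
Variables (U : set V) (a : V -> 'M[R]_n) (b : V -> V) (L : V * V -> R).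
Hypothesis HD : randers_data U a b L.
Let oU := rd_open HD.
Let Ca := rd_Ca HD.
Let Cb := rd_Cb HD.
Let asym := rd_sym HD.
Let apos := rd_pos HD.
Local Notation slit := (slit U).
Local Notation h := (metric_inverse a).
Local Notation Gbar := (Gbar a).
Local Notation christoffel := (christoffel a).
Local Notation S := (S a b).
Local Notation sform := (sform a b).
Local Notation curl := (curl b).
Local Notation smx := (smx a b).
Local Notation rform := (rform a b).
Local Notation eform := (eform a b).
Local Notation eform_mx := (eform_mx a b).
Local Notation Delta := (Delta a b).
Local Notation mN := (mN a).
Local Notation beta := (beta b).
Local Notation xi := (xi a).
Local Notation s0 := (s0 a b).
Local Notation t0 := (t0 a b).
Local Notation bsharp := (bsharp a b).
Local Notation bnorm2 := (bnorm2 a b).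
Implicit Types (x y w : V) (z : V * V).
Let oS : open slit := open_slit HD.

Lemma Ck_bsharp k : Ck k U bsharp.
Proof. exact: (Ck_mulmx oU (Cb k) (Ck_metric_inverse HD k)). Qed.

Lemma Ck_bnorm2 k : Ck k U bnorm2.
Proof. exact: (Ck_dot oU (Ck_bsharp k) (Cb k)). Qed.

Lemma dot_h x y w : U x -> dot (y *m h x) w = dot y (w *m h x).
Proof. by move=> Ux; rewrite dot_mulmx (hsym HD). Qed.

Lemma isd_bsharp x w : U x ->
  is_derive x w bsharp (('D_w b x - bsharp x *m 'D_w a x) *m h x).
Proof.
move=> Ux; have hb := isd_diff w ((Cb 0).1 _ Ux).
have hh := isd_invmx w oU Ux (fun y => aunit HD (x := y)) (Ca 0).
apply: (is_derive_eq (isd_mulmx hb hh)).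
rewrite mulmxBl mulmxN !mulmxA; exact: erefl.
Qed.

Lemma isd_bnorm2 x w : U x -> is_derive x w bnorm2
  (2 * dot ('D_w b x) (bsharp x) - dot (bsharp x *m 'D_w a x) (bsharp x)).
Proof.
move=> Ux; have hb := isd_diff w ((Cb 0).1 _ Ux).
apply: (is_derive_eq (isd_dot (isd_bsharp w Ux) hb)).
rewrite (dot_h _ _ Ux) -/(bsharp x) dotDl dotNl (dotC (bsharp x) ('D_w b x)).
by move: (dot _ _) (dot _ _) => A B; ring.
Qed.

Lemma dot_curl x y w : U x -> 2 * dot (y *m curl x) w = dot ('D_y b x) w - dot ('D_w b x) y.
Proof.
move=> Ux; rewrite /curl -scalemxAr (dotZl 2^-1) mulrA mulfV ?mul1r ?pnatr_eq0//.
rewrite mulmxBr dotDl dotNl (mul_db HD)// (dot_mulmx y w (db b x)^T) trmxK.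
by rewrite (mul_db HD)// (dotC y).
Qed.

Lemma dot_christoffel_bsharp x w : U x ->
  dot (christoffel x (bsharp x) w) (b x) = 2^-1 * dot (bsharp x *m 'D_w a x) (bsharp x).
Proof.
move=> Ux; rewrite /christoffel (dotZl 2^-1) (dot_h _ _ Ux) -/(bsharp x) !dotDl dotNl.
have -> : dot (grad_form a x (bsharp x) w) (bsharp x) = dot (w *m 'D_(bsharp x) a x) (bsharp x).
  rewrite (dot_mulmx w) (Dasym HD)// (dotC w) -(sum_Da HD)//; apply: eq_bigr => l _.
  by rewrite [_ 0 l]mxE mulrC.
by rewrite addrK.
Qed.

Lemma dot_sform x w : dot (sform x) w = - dot (bsharp x *m curl x) w.
Proof. by rewrite /sform dotNl. Qed.

Lemma sform_bsharp x : dot (sform x) (bsharp x) = 0.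
Proof. by rewrite dot_sform curl_dot oppr0. Qed.

(** The contraction of the derivative of b with b^# is half the gradient of u in one slot;
    exchanging the slots adds twice the curl, that is -2 s_j. *)
Lemma eform_mx_bsharp x w : U x ->
  dot (bsharp x *m eform_mx x) w + dot (w *m eform_mx x) (bsharp x) =
  'D_w bnorm2 x - 2 * dot (sform x) w + 2 * bnorm2 x * dot (sform x) w.
Proof.
move=> Ux; rewrite !(eform_mx_dot HD)// (christoffelC HD w)//.
rewrite (dot_christoffel_bsharp w Ux) (isd_val (isd_bnorm2 w Ux)) sform_bsharp.
have key (A u B C D E : R) : 2 * E = D - C ->
    D - 2^-1 * A + 2 * (u * - E) + (C - 2^-1 * A + 2 * (B * 0)) =
    2 * C - A - 2 * - E + 2 * u * - E.
  by move=> H; have -> : D = 2 * E + C by [rewrite H; ring]; field.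
rewrite (dot_sform x w) (dotC (b x) (bsharp x)) -/(bnorm2 x).
exact: (key _ _ _ _ _ _ (dot_curl (bsharp x) w Ux)).
Qed.

Definition bgrad x : V := \row_i 'D_(e_ i) bnorm2 x.

Lemma Ck_bgrad k : Ck k U bgrad.
Proof.
apply: (Ck_entries oU) => i j.
rewrite (_ : (fun x => _) = 'D_(e_ j) bnorm2); first exact: CkS_derive (Ck_bnorm2 k.+1).
by apply/funext => x; rewrite mxE.
Qed.

Lemma derive_bnorm2 x w : U x -> 'D_w bnorm2 x = dot w (bgrad x).
Proof.
move=> Ux; rewrite (derive_basis w ((Ck_bnorm2 0).1 _ Ux)).
by apply: eq_bigr => i _; rewrite [in RHS]mxE.
Qed.

(** The value that [cfactorP] forces on c. Having it as a formula in u and du, instead of a witness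
    chosen at each point, makes it smooth where b is nonzero. *)
Definition cfactor x : R := dot (bsharp x) (bgrad x) * (4 * (bnorm2 x * (1 - bnorm2 x)))^-1.

Definition bsupp : set V := [set x | U x /\ b x != 0].

Lemma open_bsupp : open bsupp.
Proof.
rewrite openE => x [Ux b0]; have nU := open_nbhs_nbhs (conj oU Ux).
have /cvgrPdist_lt cu := Ck_continuous (Ck_bnorm2 0) Ux.
have := cu _ (bnorm2_gt0 HD Ux b0).
move=> h; near=> y; split; first by near: y.
have : `|bnorm2 x - bnorm2 y| < bnorm2 x by near: y; exact: h.
by apply: contraTneq => by0; rewrite /bnorm2 by0 dot0r subr0 ger0_norm ?ltxx// ltW// (bnorm2_gt0 HD).
Unshelve. all: by end_near.
Qed.

Lemma phi_neq0 x : bsupp x -> 4 * (bnorm2 x * (1 - bnorm2 x)) != 0.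
Proof.
move=> [Ux b0]; rewrite !mulf_neq0 ?pnatr_eq0//.
  by rewrite gt_eqF// (bnorm2_gt0 HD).
by rewrite gt_eqF// subr_gt0 (bnorm2_lt1 HD).
Qed.

Lemma Ck_cfactor k : Ck k bsupp cfactor.
Proof.
have sub : bsupp `<=` U by move=> x [].
have oW := open_bsupp.
have Cu := Ck_sub sub (Ck_bnorm2 k).
have C1 : Ck k bsupp (fun _ : V => 1 : R) by exact: Ck_cst.
apply: (Ck_mul oW (Ck_dot oW (Ck_sub sub (Ck_bsharp k)) (Ck_sub sub (Ck_bgrad k)))).
apply: (Ck_inv oW phi_neq0); apply: (Ck_scale _ oW).
exact: (Ck_mul oW Cu (Ck_sub2 oW C1 Cu)).
Qed.

Variable K : R.
Hypothesis n2 : (2 <= n)%N.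
Hypothesis HE : forall z, slit z ->
  \sum_i riemann_curvature L i i z = (n%:R - 1) * K * L z ^+ 2.

Definition Qform z : R := dot (z.2 *m a z.1) z.2 - beta z ^+ 2.

Lemma Qform_bsharp x : U x -> Qform (x, bsharp x) = bnorm2 x * (1 - bnorm2 x).
Proof.
move=> Ux; rewrite /Qform /beta/= (bsharp_a HD)// [dot (b x) _]dotC -/(bnorm2 x).
by ring.
Qed.

(** Polarise e = 2 c (alpha^2 - beta^2) and put b^# in one slot: this is the second conclusion. With
    b^# in the other slot too, the term in s_j vanishes and c can be solved for. *)
Lemma cfactorP x : bsupp x ->
  (forall y, eform (x, y) = 2 * cfactor x * Qform (x, y)) /\
  (forall w, 2 * (1 - bnorm2 x) * dot (sform x) w =
     dot w (bgrad x) - 4 * cfactor x * (1 - bnorm2 x) * dot (b x) w).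
Proof.
move=> bx; have ph0 := phi_neq0 bx; have [Ux b0] := bx.
have [c hc] := eform_conformal HD n2 HE Ux b0.
have u0 := bnorm2_gt0 HD Ux b0; have u1 := bnorm2_lt1 HD Ux b0.
have polar y w : dot (y *m eform_mx x) w + dot (w *m eform_mx x) y =
    2 * c * (2 * dot (y *m a x) w - 2 * dot (b x) y * dot (b x) w).
  have qE v : dot (v *m eform_mx x) v = 2 * c * (dot (v *m a x) v - dot (b x) v ^+ 2).
    by rewrite -(eform_mxE HD (z := (x, v)))// hc.
  have ss : dot (w *m a x) y = dot (y *m a x) w by rewrite (dot_mulmx w y (a x)) (asym Ux) dotC.
  have hs := qE (y + w); rewrite !mulmxDl !dotDl !dotDr (qE y) (qE w) ss in hs.
  move: hs {qE ss}; move: (dot (b x) y) (dot (b x) w) (dot (y *m a x) y) (dot (w *m a x) w).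
  move: (dot (y *m a x) w) (dot (y *m eform_mx x) w) (dot (w *m eform_mx x) y).
  move=> A B C D E F G H.
  have -> : B + C = 2 * c * (F - D ^+ 2) + B + (C + 2 * c * (G - E ^+ 2)) -
    2 * c * (F - D ^+ 2) - 2 * c * (G - E ^+ 2) by ring.
  by rewrite H; ring.
have eq1 w : 2 * (1 - bnorm2 x) * dot (sform x) w =
    dot w (bgrad x) - 4 * c * (1 - bnorm2 x) * dot (b x) w.
  have := polar (bsharp x) w; rewrite (eform_mx_bsharp w Ux) (bsharp_a HD)// derive_bnorm2//.
  rewrite (dotC (b x) (bsharp x)) -/(bnorm2 x).
  move: (dot _ _) (dot _ _) (dot _ _) (bnorm2 x) => A B C D E.
  have -> : C = 2 * c * (2 * A - 2 * D * A) + 2 * B - 2 * D * B by rewrite -E; ring.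
  by ring.
have cE : c = cfactor x.
  have := eq1 (bsharp x); rewrite sform_bsharp mulr0 (dotC (b x) (bsharp x)) -/(bnorm2 x) /cfactor.
  move=> /esym/eqP; rewrite subr_eq0 => /eqP ->.
  rewrite (_ : 4 * c * (1 - bnorm2 x) * bnorm2 x = c * (4 * (bnorm2 x * (1 - bnorm2 x)))) ?mulfK//.
  by ring.
by rewrite -cE; split.
Qed.

Lemma slit_bsharp x : bsupp x -> slit (x, bsharp x).
Proof.
move=> [Ux b0]; split => //=; apply: contraTneq (bnorm2_gt0 HD Ux b0) => s0.
by rewrite /bnorm2 s0 dot0l ltxx.
Qed.

Lemma Qform_L z : slit z -> Qform z = L z ^+ 2 - 2 * L z * beta z.
Proof.
by move=> sz; rewrite /Qform -(alpha_sqr HD sz) /alpha -/(beta z); ring.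
Qed.

Lemma derive_Qform z v : slit z ->
  'D_v Qform z = 2 * (L z - beta z) * 'D_v L z - 2 * L z * 'D_v beta z.
Proof.
move=> sz; have dL := isd_diff v ((rd_CL HD 0).1 _ sz).
have db : is_derive z v beta ('D_v beta z) by exact: (isd_diff v ((Ck_beta HD 0).1 _ sz)).
have hh := isd_sub (isd_mul dL dL) (isd_mul (isd_scale 2 dL) db).
transitivity ('D_v (fun z => L z * L z - 2 * L z * beta z) z).
  by apply: near_eq_derive; apply: filterS (open_nbhs_nbhs (conj oS sz)) => z' /Qform_L ->; rewrite expr2.
rewrite (isd_val hh); move: ('D_v L z) ('D_v beta z) (L z) (beta z) => A B C D; ring.
Qed.

Lemma derive_xi_beta z : slit z -> 'D_(xi z) beta z = rform z.
Proof.
move=> [Uz z0]; have hb := isd_fst (xi z) ((Cb 0).1 _ Uz).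
rewrite (isd_val (isd_dot hb (isd_snd_id z (xi z)))) /= dotNr (dotZr 2) /rform (dotC (Gbar z)).
exact: erefl.
Qed.

Lemma derive_S_beta z : slit z -> 'D_((0, S z.1 z.2) : V * V) beta z = s0 z.
Proof.
move=> [Uz z0]; have hb := isd_fst ((0, S z.1 z.2) : V * V) ((Cb 0).1 _ Uz).
rewrite (isd_val (isd_dot hb (isd_snd_id z _))) /= derive0 dot0l add0r dotC.
exact: (dot_S_b HD).
Qed.

Lemma derive_eform_conformal z v : bsupp z.1 -> slit z -> 'D_v eform z =
  2 * 'D_(v.1) cfactor z.1 * Qform z + 2 * cfactor z.1 * 'D_v Qform z.
Proof.
move=> bz sz; have oW : open [set z : V * V | bsupp z.1] := @open_fst R V V _ open_bsupp.
have dc := isd_fst v ((Ck_cfactor 0).1 _ bz).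
have dQ : differentiable Qform z.
  have CQ : Ck 0 slit (fun z => L z * L z - 2 * L z * beta z).
    have CL := rd_CL HD 0.
    apply: (Ck_sub2 oS (Ck_mul oS CL CL)); apply: (Ck_mul oS _ (Ck_beta HD 0)).
    exact: (Ck_scale _ oS CL).
  have CQ' : Ck 0 slit Qform.
    by apply: (Ck_ext oS _ CQ) => z' sz'; rewrite (Qform_L sz') expr2.
  exact: CQ'.1.
have hh := isd_mul (isd_scale 2 dc) (isd_diff v dQ).
transitivity ('D_v (fun z => 2 * cfactor z.1 * Qform z) z); last exact: (isd_val hh).
apply: near_eq_derive; apply: filterS (open_nbhs_nbhs (conj oW bz)) => -[x y] bx.
exact: ((cfactorP bx).1 y).
Qed.

Definition sform_norm2 x : R := dot (sform x) (sform x *m h x).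

Lemma S_bsharp x : S x (bsharp x) = - (sform x *m h x).
Proof. by rewrite /S /sform mulNmx opprK. Qed.

(** The odd identity at y = b^#, where s_0 and the derivative of e along S vanish. After inserting e
    = 2 c Q the square of Q = u (1 - u) can be divided out. *)
Lemma Delta_bsharp x : bsupp x -> Delta (x, bsharp x) =
  (n%:R - 1) * ((K + cfactor x ^+ 2) * bnorm2 x + 'D_(bsharp x) cfactor x / 2 - sform_norm2 x).
Proof.
move=> bx; have sz := slit_bsharp bx; have [Ux b0] := bx.
have N0 : (n%:R - 1 : R) != 0.
  by rewrite subr_eq0 pnatr_eq1; case: (n) n2 => [|[]].
have Q0 : bnorm2 x * (1 - bnorm2 x) != 0.
  by have := phi_neq0 bx; rewrite mulf_eq0 negb_or => /andP[].
have sb : s0 (x, bsharp x) = 0 by exact: sform_bsharp.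
have bb : beta (x, bsharp x) = bnorm2 x by rewrite /beta dotC.
have tb : t0 (x, bsharp x) = - sform_norm2 x by rewrite /t0 S_bsharp dotNr.
have eE := (cfactorP bx).1 (bsharp x).
have rE : rform (x, bsharp x) = eform (x, bsharp x).
  by rewrite /eform -/(s0 _) sb mulr0 addr0.
have XE : 'D_(xi (x, bsharp x)) eform (x, bsharp x) =
  2 * 'D_(bsharp x) cfactor x * Qform (x, bsharp x) -
  4 * cfactor x * bnorm2 x * (2 * cfactor x * Qform (x, bsharp x)).
  rewrite derive_eform_conformal// derive_Qform// (derive_xi_L HD sz) (derive_xi_beta sz) rE bb.
  rewrite eE /=; move: ('D__ _ _) (Qform _) (L _) (cfactor _) (bnorm2 _) => *; ring.
have YE : 'D_((0, S (x, bsharp x).1 (x, bsharp x).2) : V * V) eform (x, bsharp x) = 0.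
  rewrite derive_eform_conformal// derive_Qform// (derive_S_L HD sz) (derive_S_beta sz) sb /=.
  by rewrite derive0 !mulr0 mul0r subrr mulr0 addr0.
have := odd_ricci HD n2 sz HE; rewrite XE YE sb tb bb eE /= -bb -/(Qform (x, bsharp x)) bb.
rewrite (Qform_bsharp Ux).
have key (D s u c dc N : R) : u * (1 - u) != 0 -> N != 0 ->
    - (3 / 2) * (2 * c * (u * (1 - u))) ^+ 2 * u + u * (1 - u) *
    (-2 * (2 * c * (u * (1 - u))) * 0 -
     (2 * dc * (u * (1 - u)) - 4 * c * u * (2 * c * (u * (1 - u)))) / 2 - 0 * u) +
    (u * (1 - u)) ^+ 2 * (2 * D / N - 2 * - s - 2 * K * u) = 0 ->
    D = N * ((K + c ^+ 2) * u + dc / 2 - s).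
  move=> q0 N1 H.
  have : (u * (1 - u)) ^+ 2 * (- 6 * c ^+ 2 * u - dc + 4 * c ^+ 2 * u +
    (2 * D / N + 2 * s - 2 * K * u)) = 0 by rewrite -H; field.
  move/eqP; rewrite mulf_eq0 expf_eq0/= (negbTE q0)/= => /eqP {}H.
  have -> : D = N / 2 * ((2 * c ^+ 2 * u + dc - 2 * s + 2 * K * u) +
    (- 6 * c ^+ 2 * u - dc + 4 * c ^+ 2 * u + (2 * D / N + 2 * s - 2 * K * u))) by field.
  by rewrite H; field.
exact: (key _ _ _ _ _ _ Q0 N0).
Qed.

(** Transposition and cyclicity show that the trace is its own opposite. *)
Lemma trace_sym_antisym m (P Q H : 'M[R]_m) : P^T = P -> Q^T = - Q -> H^T = H ->
  \tr (P *m H *m (Q *m H)) = 0.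
Proof.
move=> sP aQ sH; have : \tr (P *m H *m (Q *m H)) = - \tr (P *m H *m (Q *m H)).
  rewrite -{1}mxtrace_tr !trmx_mul sP aQ sH mulmxN mulNmx linearN/=.
  by congr (- _); rewrite [in LHS]mulmxA [LHS]mxtrace_mulC !mulmxA.
by move=> hh; lra.
Qed.

Definition dbsharp x : 'M[R]_n := \matrix_(i, j) ('D_(e_ i) bsharp x) 0 j.

(** The left factor is the covariant derivative of b^#. It splits into a symmetric part and the
    curl, and the symmetric part is trace-orthogonal to the curl. *)
Lemma trace_dbsharp x : U x ->
  \tr ((mN x (bsharp x) + dbsharp x) *m smx x) = \tr (smx x *m smx x).
Proof.
move=> Ux; pose X : 'M[R]_n := \matrix_(i < n) (bsharp x *m 'D_(e_ i) a x).
have half (B D Y : 'M[R]_n) : 2^-1 *: (Y + D - Y^T) + (B - Y) =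
    2^-1 *: (B - B^T) + 2^-1 *: (B + B^T + D - (Y + Y^T)).
  by apply/matrixP => i j; rewrite !mxE; field.
have half_sym (B D Y : 'M[R]_n) : D^T = D ->
    (2^-1 *: (B + B^T + D - (Y + Y^T)))^T = 2^-1 *: (B + B^T + D - (Y + Y^T)).
  move=> sD; apply/matrixP => i j; have := congr1 (fun M : 'M[R]_n => M i j) sD.
  by rewrite !mxE => ->; ring.
have E : mN x (bsharp x) + dbsharp x =
    (2^-1 *: (X + 'D_(bsharp x) a x - X^T) + (db b x - X)) *m h x.
  rewrite [RHS]mulmxDl -(scalemxAl 2^-1 (X + _ - _)); congr (_ + _); apply/row_matrixP => i.
    have -> : row i (mN x (bsharp x)) = christoffel x (bsharp x) (e_ i).
      by rewrite rowE (mul_mN HD).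
    rewrite /christoffel; have -> : grad_form a x (bsharp x) (e_ i) = row i X^T.
      by apply/rowP => j; rewrite [LHS]mxE dot_deltar [RHS]mxE [RHS]mxE [RHS]mxE.
    rewrite linearZ/= row_mul linearB/= linearD/= (rowE i ('D__ _ _)).
    by rewrite /X rowK.
  have -> : row i (dbsharp x) = 'D_(e_ i) bsharp x by apply/rowP => j; rewrite [LHS]mxE [LHS]mxE.
  rewrite (isd_val (isd_bsharp (e_ i) Ux)) row_mul linearB/= /X rowK.
  congr ((_ - _) *m _); apply/rowP => j; rewrite [RHS]mxE [RHS]mxE; exact: erefl.
rewrite E half mulmxDl mulmxDl linearD/=.
have T0 : \tr (2^-1 *: (db b x + (db b x)^T + 'D_(bsharp x) a x - (X + X^T)) *m h x *m smx x) = 0 :=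
  trace_sym_antisym (half_sym (db b x) ('D_(bsharp x) a x) X (Dasym HD (bsharp x) Ux))
    (curl_antisym b x) (hsym HD Ux).
rewrite T0 addr0; exact: erefl.
Qed.

(** Leibniz rule for s^# = - b^# s: the covariant derivative falling on b^# gives the trace of s^2,
    and falling on s it gives [Delta] at b^#. The left-hand side is a bare coordinate divergence,
    whence the Christoffel trace on the right. *)
Lemma divergence_sform x : U x ->
  \sum_i ('D_(e_ i) (fun x => sform x *m h x) x) 0 i =
  - Delta (x, bsharp x) - \tr (mN x (sform x *m h x)) - \tr (smx x *m smx x).
Proof.
move=> Ux; have Csm := Ck_mulmx oU (Ck_curl HD 0) (Ck_metric_inverse HD 0).
have D i : 'D_(e_ i) (fun x => sform x *m h x) x =
    - (row i (dbsharp x) *m smx x) - bsharp x *m 'D_(e_ i) smx x.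
  have E : (fun x => sform x *m h x) = (fun x => - (bsharp x *m smx x)).
    by apply/funext => x'; rewrite /sform mulNmx mulmxA.
  have -> : row i (dbsharp x) = 'D_(e_ i) bsharp x by apply/rowP => j; rewrite [LHS]mxE [LHS]mxE.
  have hb := isd_diff (e_ i) ((Ck_bsharp 0).1 _ Ux); have hs := isd_diff (e_ i) (Csm.1 _ Ux).
  by rewrite E (isd_val (isd_oppmx (isd_mulmx hb hs))) opprD.
have -> : \sum_i ('D_(e_ i) (fun x => sform x *m h x) x) 0 i =
    - \tr (dbsharp x *m smx x) - \sum_i (bsharp x *m 'D_(e_ i) smx x) 0 i.
  rewrite -sumrN -sumrN -big_split; apply: eq_bigr => i _ /=.
  rewrite (D i) [LHS]mxE; congr (_ + _); last by rewrite [LHS]mxE.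
  by rewrite [LHS]mxE -row_mul [in LHS]mxE.
have T : \tr (smx x *m smx x) = \tr (mN x (bsharp x) *m smx x) + \tr (dbsharp x *m smx x).
  by rewrite -(trace_dbsharp Ux) mulmxDl linearD.
rewrite T.
have -> : Delta (x, bsharp x) = \sum_i (bsharp x *m 'D_(e_ i) smx x) 0 i
    - \tr (mN x (sform x *m h x)) - \tr (mN x (bsharp x) *m smx x).
  rewrite /Delta /= S_bsharp (mN_flip HD _ Ux); congr (_ + _ - _); last exact: linearN.
  apply: eq_bigr => i _; exact: (derive_S_x HD).
have key (A B C E : R) : - C - A = - (A - B - E) - B - (E + C) by ring.
exact: key.
Qed.

(** In the frame given by [D] the trace becomes minus the squared Frobenius norm of an antisymmetric
    matrix; its sign, and what its vanishing means, follow. *)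
Let trace_smx2 x (D : 'M[R]_n) : h x = D^T *m D ->
  \tr (smx x *m smx x) = - \tr (D *m curl x *m D^T *m (D *m curl x *m D^T)^T).
Proof.
have key (C : 'M[R]_n) : C^T = - C ->
    \tr (C *m (D^T *m D) *m (C *m (D^T *m D))) = - \tr (D *m C *m D^T *m (D *m C *m D^T)^T).
  move=> aC; rewrite !trmx_mul trmxK aC.
  rewrite mulNmx mulmxN mulmxN linearN/= opprK.
  by rewrite !mulmxA [LHS]mxtrace_mulC !mulmxA.
by move=> hD; rewrite -(key _ (curl_antisym b x)) -hD.
Qed.

Lemma curl_norm2_ge0 x : U x -> 0 <= - \tr (smx x *m smx x).
Proof.
move=> Ux; have [D hD] := posdef_decomposition (hsym HD Ux) (posdef_invmx (asym Ux) (apos Ux)).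
pose N := D *m curl x *m D^T.
rewrite (trace_smx2 hD) opprK -/N.
apply: sumr_ge0 => i _; rewrite mxE; apply: sumr_ge0 => j _.
by rewrite [_^T _ _]mxE -expr2 sqr_ge0.
Qed.

Lemma curl_norm2_eq0 x : U x -> \tr (smx x *m smx x) = 0 -> curl x = 0.
Proof.
move=> Ux; have [D hD] := posdef_decomposition (hsym HD Ux) (posdef_invmx (asym Ux) (apos Ux)).
pose N := D *m curl x *m D^T.
rewrite (trace_smx2 hD) -/N.
move/eqP; rewrite oppr_eq0 => /eqP tN.
have N0 : N = 0.
  have E i : (N *m N^T) i i = \sum_j N i j ^+ 2.
    by rewrite mxE; apply: eq_bigr => k _; rewrite [_^T _ _]mxE expr2.
  move: tN => /psumr_eq0P tN; apply/matrixP => i j; rewrite [RHS]mxE.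
  have /psumr_eq0P hij : \sum_j N i j ^+ 2 = 0.
    by rewrite -E ?tN// => k _; rewrite E// sumr_ge0// => l _; exact: sqr_ge0.
  by apply/eqP; rewrite -sqrf_eq0; apply/eqP; apply: hij => // l _; exact: sqr_ge0.
have uD : D \in unitmx.
  have : h x \in unitmx by rewrite unitmx_inv (aunit HD).
  by rewrite hD unitmx_mul => /andP[].
have : N *m invmx D^T = 0 by rewrite N0 mul0mx.
rewrite mulmxK ?unitmx_tr// => /(congr1 (fun M => invmx D *m M)).
by rewrite mulKmx// mulmx0.
Qed.

End ConformalFactor.

Lemma continuous_near_bounded (R : realType) (V : normedModType R) (f : V -> R) x0 : {for x0, continuous f} ->
  \forall x \near x0, `|f x| <= `|f x0| + 1.
Proof.
move=> /cvgrPdist_lt /(_ 1 ltr01); apply: filterS => x h.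
have -> : f x = f x0 - (f x0 - f x) by ring.
by rewrite (le_trans (ler_normB _ _))// lerD2l ltW.
Qed.

(** * Functions dominated by a gradient *)

Section Dominated.
Variables (R : realType) (n : nat) (g : 'rV[R]_n -> 'rV[R]_n) (x0 : 'rV[R]_n).
Notation V := 'rV[R]_n.

Let nearE (P : V -> Prop) : (forall x, P x) -> \forall x \near x0, P x.
Proof. by move=> h; near=> x; exact: h. Unshelve. all: by end_near. Qed.

(** The relation T = O(|g|) near [x0]. It is stable under sums and under multiplication by
    continuous functions, so with g = du the first-order terms of an equation need not be collected
    into a drift. *)
Definition dominated (T : V -> R) := exists B, 0 <= B /\
  \forall x \near x0, `|T x| <= B * \sum_i `|g x 0 i|.

Lemma dominated_add S T : dominated S -> dominated T -> dominated (fun x => S x + T x).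
Proof.
move=> [B [B0 hB]] [C [C0 hC]]; exists (B + C); split; first exact: addr_ge0.
apply: filterS2 hB hC => x hS hT; rewrite mulrDl (le_trans (ler_normD _ _))//.
exact: lerD.
Qed.

Lemma dominated_opp T : dominated T -> dominated (fun x => - T x).
Proof.
by move=> [B [B0 hB]]; exists B; split => //; apply: filterS hB => x; rewrite normrN.
Qed.

Lemma dominated_mul (f T : V -> R) : {for x0, continuous f} -> dominated T ->
  dominated (fun x => f x * T x).
Proof.
move=> /continuous_near_bounded hf [B [B0 hB]]; exists ((`|f x0| + 1) * B).
split; first by rewrite mulr_ge0// addr_ge0.
by apply: filterS2 hf hB => x h1 h2; rewrite normrM -mulrA ler_pM.
Qed.

Lemma dominated_coord i : dominated (fun x => g x 0 i).
Proof.
exists 1; split => //; apply: nearE => x; rewrite mul1r (bigD1 i)//= lerDl.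
exact: sumr_ge0.
Qed.

Lemma dominated_sum (I : Type) (r : seq I) (T : I -> V -> R) :
  (forall i, dominated (T i)) -> dominated (fun x => \sum_(i <- r) T i x).
Proof.
move=> hT; elim: r => [|i r ih].
  by exists 0; split => //; apply: nearE => x; rewrite big_nil normr0 mul0r.
have [B [B0 hB]] := dominated_add (hT i) ih; exists B; split => //.
by apply: filterS hB => x; rewrite big_cons.
Qed.

Lemma dominated_ext (S T : V -> R) : (\forall x \near x0, S x = T x) -> dominated S ->
  dominated T.
Proof.
by move=> h [B [B0 hB]]; exists B; split => //; apply: filterS2 h hB => x ->.
Qed.

Lemma dominated_dotl (S f : V -> V) : (forall i, dominated (fun x => S x 0 i)) ->
  (forall i, {for x0, continuous (fun x => f x 0 i)}) ->
  dominated (fun x => dot (S x) (f x)).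
Proof.
move=> hS hf; apply: dominated_sum => i; have := dominated_mul (hf i) (hS i).
by apply: dominated_ext; apply: nearE => x; rewrite mulrC.
Qed.

End Dominated.

(** A local upper bound C for the form of [a] gives the lower bound 1/C for the form of its inverse,
    by Cauchy-Schwarz applied to [w *m invmx (a x)] and [w]. *)
Lemma posdef_near (R : realType) n (U : set 'rV[R]_n) (a : 'rV[R]_n -> 'M[R]_n) x0 :
  open U -> U x0 -> (forall x, U x -> (a x)^T = a x) ->
  (forall x, U x -> forall v, v != 0 -> 0 < dot (v *m a x) v) -> Ck 0 U a ->
  exists2 theta : R, 0 < theta & \forall x \near x0, forall w : 'rV_n,
    theta * dot w w <= dot (w *m invmx (a x)) w.
Proof.
move=> oU Ux0 sa pa Ca.
(* One continuous function that bounds all entries of [a] at once. *)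
have Ca' : Ck 0 U (fun x => \sum_i \sum_j (a x i j) ^+ 2).
  apply: (Ck_sum oU) => i _; apply: (Ck_sum oU) => j _.
  by apply: (Ck_ext oU _ (Ck_mul oU (Ck_mx oU Ca i j) (Ck_mx oU Ca i j))) => x _; rewrite expr2.
have := continuous_near_bounded (Ck_continuous Ca' Ux0).
set B := `| _ | + 1 => hB.
have B0 : 0 < B by rewrite ltr_wpDl.
pose C := n%:R * (n%:R * (1 + B)) + 1.
have C0 : 0 < C by rewrite ltr_wpDl// !mulr_ge0// ?ler0n// addr_ge0// ltW.
exists C^-1; first by rewrite invr_gt0.
near=> x => w; have Ux : U x by near: x; exact: open_nbhs_nbhs.
have hx : `|\sum_i \sum_j (a x i j) ^+ 2| <= B by near: x; exact: hB.
have aij i j : `|a x i j| <= 1 + B.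
  have h1 : a x i j ^+ 2 <= B.
    apply: le_trans hx; rewrite ger0_norm; last by apply: sumr_ge0 => k _; apply: sumr_ge0 => l _; exact: sqr_ge0.
    rewrite (bigD1 i)//= (bigD1 j)//= -addrA lerDl addr_ge0//.
      by apply: sumr_ge0 => l _; exact: sqr_ge0.
    by apply: sumr_ge0 => k _; apply: sumr_ge0 => l _; exact: sqr_ge0.
  have [h2|h2] := lerP (`|a x i j|) 1; first by rewrite (le_trans h2)// lerDl ltW.
  rewrite -real_normK ?num_real// in h1.
  rewrite (le_trans _ (le_trans h1 _)) ?lerDr// expr2 ler_peMr// ltW//.
have waw : dot (w *m a x) w <= C * dot w w.
  rewrite dot_mulmxE.
  have step : forall i j, a x i j * w 0 i * w 0 j <= (1 + B) * dot w w.
    move=> i j; rewrite (le_trans (ler_norm _))// !normrM -mulrA ler_pM//.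
    have h2 := coord_sqr_le_dot w i; have h3 := coord_sqr_le_dot w j.
    rewrite -(real_normK (num_real (w 0 i))) in h2; rewrite -(real_normK (num_real (w 0 j))) in h3.
    have := sqr_ge0 (`|w 0 i| - `|w 0 j|); move: h2 h3; move: (`|w 0 i|) (`|w 0 j|) (dot w w) => p q r.
    by nra.
  apply: le_trans (_ : \sum_(i < n) \sum_(j < n) (1 + B) * dot w w <= _).
    by apply: ler_sum => i _; apply: ler_sum => j _; exact: step.
  rewrite !sumr_const !card_ord -[leLHS]mulr_natl -[(1 + B) * _ *+ n]mulr_natl /C.
  have -> : (n%:R * (n%:R * (1 + B)) + 1) * dot w w =
    n%:R * (n%:R * ((1 + B) * dot w w)) + dot w w by ring.
  by rewrite lerDl dot_ge0.
have ua : a x \in unitmx by apply: posdef_unitmx; exact: pa.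
have := dot_cauchy (w *m invmx (a x)) w (sa x Ux) (pa x Ux).
rewrite mulmxKV// (dotC w (w *m _)).
set p := dot (w *m invmx _) w => h.
have [w0|w0] := eqVneq w 0; first by rewrite /p w0 !dot0r mulr0.
have ww : 0 < dot w w by rewrite dot_gt0.
have p0 : 0 < p := posdef_invmx (sa x Ux) (pa x Ux) w0.
have : dot w w ^+ 2 <= p * (C * dot w w) by apply: le_trans h _; rewrite ler_pM2l.
rewrite expr2 mulrA ler_pM2r// => h2.
by rewrite mulrC ler_pdivrMr.
Unshelve. all: by end_near.
Qed.

(** * The elliptic inequality and its equality case *)

Section Rigidity.
Variables (R : realType) (n : nat).
Notation V := 'rV[R]_n.
Notation e_ i := (delta_mx 0 i : V).
Variables (U : set V) (a : V -> 'M[R]_n) (b : V -> V) (L : V * V -> R).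
Hypothesis HD : randers_data U a b L.
Let oU := rd_open HD.
Let Ca := rd_Ca HD.
Let Cb := rd_Cb HD.
Let asym := rd_sym HD.
Let apos := rd_pos HD.
Local Notation slit := (slit U).
Local Notation h := (metric_inverse a).
Local Notation Gbar := (Gbar a).
Local Notation christoffel := (christoffel a).
Local Notation S := (S a b).
Local Notation sform := (sform a b).
Local Notation curl := (curl b).
Local Notation smx := (smx a b).
Local Notation rform := (rform a b).
Local Notation eform := (eform a b).
Local Notation eform_mx := (eform_mx a b).
Local Notation Delta := (Delta a b).
Local Notation mN := (mN a).
Local Notation beta := (beta b).
Local Notation xi := (xi a).
Local Notation s0 := (s0 a b).
Local Notation t0 := (t0 a b).
Local Notation bsharp := (bsharp a b).
Local Notation bnorm2 := (bnorm2 a b).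
Local Notation bgrad := (bgrad a b).
Local Notation cfactor := (cfactor a b).
Local Notation bsupp := (bsupp U b).
Local Notation dbsharp := (dbsharp a b).
Local Notation sform_norm2 := (sform_norm2 a b).
Implicit Types (x y w : V) (z : V * V).
Variable K : R.
Hypothesis n2 : (2 <= n)%N.
Hypothesis HE : forall z, slit z ->
  \sum_i riemann_curvature L i i z = (n%:R - 1) * K * L z ^+ 2.
Let obs : open bsupp := open_bsupp HD.

(** [phi] and [psi] are the coefficients with which du enters [sform] and [cfactor]. *)
Definition phi x : R := (2 * (1 - bnorm2 x))^-1.
Definition psi x : R := (4 * (bnorm2 x * (1 - bnorm2 x)))^-1.
Definition hess (M : 'M[R]_n) x : R :=
  \sum_j \sum_k M j k * 'D_(e_ j) ('D_(e_ k) bnorm2) x.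

Lemma hessD (M N : 'M[R]_n) c x : hess (M + c *: N) x = hess M x + c * hess N x.
Proof.
rewrite /hess mulr_sumr -big_split; apply: eq_bigr => j _; rewrite mulr_sumr -big_split.
by apply: eq_bigr => k _; rewrite !mxE mulrDl mulrA.
Qed.

Lemma bsupp_sub : bsupp `<=` U. Proof. by move=> x []. Qed.

Lemma two_one_sub_neq0 x : bsupp x -> 2 * (1 - bnorm2 x) != 0.
Proof.
by move=> [Ux b0]; rewrite mulf_neq0 ?pnatr_eq0// gt_eqF// subr_gt0 (bnorm2_lt1 HD).
Qed.

Let CU k (Z : normedModType R) (f : V -> Z) : Ck k U f -> Ck k bsupp f.
Proof. exact: (Ck_sub bsupp_sub). Qed.

Lemma Ck_phi k : Ck k bsupp phi.
Proof.
apply: (Ck_inv obs two_one_sub_neq0); apply: (Ck_scale _ obs).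
have C1 : Ck k bsupp (fun _ : V => 1 : R) by exact: Ck_cst.
exact: (Ck_sub2 obs C1 (CU (Ck_bnorm2 HD k))).
Qed.

Lemma Ck_psi k : Ck k bsupp psi.
Proof.
apply: (Ck_inv obs (phi_neq0 HD)); apply: (Ck_scale _ obs).
have C1 : Ck k bsupp (fun _ : V => 1 : R) by exact: Ck_cst.
exact: (Ck_mul obs (CU (Ck_bnorm2 HD k)) (Ck_sub2 obs C1 (CU (Ck_bnorm2 HD k)))).
Qed.

Lemma derive_phi x w : bsupp x -> 'D_w phi x = 2 * phi x ^+ 2 * dot w (bgrad x).
Proof.
move=> bx; have Ux := bsupp_sub bx.
have hu := isd_diff w ((Ck_bnorm2 HD 0).1 _ Ux).
have h1 := isd_scale 2 (isd_sub (isd_cst x w 1) hu).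
have := @isd_inv _ _ (fun x => 2 * (1 - bnorm2 x)) _ _ _ (two_one_sub_neq0 bx) h1.
move=> /isd_val; rewrite -/phi => ->; rewrite (derive_bnorm2 HD _ Ux) /phi exprVn.
by move: (dot _ _) (2 * (1 - bnorm2 x)) => A B; rewrite sub0r mulrN opprK mulrAC.
Qed.

Lemma sformE x : bsupp x -> sform x = phi x *: bgrad x - (2 * cfactor x) *: b x.
Proof.
move=> bx; have n0 := two_one_sub_neq0 bx; apply/rowP => i.
have := (cfactorP HD n2 HE bx).2 (e_ i); rewrite dot_deltar dot_deltal dot_deltar => H.
have lin (p c : R) (G B : V) : (p *: G - c *: B) 0 i = p * G 0 i - c * B 0 i by rewrite !mxE.
rewrite lin; apply: (mulfI n0); rewrite H /phi; move: (bgrad x 0 i) (b x 0 i) (cfactor x) (bnorm2 x) n0 => A B c u n0.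
by field; move: n0; rewrite mulf_eq0 negb_or => /andP[].
Qed.

Lemma derive_bgrad x i j : U x -> ('D_(e_ i) bgrad x) 0 j = 'D_(e_ i) ('D_(e_ j) bnorm2) x.
Proof.
move=> Ux; have := (isd_mx _ _ _ _).2 (isd_diff (e_ i) ((Ck_bgrad HD 0).1 _ Ux)) 0 j.
move=> /isd_val <-; have -> : (fun x => bgrad x 0 j) = 'D_(e_ j) bnorm2; last exact: erefl.
by apply/funext => y; rewrite mxE.
Qed.

(** The divergence of [divergence_sform] computed a second time, from s = phi du - 2 c b. *)
Lemma divergence_sform_expand x : bsupp x ->
  \sum_i ('D_(e_ i) (fun x => sform x *m h x) x) 0 i =
  2 * phi x ^+ 2 * dot (bgrad x *m h x) (bgrad x)
  + phi x * (hess (h x) x + \sum_i (bgrad x *m 'D_(e_ i) h x) 0 i)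
  - 2 * 'D_(bsharp x) cfactor x - 2 * cfactor x * \tr (dbsharp x).
Proof.
move=> bx; have Ux := bsupp_sub bx.
have D i : ('D_(e_ i) (fun x => sform x *m h x) x) 0 i =
    2 * phi x ^+ 2 * ((bgrad x *m h x) 0 i * bgrad x 0 i)
    + (phi x * ((\sum_j h x i j * 'D_(e_ i) ('D_(e_ j) bnorm2) x) + (bgrad x *m 'D_(e_ i) h x) 0 i)
    - 2 * (bsharp x 0 i * 'D_(e_ i) cfactor x) - 2 * cfactor x * dbsharp x i i).
  have hp := isd_diff (e_ i) ((Ck_phi 0).1 _ bx).
  have hc := isd_diff (e_ i) ((Ck_cfactor HD 0).1 _ bx).
  have hg := isd_diff (e_ i) ((Ck_bgrad HD 0).1 _ Ux).
  have hh := isd_diff (e_ i) ((Ck_metric_inverse HD 0).1 _ Ux).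
  have hb := isd_diff (e_ i) ((Ck_bsharp HD 0).1 _ Ux).
  have H := isd_addmx (isd_scalemx hp (isd_mulmx hg hh)) (isd_oppmx (isd_scalemx (isd_scale 2 hc) hb)).
  have -> : 'D_(e_ i) (fun x => sform x *m h x) x =
      'D_(e_ i) (fun x => phi x *: (bgrad x *m h x) - (2 * cfactor x) *: bsharp x) x.
    apply: near_eq_derive; apply: filterS (open_nbhs_nbhs (conj obs bx)) => y bY.
    by rewrite (sformE bY) mulmxBl -(scalemxAl (phi y)) -(scalemxAl (2 * cfactor y)).
  rewrite (isd_val H) derive_phi// dot_deltal.
  have -> : \sum_j h x i j * 'D_(e_ i) ('D_(e_ j) bnorm2) x = ('D_(e_ i) bgrad x *m h x) 0 i.
    rewrite [RHS]mxE; apply: eq_bigr => j _; rewrite derive_bgrad// mulrC; congr (_ * _).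
    by rewrite -{1}(hsym HD Ux) [LHS]mxE.
  have -> : dbsharp x i i = ('D_(e_ i) bsharp x) 0 i by rewrite [LHS]mxE.
  move: ('D_(e_ i) bgrad x *m h x) (bgrad x *m 'D_(e_ i) h x) ('D_(e_ i) bsharp x) (bgrad x *m h x).
  move: (bsharp x) (bgrad x) ('D_(e_ i) cfactor x) (phi x) (cfactor x) => B G Dc p c X Y Z W.
  by rewrite !mxE; ring.
rewrite (eq_bigr _ (fun i _ => D i)) big_split -mulr_sumr sumrB sumrB -!mulr_sumr big_split /=.
have -> : 'D_(bsharp x) cfactor x = \sum_i bsharp x 0 i * 'D_(e_ i) cfactor x.
  rewrite (derive_basis _ ((Ck_cfactor HD 0).1 _ bx)); exact: erefl.
rewrite -/(hess (h x) x) -/(\tr (dbsharp x)) -/(dot _ _) !addrA.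
exact: erefl.
Qed.

Lemma derive_cfactor_expand x : bsupp x -> 'D_(bsharp x) cfactor x =
  psi x * (hess ((bsharp x)^T *m bsharp x) x + dot ('D_(bsharp x) bsharp x) (bgrad x))
  + dot (bsharp x) (bgrad x) * 'D_(bsharp x) psi x.
Proof.
move=> bx; have Ux := bsupp_sub bx.
have hp := isd_diff (bsharp x) ((Ck_psi 0).1 _ bx).
have hg := isd_diff (bsharp x) ((Ck_bgrad HD 0).1 _ Ux).
have hb := isd_diff (bsharp x) ((Ck_bsharp HD 0).1 _ Ux).
have H := isd_val (isd_mul (isd_dot hb hg) hp); rewrite {}H.
have -> : hess ((bsharp x)^T *m bsharp x) x = dot (bsharp x) ('D_(bsharp x) bgrad x).
  rewrite (derive_basis (bsharp x) ((Ck_bgrad HD 0).1 _ Ux)) dotC dot_suml.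
  apply: eq_bigr => j _; rewrite (dotZl (bsharp x 0 j)) mulr_sumr; apply: eq_bigr => k _.
  rewrite -derive_bgrad// [(_ *m _) j k]mxE big_ord1 [_^T j 0]mxE.
  by rewrite -mulrA; congr (_ * _); rewrite mulrC.
have key (p D1 D2 D3 d : R) : (D1 + D2) * p + D3 * d = p * (D2 + D1) + D3 * d by ring.
exact: key.
Qed.

(* The second derivatives of [bnorm2] along [bsharp] enter the divergence of [sform]
   both through [cfactor] and through [Delta]; [kappa] collects the two contributions. *)
Definition kappa : R := 1 - (n%:R - 1) / 4.
Definition pde_mx x : 'M[R]_n :=
  h x + (- (kappa / bnorm2 x)) *: ((bsharp x)^T *m bsharp x).

(** What remains of the two computations of the divergence of s^# when the second-order part, the
    curl term and the term in K are set apart; [pde_defectE] shows that u enters it only through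
    first-order expressions. *)
Definition pde_defect x : R :=
  phi x * hess (pde_mx x) x + (\tr (smx x *m smx x) + (n%:R - 1) * K * bnorm2 x).

Lemma trace_mN_sum x w : U x ->
  \tr (mN x w) = \sum_i \tr (mN x (e_ i)) * w 0 i.
Proof.
move=> Ux; transitivity (\sum_j \sum_i w 0 i * mN x (e_ i) j j).
  apply: eq_bigr => j _; rewrite mxE (christoffelC HD)// -(mul_mN HD)// mxE.
  apply: eq_bigr => i _; congr (_ * _); rewrite [LHS]mxE [RHS]mxE; exact: (f_equal (fun v : V => v 0 j) (christoffelC HD _ _ Ux)).
by rewrite exchange_big; apply: eq_bigr => i _; rewrite -mulr_sumr mulrC.
Qed.

(** Second derivatives along b^# arise from -2 c in the divergence and from c/2 in [Delta]. As psi =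
    phi / (2 u), they join the term phi h^{jk} u_jk with the coefficient - kappa / u. *)
Lemma pde_defectE x : bsupp x -> pde_defect x =
  - (2 * phi x ^+ 2) * dot (bgrad x *m h x) (bgrad x)
  - phi x * \sum_i (bgrad x *m 'D_(e_ i) h x) 0 i
  + 2 * \tr (dbsharp x) * cfactor x
  + (2 - (n%:R - 1) / 2) * (psi x * dot ('D_(bsharp x) bsharp x) (bgrad x)
      + 'D_(bsharp x) psi x * dot (bsharp x) (bgrad x))
  - \sum_i \tr (mN x (e_ i)) * (sform x *m h x) 0 i
  - (n%:R - 1) * bnorm2 x * cfactor x * cfactor x
  + (n%:R - 1) * dot (sform x) (sform x *m h x).
Proof.
move=> bx; have Ux := bsupp_sub bx.
have u0 : bnorm2 x != 0 by rewrite gt_eqF// (bnorm2_gt0 HD)//; case: bx.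
have u1 : 1 - bnorm2 x != 0.
  by have := two_one_sub_neq0 bx; rewrite mulf_eq0 negb_or => /andP[].
have := divergence_sform HD Ux; rewrite (divergence_sform_expand bx) (Delta_bsharp HD n2 HE bx).
rewrite (trace_mN_sum _ Ux) (derive_cfactor_expand bx) /pde_defect /pde_mx hessD /sform_norm2.
have key (N u c p q gg HH HB G t B1 B2 B3 mm ss cc : R) : u != 0 -> 1 - u != 0 ->
  p = (2 * (1 - u))^-1 -> q = (4 * (u * (1 - u)))^-1 ->
  2 * p ^+ 2 * gg + p * (HH + G) - 2 * (q * (HB + B1) + B2 * B3) - 2 * c * t =
  - (N * ((K + c ^+ 2) * u + (q * (HB + B1) + B2 * B3) / 2 - ss)) - mm - cc ->
  p * (HH + - ((1 - N / 4) / u) * HB) + (cc + N * K * u) =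
  - (2 * p ^+ 2) * gg - p * G + 2 * t * c + (2 - N / 2) * (q * B1 + B3 * B2) - mm
  - N * u * c * c + N * ss.
  move=> u0' u1' -> -> H.
  have -> : cc = - (N * ((K + c ^+ 2) * u + ((4 * (u * (1 - u)))^-1 * (HB + B1) + B2 * B3) / 2 - ss)) - mm
    - (2 * (2 * (1 - u))^-1 ^+ 2 * gg + (2 * (1 - u))^-1 * (HH + G)
       - 2 * ((4 * (u * (1 - u)))^-1 * (HB + B1) + B2 * B3) - 2 * c * t) by rewrite H; ring.
  by field; rewrite u0' u1'.
exact: key.
Qed.

Let near_bsupp x0 : bsupp x0 -> \forall x \near x0, bsupp x.
Proof. by move=> bx; exact: open_nbhs_nbhs (conj obs bx). Qed.

Let cont k (Z : normedModType R) (f : V -> Z) x0 : bsupp x0 -> Ck k bsupp f -> {for x0, continuous f}.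
Proof. by move=> bx C; exact: Ck_continuous C bx. Qed.

(** Every summand of [pde_defectE] has a factor that is a component of du or of [sform], a
    contraction with du, or [cfactor], and all of these are linear in du. *)
Lemma dominated_pde_defect x0 : bsupp x0 -> dominated bgrad x0 pde_defect.
Proof.
move=> bx; apply: (@dominated_ext _ _ _ _ _ _ (filterS (fun x bx' => esym (pde_defectE bx')) (near_bsupp bx))).
have Cu : Ck 0 bsupp bnorm2 := CU (Ck_bnorm2 HD 0).
have Cp := Ck_phi 0; have Cq := Ck_psi 0; have Cc := Ck_cfactor HD 0.
have Ch : Ck 0 bsupp h := CU (Ck_metric_inverse HD 0).
have Cg : Ck 0 bsupp bgrad := CU (Ck_bgrad HD 0).
have Cbs : Ck 0 bsupp bsharp := CU (Ck_bsharp HD 0).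
have CDbs i : Ck 0 bsupp ('D_(e_ i) bsharp) := CU (CkS_derive _ (Ck_bsharp HD 1)).
have CDh i : Ck 0 bsupp ('D_(e_ i) h) := CU (CkS_derive _ (Ck_metric_inverse HD 1)).
have Csg : Ck 0 bsupp (fun x => sform x *m h x) := CU (Ck_mulmx oU (Ck_sform HD 0) (Ck_metric_inverse HD 0)).
have Ccst (r : R) : Ck 0 bsupp (fun _ : V => r) by exact: Ck_cst.
have Dg i : dominated bgrad x0 (fun x => bgrad x 0 i) := dominated_coord bgrad x0 i.
have dotg (f : V -> V) : Ck 0 bsupp f -> dominated bgrad x0 (fun x => dot (f x) (bgrad x)).
  move=> Cf; have := dominated_dotl Dg (fun i => cont bx (Ck_mx obs Cf 0 i)).
  apply: dominated_ext; apply: filterS (near_bsupp bx) => x _; exact: dotC.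
have mulg (f T : V -> R) : Ck 0 bsupp f -> dominated bgrad x0 T -> dominated bgrad x0 (fun x => f x * T x).
  by move=> Cf; exact: (dominated_mul (cont bx Cf)).
have Dc : dominated bgrad x0 cfactor.
  have := mulg psi _ Cq (dotg _ Cbs); apply: dominated_ext.
  by apply: filterS (near_bsupp bx) => x _; exact: mulrC.
have Ds i : dominated bgrad x0 (fun x => sform x 0 i).
  have Cb2 : Ck 0 bsupp (fun x => -2 * b x 0 i) := Ck_scale _ obs (Ck_mx obs (CU (Cb 0)) 0 i).
  have := dominated_add (mulg phi _ Cp (Dg i)) (mulg _ _ Cb2 Dc).
  apply: dominated_ext; apply: filterS (near_bsupp bx) => x bx'; rewrite (sformE bx').
  have lin (p c : R) (G B : V) : (p *: G - (2 * c) *: B) 0 i = p * G 0 i + -2 * B 0 i * c.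
    by rewrite !mxE; ring.
  by rewrite lin.
have Dsg i : dominated bgrad x0 (fun x => (sform x *m h x) 0 i).
  have := @dominated_dotl _ _ bgrad x0 sform (fun x => row i (h x)) Ds.
  have hr j : {for x0, continuous (fun x => row i (h x) 0 j)}.
    have -> : (fun x => row i (h x) 0 j) = (fun x => h x i j) by apply/funext => x; rewrite mxE.
    exact: cont bx (Ck_mx obs Ch i j).
  move=> /(_ hr); apply: dominated_ext; apply: filterS (near_bsupp bx) => x [Ux _].
  rewrite [RHS]mxE; apply: eq_bigr => j _; rewrite [row _ _ _ _]mxE; congr (_ * _).
  by rewrite -{1}(hsym HD Ux) mxE.
have CDdir : Ck 0 bsupp (fun x => 'D_(bsharp x) bsharp x).
  apply: (Ck_entries obs) => i j.
  have C : Ck 0 bsupp (fun x => \sum_k bsharp x 0 k * ('D_(e_ k) bsharp x) i j).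
    by apply: (Ck_sum obs) => k _; apply: (Ck_mul obs); apply: (Ck_mx obs).
  apply: (Ck_ext obs _ C) => x [Ux _].
  rewrite (derive_basis _ ((Ck_bsharp HD 0).1 _ Ux)) summxE; apply: eq_bigr => k _.
  by rewrite [RHS]mxE.
have CDpsi : Ck 0 bsupp (fun x => 'D_(bsharp x) psi x).
  have C : Ck 0 bsupp (fun x => \sum_k bsharp x 0 k * 'D_(e_ k) psi x).
    apply: (Ck_sum obs) => k _; apply: (Ck_mul obs); first exact: (Ck_mx obs).
    exact: CkS_derive (Ck_psi 1).
  apply: (Ck_ext obs _ C) => x bx'.
  by rewrite (derive_basis _ ((Ck_psi 0).1 _ bx')).
have Ctr (M : V -> 'M[R]_n) : Ck 0 bsupp M -> Ck 0 bsupp (fun x => \tr (M x)).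
  by move=> CM; apply: (Ck_sum obs) => i _; apply: (Ck_mx obs).
have Cdb : Ck 0 bsupp (fun x => 2 * \tr (dbsharp x)).
  apply: (Ck_scale _ obs); apply: (Ctr _); apply: (Ck_entries obs) => i j.
  apply: (Ck_ext obs _ (Ck_mx obs (CDbs i) 0 j)) => x _; by rewrite [RHS]mxE.
have CmN i : Ck 0 bsupp (fun x => \tr (mN x (e_ i))).
  apply: (Ctr _); apply: (Ck_entries obs) => j k.
  apply: (Ck_ext obs _ (Ck_mx obs (CU (Ck_christoffel HD 0 (e_ i) (e_ j))) 0 k)) => x _.
  by rewrite [RHS]mxE.
apply: dominated_add; [apply: dominated_add; [apply: dominated_add; [apply: dominated_add;
  [apply: dominated_add; [apply: dominated_add|]|]|]|]|].
- apply: (mulg (fun x => - (2 * phi x ^+ 2))).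
    apply: (Ck_opp obs); apply: (Ck_scale _ obs).
    by apply: (Ck_ext obs _ (Ck_mul obs Cp Cp)) => x _; rewrite expr2.
  exact: (dotg _ (Ck_mulmx obs Cg Ch)).
- apply: dominated_opp; apply: (mulg _ _ Cp); apply: dominated_sum => i.
  have C j : {for x0, continuous (fun x => row i ('D_(e_ i) h x)^T 0 j)}.
    have -> : (fun x => row i ('D_(e_ i) h x)^T 0 j) = (fun x => 'D_(e_ i) h x j i).
      by apply/funext => x; rewrite mxE mxE.
    exact: cont bx (Ck_mx obs (CDh i) j i).
  apply: dominated_ext (dominated_dotl Dg C); apply: filterS (near_bsupp bx) => x _.
  by rewrite [RHS]mxE; apply: eq_bigr => j _; rewrite [row _ _ _ _]mxE [_^T _ _]mxE.
- exact: (mulg (fun x => 2 * \tr (dbsharp x)) _ Cdb Dc).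
- apply: (mulg (fun=> _) _ (Ccst _)); apply: dominated_add.
    exact: (mulg _ _ Cq (dotg _ CDdir)).
  exact: (mulg _ _ CDpsi (dotg _ Cbs)).
- apply: dominated_opp; apply: dominated_sum => i; exact: (mulg _ _ (CmN i) (Dsg i)).
- apply: dominated_opp; apply: (mulg (fun x => (n%:R - 1) * bnorm2 x * cfactor x) _ _ Dc).
  exact: (Ck_mul obs (Ck_scale _ obs Cu) Cc).
- apply: (mulg (fun=> _) _ (Ccst _)); apply: (dominated_dotl Ds) => i.
  exact: (cont bx (Ck_mx obs Csg 0 i)).
Qed.

Lemma pde_mx_sym x : U x -> (pde_mx x)^T = pde_mx x.
Proof.
by move=> Ux; rewrite /pde_mx linearD/= linearZ/= trmx_mul trmxK (hsym HD Ux).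
Qed.

(** By Cauchy-Schwarz the square of the pairing of b^# with w, divided by u, lies between 0 and
    |w|^2. Hence the form is at least 1 - kappa = (n-1)/4 times |w|^2 when kappa is positive, and at
    least |w|^2 otherwise. *)
Lemma pde_mx_elliptic x w : bsupp x ->
  Num.min 1 ((n%:R - 1) / 4) * dot (w *m h x) w <= dot (w *m pde_mx x) w.
Proof.
move=> [Ux b0]; have u0 := bnorm2_gt0 HD Ux b0.
have hs := dot_cauchy (b x) w (hsym HD Ux) (posdef_invmx (asym Ux) (apos Ux)).
rewrite -/(bsharp x) -/(bnorm2 x) in hs.
have -> : dot (w *m pde_mx x) w = dot (w *m h x) w - kappa / bnorm2 x * dot (bsharp x) w ^+ 2.
  rewrite /pde_mx mulmxDr dotDl -scalemxAr (dotZl (- (kappa / bnorm2 x))) mulmxA row_mul_tr.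
  by rewrite mul_scalar_mx (dotZl (dot w _)) (dotC w (bsharp x)) -expr2 mulNr.
have q0 : 0 <= dot (w *m h x) w.
  have [->|w0] := eqVneq w 0; first by rewrite dot0r.
  exact: ltW (posdef_invmx (asym Ux) (apos Ux) w0).
set q := dot (w *m h x) w in hs q0 *; set d := dot (bsharp x) w in hs *.
have hd : 0 <= d ^+ 2 / bnorm2 x <= q.
  apply/andP; split; first by rewrite divr_ge0 ?sqr_ge0 ?ltW.
  by rewrite ler_pdivrMr// mulrC.
rewrite mulrAC -mulrA; move: (d ^+ 2 / bnorm2 x) hd => e /andP[e0 eq].
rewrite /kappa; set N := (n%:R - 1) / 4.
have [N1|N1] := lerP 1 N.
  rewrite mul1r lerBrDr -subr_ge0 opprD addNKr oppr_ge0.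
  by rewrite mulr_le0_ge0// subr_le0.
have -> : q - (1 - N) * e = N * q + (1 - N) * (q - e) by ring.
by rewrite lerDl mulr_ge0// subr_ge0// ltW.
Qed.

Hypothesis K_le0 : K <= 0.

Lemma N_gt0 : 0 < n%:R - 1 :> R.
Proof. by rewrite subr_gt0 ltr1n. Qed.

Lemma NKu_ge0 (u : R) : 0 <= u -> 0 <= (n%:R - 1) * (- K) * u.
Proof.
by move=> u0; apply: mulr_ge0 => //; apply: mulr_ge0; rewrite ?oppr_ge0// ltW// N_gt0.
Qed.

(* The drift - 2 B sg(u_i) bounds the first-order terms from below without having to
   be written out, since it need not be continuous in the strong maximum principle. *)
Lemma bnorm2_strong_maximum x0 : bsupp x0 ->
  (\forall x \near x0, bnorm2 x <= bnorm2 x0) -> \forall x \near x0, bnorm2 x = bnorm2 x0.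
Proof.
move=> bx umax; have Ux0 := bsupp_sub bx.
have [B [B0 hB]] := dominated_pde_defect bx.
have [th th0 hth] := posdef_near oU Ux0 asym apos (Ca 0).
have Ctr : Ck 0 bsupp (fun x => \tr (pde_mx x)).
  apply: (Ck_sum obs) => i _; apply: (Ck_mx obs); apply: (Ck_addmx obs (CU (Ck_metric_inverse HD 0))).
  have Cbs : Ck 0 bsupp bsharp := CU (Ck_bsharp HD 0).
  apply: (Ck_scalemx obs _ (Ck_mulmx obs (Ck_trmx obs Cbs) Cbs)).
  apply: (Ck_opp obs); apply: (Ck_scale _ obs); apply: (Ck_inv obs _ (CU (Ck_bnorm2 HD 0))).
  by move=> y [Uy by0]; rewrite gt_eqF// (bnorm2_gt0 HD).
have := continuous_near_bounded (cont bx Ctr); set B1 := `| _ | + 1 => hB1.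
have B10 : 0 <= B1 by rewrite addr_ge0.
pose P x := bsupp x /\ bnorm2 x <= bnorm2 x0 /\ (forall w, th * dot w w <= dot (w *m h x) w) /\
  `|\tr (pde_mx x)| <= B1 /\ `|pde_defect x| <= B * \sum_i `|bgrad x 0 i|.
have nP : \forall x \near x0, P x.
  near=> x; rewrite /P; split; first by near: x; exact: near_bsupp.
  split; first by near: x.
  split; first by near: x.
  by split; near: x.
(* The estimates hold near [x0]; the interior of the set where they all hold is the open set
   required by [strong_maximum]. *)
pose W : set V := interior (P : set V).
have oW : open W := open_interior _.
have Wx0 : W x0 := nP.
have WP : W `<=` P := @interior_subset _ _.
have WU x : W x -> U x by move=> /WP [/bsupp_sub].
pose m := Num.min 1 ((n%:R - 1) / 4) : R.
have m0 : 0 < m by rewrite /m lt_min ltr01/= divr_gt0// N_gt0.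
pose Vf x : V := \row_i (- (2 * B) * Num.sg (bgrad x 0 i)).
apply: (@strong_maximum _ _ W bnorm2 pde_mx Vf x0 (m * th) (B1 + 2 * B)) => //.
- exact: (Ck_sub WU (Ck_bnorm2 HD 2)).
- by move=> x /WP [_ []].
- by rewrite mulr_gt0.
- move=> x Wx; have [bX [_ [hx _]]] := WP x Wx; split; first exact: pde_mx_sym (WU x Wx).
  move=> w; apply: le_trans (pde_mx_elliptic w bX).
  by rewrite -mulrA ler_wpM2l// ltW.
- move=> x /WP [_ [_ [_ [h1 _]]]]; apply: le_trans (ler_norm _) _.
  by apply: (le_trans h1); rewrite lerDl mulr_ge0.
- move=> x _ i; rewrite mxE normrM normrN.
  have B2 : 0 <= 2 * B by rewrite mulr_ge0.
  have s1 : `|Num.sg (bgrad x 0 i)| <= 1 by rewrite normr_sg lern1 leq_b1.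
  rewrite (ger0_norm B2); apply: (le_trans (ler_wpM2l B2 s1)).
  by rewrite mulr1 lerDr.
move=> x Wx; have [bX [_ [_ [_ hD]]]] := WP x Wx; have Ux := WU x Wx.
have -> : \sum_i Vf x 0 i * 'D_(e_ i) bnorm2 x = - (2 * (B * \sum_i `|bgrad x 0 i|)).
  rewrite !mulr_sumr -sumrN; apply: eq_bigr => i _; rewrite mxE.
  have -> : 'D_(e_ i) bnorm2 x = bgrad x 0 i by rewrite [RHS]mxE.
  by rewrite -mulrA -normrEsg mulNr mulrA.
rewrite -/(hess (pde_mx x) x).
have u0 : 0 < bnorm2 x by case: bX => ? ?; exact: (bnorm2_gt0 HD).
have u1 : bnorm2 x < 1 by case: bX => ? ?; exact: (bnorm2_lt1 HD).
(* The definition of [pde_defect] solved for the Hessian term; K <= 0 makes the added bracket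
   non-negative. *)
have E : hess (pde_mx x) x = 2 * (1 - bnorm2 x) * (pde_defect x +
    (- \tr (smx x *m smx x) + (n%:R - 1) * (- K) * bnorm2 x)).
  rewrite /pde_defect /phi; move: (hess _ _) (\tr _) (bnorm2 x) u1 => H T u u1.
  by field; rewrite subr_eq0 eq_sym lt_eqF.
have s0 : 0 <= - \tr (smx x *m smx x) + (n%:R - 1) * (- K) * bnorm2 x.
  exact: (addr_ge0 (curl_norm2_ge0 HD Ux) (NKu_ge0 (ltW u0))).
have G0 : 0 <= B * \sum_i `|bgrad x 0 i| by rewrite mulr_ge0// sumr_ge0.
(* The factor 2 (1 - u) lies between 0 and 2, which is where the constant 2 B of the drift comes
   from. *)
have key (s d u G : R) : `|d| <= G -> 0 <= s -> 0 < u -> u < 1 -> 0 <= G ->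
    - (2 * G) <= 2 * (1 - u) * (d + s).
  rewrite ler_norml => /andP[dG _] s1 v0 v1 G1.
  have h1 : - G <= d + s by lra.
  have [g0|g0] := lerP 0 (d + s).
    apply: (@le_trans _ _ 0); first by rewrite oppr_le0 mulr_ge0.
    by rewrite mulr_ge0// mulr_ge0// subr_ge0 ltW.
  have : d + s <= (1 - u) * (d + s).
    have -> : (1 - u) * (d + s) = d + s + u * - (d + s) by ring.
    by rewrite lerDl mulr_ge0 ?oppr_ge0 ?ltW.
  by rewrite -mulrA; move: ((1 - u) * (d + s)) => e; lra.
rewrite E; exact: key.
Unshelve. all: by end_near.
Qed.

(** With du = 0 near [x0] all first-order terms vanish, and what is left says that tr(s s) + (n-1) K
    u = 0. Both summands are non-positive, hence both are zero. *)
Lemma rigid_of_constant x0 : bsupp x0 -> (\forall x \near x0, bnorm2 x = bnorm2 x0) ->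
  [/\ curl x0 = 0, sform x0 = 0, forall y, eform (x0, y) = 0 & K = 0].
Proof.
move=> bx hc; have Ux := bsupp_sub bx.
have Dz : \forall x \near x0, bgrad x = 0.
  apply: filterS (near_join hc) => x hx; apply/rowP => i; rewrite [LHS]mxE [RHS]mxE.
  by rewrite (near_eq_derive _ hx) derive_cst.
have g0 : bgrad x0 = 0 := nbhs_singleton Dz.
have c0 : cfactor x0 = 0 by rewrite /cfactor g0 dot0r mul0r.
have s0 : sform x0 = 0 by rewrite (sformE bx) g0 c0 scaler0 mulr0 scale0r subr0.
have e0 y : eform (x0, y) = 0 by rewrite ((cfactorP HD n2 HE bx).1 y) c0 mulr0 mul0r.
have H0 : hess (pde_mx x0) x0 = 0.
  apply: big1 => j _; apply: big1 => k _.
  have -> : 'D_(e_ j) ('D_(e_ k) bnorm2) x0 = 0; last by rewrite mulr0.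
  transitivity ('D_(e_ j) (fun _ : V => 0 : R) x0); last by rewrite derive_cst.
  apply: near_eq_derive; apply: filterS Dz => x /(congr1 (fun v : V => v 0 k)).
  by rewrite mxE [RHS]mxE.
have d0 : pde_defect x0 = 0.
  have [B [B0 hB]] := dominated_pde_defect bx.
  have := nbhs_singleton hB; rewrite big1 ?mulr0 ?normr_le0; first by move=> /eqP.
  by move=> i _; rewrite g0 mxE normr0.
have u0 : 0 < bnorm2 x0 by case: bx => ? ?; exact: (bnorm2_gt0 HD).
move: d0; rewrite /pde_defect H0 mulr0 add0r => T.
have t0 := curl_norm2_ge0 HD Ux.
have k0 : 0 <= (n%:R - 1) * (- K) * bnorm2 x0.
  exact: NKu_ge0 (ltW u0).
have [T0 K0] : \tr (smx x0 *m smx x0) = 0 /\ (n%:R - 1) * K * bnorm2 x0 = 0.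
  by move: T t0 k0; rewrite mulrN mulNr; move: (\tr _) (_ * _) => A B; split; lra.
split => //; first exact: (curl_norm2_eq0 HD).
by move/eqP: K0; rewrite !mulf_eq0 (gt_eqF N_gt0) (gt_eqF u0) orbF => /eqP.
Qed.

Lemma Gspray_parallel z : curl z.1 = 0 -> sform z.1 = 0 -> eform z = 0 -> Gspray a b L z = Gbar z.
Proof.
move=> c0 s0 e0; rewrite /Gspray /Pf s0 e0 dot0l mul0r subr0 scale0r addr0.
by rewrite /S c0 mulmx0 mul0mx scaler0 addr0.
Qed.

Variable m : R.
Hypothesis bnorm2_cst : forall x, U x -> bnorm2 x = m.

Lemma bform_eq0 x : U x -> bnorm2 x = 0 -> b x = 0.
Proof.
move=> Ux u0; apply/eqP; apply: contraT => b0.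
by have := bnorm2_gt0 HD Ux b0; rewrite u0 ltxx.
Qed.

Lemma spray_rigid z i : slit z -> spray L i z = Gbar z 0 i.
Proof.
move=> sz; have [Ux z0] := sz; rewrite (sprayE HD i sz).
(* If the constant is 0 then b vanishes on the whole chart; otherwise b vanishes nowhere and
   [rigid_of_constant] applies at every point. *)
have [m0|m0] := eqVneq m 0.
  have b0 : \forall x \near z.1, b x = 0.
    apply: filterS (open_nbhs_nbhs (conj oU Ux)) => x Ux'.
    by apply: bform_eq0 => //; rewrite bnorm2_cst.
  have Db v : 'D_v b z.1 = 0 by rewrite (near_eq_derive _ b0) derive_cst.
  have c0 : curl z.1 = 0.
    by apply/matrixP => k l; rewrite !mxE !Db !mxE subrr mulr0.
  have s0 : sform z.1 = 0 by rewrite /sform c0 mulmx0 oppr0.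
  have e0 : eform z = 0.
    by rewrite /eform /rform Db s0 (nbhs_singleton b0) !dot0l !dot0r !mulr0 subrr addr0.
  by rewrite (Gspray_parallel c0 s0 e0).
have bz : bsupp z.1.
  split => //; apply: contraNneq m0 => b0; rewrite -(bnorm2_cst Ux) /bnorm2 b0 dot0r //.
have hc : \forall x \near z.1, bnorm2 x = bnorm2 z.1.
  apply: filterS (open_nbhs_nbhs (conj oU Ux)) => x Ux'.
  by rewrite !bnorm2_cst.
have [c0 s0 e0 _] := rigid_of_constant bz hc.
have ez : eform z = 0 by have := e0 z.2; case: (z).
by rewrite (Gspray_parallel c0 s0 ez).
Qed.

Lemma berwald_coef_rigid z i j k : slit z ->
  berwald_coef L i j k z = christoffel z.1 (e_ k) (e_ j) 0 i.
Proof.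
move=> sz; have [Ux z0] := sz.
have D1 z' : slit z' -> 'D_(dy R j) (spray L i) z' = christoffel z'.1 z'.2 (e_ j) 0 i.
  move=> sz'; rewrite -(isd_val ((isd_mx _ _ _ _).2 (isd_Gbar_y HD (e_ j) sz'.1) 0 i)).
  apply: near_eq_derive; apply: filterS (open_nbhs_nbhs (conj (open_slit HD) sz')) => w sw.
  exact: spray_rigid.
rewrite -(isd_val ((isd_mx _ _ _ _).2 (isd_christoffel_y HD (e_ j) (e_ k) Ux) 0 i)).
apply: near_eq_derive; apply: filterS (open_nbhs_nbhs (conj (open_slit HD) sz)) => w sw.
exact: D1.
Qed.

Lemma fundamental_tensor_rigid z : K < 0 -> slit z -> fundamental_tensor L z = a z.1.
Proof.
move=> K0 sz; have [Ux z0] := sz.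
have b0 : b z.1 = 0.
  apply/eqP; apply: contraT => b0; have bz : bsupp z.1 by [].
  have hc : \forall x \near z.1, bnorm2 x = bnorm2 z.1.
    apply: filterS (open_nbhs_nbhs (conj oU Ux)) => x Ux'.
    by rewrite !bnorm2_cst.
  by have [_ _ _ K1] := rigid_of_constant bz hc; rewrite K1 ltxx in K0.
rewrite (fundamental_tensorE HD sz) /ell b0 addr0.
have aL : alpha b L z = L z by rewrite /alpha b0 dot0l subr0.
have key (l : R) (y : V) (M : 'M[R]_n) : l != 0 ->
    (l^-1 *: y)^T *m (l^-1 *: y) + (l / l) *: (M - l ^- 2 *: (y^T *m y)) = M.
  by move=> l0; apply/matrixP => p q; rewrite !mxE !big_ord1 !mxE; field.
by rewrite !aL; apply: key; exact: (L_neq0 HD sz).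
Qed.

End Rigidity.

(** * Chart changes and constancy of the norm *)

Section ChartChange.
Variables (R : realType) (n : nat) (M : topologicalType) (A : smooth_atlas R n M).
Notation V := 'rV[R]_n.
Implicit Types (c d : atlas_index A) (p q : M).

Lemma tangent_vector_ext (v w : tangent_vector A) :
  base_point v = base_point w -> component v = component w -> v = w.
Proof.
case: v w => [p f h1 h2] [q g h3 h4] /= pq fg; move: h3 h4; rewrite -pq -fg => h3 h4.
by congr TangentVector; exact: Prop_irrelevance.
Qed.

Lemma coord_vector_change c d p (y : V) : chart_dom (A c) p -> chart_dom (A d) p ->
  coord_vector c (chart_map (A c) p) y =
  coord_vector d (chart_map (A d) p) ('D_y (transition (A c) (A d)) (chart_map (A c) p)).
Proof.
move=> pc pd; apply: tangent_vector_ext; first by rewrite /= !chart_mapK.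
apply/funext => e; rewrite /= !chart_mapK//.
have Ed : coord_component c p y d = 'D_y (transition (A c) (A d)) (chart_map (A c) p).
  by rewrite /coord_component; case: asboolP => // -[].
have [pe|npe] := pselect (chart_dom (A e) p); last by rewrite !coord_component_out.
rewrite (coord_component_change c y pd pe) Ed [RHS]/coord_component.
by case: asboolP => // -[].
Qed.

Lemma in_chart_change (F : tangent_vector A -> R) c d p (y : V) :
  chart_dom (A c) p -> chart_dom (A d) p ->
  in_chart F c (chart_map (A c) p, y) =
  in_chart F d (chart_map (A d) p, 'D_y (transition (A c) (A d)) (chart_map (A c) p)).
Proof. by move=> pc pd; rewrite /in_chart (coord_vector_change y pc pd). Qed.

(** The preimage is the vector transported back to [c]; the cocycle relation returns it to [d],
    where the transition from the chart to itself is the identity near the point. *)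
Lemma transition_surj c d p (w : V) : chart_dom (A c) p -> chart_dom (A d) p ->
  exists y, 'D_y (transition (A c) (A d)) (chart_map (A c) p) = w.
Proof.
move=> pc pd; exists (coord_component d p w c).
have := coord_component_change d w pc pd; rewrite [X in X = _]/coord_component.
case: asboolP => [_ <-|[]//].
have idE : \forall x \near chart_map (A d) p, transition (A d) (A d) x = x.
  have nb : nbhs (chart_map (A d) p) (chart_cod (A d)).
    by apply: open_nbhs_nbhs; split; [exact: chart_cod_open|exists p].
  by apply: filterS nb => _ [q qd <-]; rewrite /transition/= chart_mapK.
transitivity ('D_w (@id V) (chart_map (A d) p)); last exact: derive_id.
exact: (near_eq_derive _ idE).
Qed.

End ChartChange.

Section GlobalNorm.
Variables (R : realType) (n : nat) (M : topologicalType) (A : smooth_atlas R n M).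
Notation V := 'rV[R]_n.
Variable F : tangent_vector A -> R.
Implicit Types (c d : atlas_index A) (p q : M).

Lemma randers_charts : randers_metric F ->
  exists (alpha beta : tangent_vector A -> R) (a : atlas_index A -> V -> 'M[R]_n)
    (b : atlas_index A -> V -> V), forall c,
  [/\ randers_data (chart_cod (A c)) (a c) (b c) (in_chart F c),
      forall x y, chart_cod (A c) x -> in_chart beta c (x, y) = dot (b c x) y
    & forall x y, chart_cod (A c) x -> in_chart alpha c (x, y) = Num.sqrt (dot (y *m a c x) y)].
Proof.
move=> [[F0 Fs Fh Fg] [alpha [beta [ra rb FE]]]].
have /choice[a ha] := ra; have /choice[b hb] : forall c, exists b : V -> V,
    smooth_on (chart_cod (A c)) b /\ forall x y, chart_cod (A c) x ->
      in_chart beta c (x, y) = \sum_(i < n) b x 0 i * y 0 i.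
  by move=> c; have [b b1 b2] := rb c; exists b.
exists alpha, beta, a, b => c; have [sa pa Ea] := ha c; have [sb Eb] := hb c.
have Ea' x y : chart_cod (A c) x -> in_chart alpha c (x, y) = Num.sqrt (dot (y *m a c x) y).
  by move=> cx; rewrite Ea// dot_mulmxE.
split => //; split.
- exact: chart_cod_open.
- by move=> k; exact: smooth_on_Ck.
- by move=> k; exact: smooth_on_Ck.
- by move=> k; exact: smooth_on_Ck (Fs c).
- by move=> x /pa[].
- by move=> x /pa[_ pd] v v0; rewrite dot_mulmxE; exact: pd.
- by move=> x y cx; rewrite /in_chart FE -Ea'// /dot -Eb.
- by move=> z; exact: F0.
- by move=> z sz v v0; rewrite dot_mulmxE; exact: (Fg c z sz).
Qed.

Variables (alpha beta : tangent_vector A -> R) (a : atlas_index A -> V -> 'M[R]_n)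
  (b : atlas_index A -> V -> V).
Hypothesis HD : forall c, randers_data (chart_cod (A c)) (a c) (b c) (in_chart F c).
Hypothesis betaE : forall c x y, chart_cod (A c) x -> in_chart beta c (x, y) = dot (b c x) y.
Hypothesis alphaE : forall c x y, chart_cod (A c) x ->
  in_chart alpha c (x, y) = Num.sqrt (dot (y *m a c x) y).
Let norm2 c x := bnorm2 (a c) (b c) x.

Let quad_ge0 c x (y : V) : chart_cod (A c) x -> 0 <= dot (y *m a c x) y.
Proof.
move=> cx; have [->|y0] := eqVneq y 0; first by rewrite dot0r.
exact: ltW (rd_pos (HD c) cx y0).
Qed.

(** u is the maximum of beta^2 / alpha^2 on the tangent space. It is therefore enough to transport
    b^# from one chart to the other and to apply Cauchy-Schwarz there, without the transformation
    laws of b and of the inverse metric. *)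
Let bnorm2_le c d p : chart_dom (A c) p -> chart_dom (A d) p ->
  norm2 c (chart_map (A c) p) <= norm2 d (chart_map (A d) p).
Proof.
move=> pc pd; set x := chart_map (A c) p; set x' := chart_map (A d) p.
have cx : chart_cod (A c) x by exists p.
have dx : chart_cod (A d) x' by exists p.
pose v := bsharp (a c) (b c) x; pose w := 'D_v (transition (A c) (A d)) x.
have Eb : dot (b d x') w = norm2 c x.
  by rewrite -(betaE _ dx) -(in_chart_change beta v pc pd) (betaE _ cx) dotC.
have Ea : dot (w *m a d x') w = norm2 c x.
  have := in_chart_change alpha v pc pd; rewrite (alphaE _ cx) (alphaE _ dx) -/w.
  move=> /(congr1 (fun r => r ^+ 2)); rewrite !sqr_sqrtr ?quad_ge0// => <-.
  by rewrite (bsharp_a (HD c))// dotC.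
have u0 : 0 <= norm2 c x by rewrite -Ea quad_ge0.
have := dot_cauchy (bsharp (a d) (b d) x') w (rd_sym (HD d) dx) (rd_pos (HD d) dx).
rewrite !(bsharp_a (HD d))// Eb Ea [dot (b d x') _]dotC -/(bnorm2 _ _ _) -/(norm2 d x').
move: u0; rewrite le_eqVlt => /predU1P[<- _|u0]; last by rewrite expr2 ler_pM2r.
have := quad_ge0 (bsharp (a d) (b d) x') dx.
by rewrite (bsharp_a (HD d))// dotC.
Qed.

Lemma bnorm2_change c d p : chart_dom (A c) p -> chart_dom (A d) p ->
  norm2 c (chart_map (A c) p) = norm2 d (chart_map (A d) p).
Proof. by move=> pc pd; apply/eqP; rewrite eq_le !bnorm2_le. Qed.

Hypotheses (n2 : (2 <= n)%N) (cM : connected [set: M]) (kM : compact [set: M]).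
Variable K : R.
Hypothesis K_le0 : K <= 0.
Hypothesis HE : forall c z, slit (chart_cod (A c)) z ->
  \sum_i riemann_curvature (in_chart F c) i i z = (n%:R - 1) * K * in_chart F c z ^+ 2.

Lemma bnorm2_global : exists m, forall c x, chart_cod (A c) x -> norm2 c x = m.
Proof.
(* An empty manifold has no maximum point, but then every chart is empty too. *)
have [M0|] := pselect ([set: M] !=set0); last first.
  move=> M0; exists 0 => c x [p pc _]; exfalso; apply: M0; by exists p.
have /choice[ch hch] := atlas_cover A.
pose u p := norm2 (ch p) (chart_map (A (ch p)) p).
have uE c p : chart_dom (A c) p -> u p = norm2 c (chart_map (A c) p).
  by move=> pc; exact: bnorm2_change.
have near_chart c p (P : V -> Prop) : chart_dom (A c) p ->
    (\forall x \near chart_map (A c) p, P x) ->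
    \forall q \near p, chart_dom (A c) q /\ P (chart_map (A c) q).
  move=> pc hP; have h1 : nbhs p (chart_map (A c) @^-1` [set x | P x]).
    exact: (chart_map_cont pc hP).
  have h2 : nbhs p (chart_dom (A c)).
    by apply: open_nbhs_nbhs; split => //; exact: chart_dom_open.
  by apply: filterS2 h1 h2 => q.
have ucont : continuous u.
  move=> p N; rewrite (uE _ _ (hch p)) => hN.
  have cx : chart_cod (A (ch p)) (chart_map (A (ch p)) p) by exists p.
  have := Ck_continuous (Ck_bnorm2 (HD (ch p)) 0) cx hN => hx.
  have := near_chart _ _ _ (hch p) hx; apply: filterS => q [qc].
  by rewrite /= (uE _ _ qc).
have [pm _ pmax] := @compact_EVT_max M R u setT M0 kM (continuous_subspaceT ucont).
exists (u pm) => c x [p pc <-]; rewrite -(uE _ _ pc).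
have -> : [set q | u q = u pm] p => //.
(* The set where u attains its maximum is nonempty, open and closed. *)
rewrite (cM (B := [set q | u q = u pm])) //.
- by exists pm.
- exists [set q | u q = u pm]; last by rewrite setTI.
  rewrite openE => q /= uq; have qc := hch q.
  set x0 := chart_map (A (ch q)) q; have cx : chart_cod (A (ch q)) x0 by exists q.
  have umax : \forall x \near x0, norm2 (ch q) x <= norm2 (ch q) x0.
    have : nbhs x0 (chart_cod (A (ch q))) by apply: open_nbhs_nbhs; split => //; exact: chart_cod_open.
    apply: filterS => _ [r rc <-]; rewrite -(uE _ _ rc) -(uE _ _ qc) uq.
    by apply: pmax; rewrite inE.
  have ucst : \forall x \near x0, norm2 (ch q) x = norm2 (ch q) x0.
    have [b0|b0] := eqVneq (b (ch q) x0) 0; last first.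
      exact: (bnorm2_strong_maximum (HD (ch q)) n2 (HE (c := ch q)) K_le0 (conj cx b0) umax).
    have n0 : norm2 (ch q) x0 = 0 by rewrite /norm2 /bnorm2 b0 dot0r.
    have : nbhs x0 (chart_cod (A (ch q))) by apply: open_nbhs_nbhs; split => //; exact: chart_cod_open.
    apply: filterS2 umax => x1; rewrite n0 => h1 cx'; apply/eqP; rewrite eq_le h1/=.
    have := quad_ge0 (bsharp (a (ch q)) (b (ch q)) x1) cx'.
    by rewrite (bsharp_a (HD (ch q)))// dotC.
  have := near_chart _ _ _ qc ucst; rewrite /interior; apply: filterS => r [rc].
  by rewrite /= (uE _ _ rc) => ->; rewrite -(uE _ _ qc).
- exists [set q | u q = u pm]; last by rewrite setTI.
  have -> : [set q | u q = u pm] = u @^-1` [set u pm] by [].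
  by apply: closed_comp => //; exact: closed_eq.
Qed.

End GlobalNorm.

(** * The Picard-Lindelof theorem *)

Section Picard.
Variable R : realType.
Implicit Types (h F : R -> R) (a b c d r t : R).

Definition clamp c r t : R := Num.max (c - r) (Num.min (c + r) t).

Lemma clampP c r t : 0 <= r ->
  [\/ t <= c - r /\ clamp c r t = c - r, c - r <= t <= c + r /\ clamp c r t = t
    | c + r <= t /\ clamp c r t = c + r].
Proof.
move=> r0; rewrite /clamp; case: (leP (c + r) t) => h1.
  apply: Or33; split => //; case: (leP (c - r) (c + r)) => h2; lra.
case: (leP (c - r) t) => h2; last by apply: Or31; split => //; exact: ltW.
by apply: Or32; split => //; rewrite ltW.
Qed.

Lemma clamp_bound c r t : 0 <= r -> `|clamp c r t - c| <= r.
Proof.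
move=> r0; rewrite ler_norml.
by case: (clampP c t r0) => -[h ->]; [|case/andP: h => h h'|]; apply/andP; split; lra.
Qed.

Lemma clamp_id c r t : `|t - c| <= r -> clamp c r t = t.
Proof.
move=> h0; have r0 : 0 <= r by exact: le_trans h0.
move: h0; rewrite ler_norml => /andP[h1 h2].
by case: (clampP c t r0) => -[h ->]; lra.
Qed.

Lemma clamp_lip c r x y : 0 <= r -> `|clamp c r x - clamp c r y| <= `|x - y|.
Proof.
move=> r0; wlog xy : x y / x <= y.
  move=> W; have [/W//|/ltW/W] := leP x y.
  by rewrite distrC [leRHS]distrC.
rewrite distrC [leRHS]distrC [leRHS]ger0_norm ?subr_ge0// ler_norml.
by case: (clampP c x r0) => -[h ->]; [|case/andP: h => h h'|];
  (case: (clampP c y r0) => -[k ->]; [|case/andP: k => k k'|]); apply/andP; split; lra.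
Qed.

Lemma lipschitz_cont h c : (forall x y, `|h x - h y| <= c * `|x - y|) -> continuous h.
Proof.
move=> H x; apply/cvgrPdist_lt => e e0.
have c1 : 0 < `|c| + 1 by rewrite ltr_wpDl.
near=> y; apply: le_lt_trans (H x y) _.
apply: (@le_lt_trans _ _ ((`|c| + 1) * `|x - y|)).
  by rewrite ler_wpM2r// (le_trans (ler_norm c))// lerDl.
rewrite -ltr_pdivlMl// mulrC; near: y.
by apply: cvgr_dist_lt => //; rewrite divr_gt0.
Unshelve. all: by end_near.
Qed.

(** The integral starts at -2, so that the fundamental theorem of calculus covers a neighbourhood of
    [-1, 1], where all times used below lie. *)
Lemma antiderivative h : continuous h ->
  exists F, forall t, -2 < t -> is_derive t 1 F (h t).
Proof.
move=> ch; pose mu := @lebesgue_measure R.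
exists (fun x => \int[mu]_(t in [set` Interval (BLeft (-2)) (BRight x)]) h t)%R => t t2.
have int : mu.-integrable [set` Interval (BLeft (-2)) (BRight (t + 1))] (EFin \o h).
  apply: continuous_compact_integrable; first exact: segment_compact.
  by apply: continuous_subspaceT => x; exact: ch.
have t1 : t < t + 1 by rewrite ltrDl.
have [d e] := @continuous_FTC1_closed R h (-2) t (t + 1) t1 int t2 (ch t); split; [exact: d|rewrite -derive1E; exact: e].
Qed.

Lemma mvt_bound F h d (M : R) a b :
  (forall t, `|t| <= d -> is_derive t 1 F (h t)) -> (forall t, `|t| <= d -> `|h t| <= M) ->
  `|a| <= d -> `|b| <= d -> `|F a - F b| <= M * `|a - b|.
Proof.
move=> dF hM; wlog ab : a b / a <= b.
  by move=> W ha hb; have [ab|/ltW ba] := leP a b; [exact: W|rewrite distrC [`|a - b|]distrC; exact: W].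
move=> /ler_normlP[a1 a2] /ler_normlP[b1 b2].
have inI t : a <= t <= b -> `|t| <= d.
  by move=> /andP[t1 t2]; rewrite ler_norml; apply/andP; split; lra.
have [||c cab E] := @MVT_segment R F h a b ab.
- by move=> x; rewrite in_itv/= => /andP[/ltW x1 /ltW x2]; apply: dF; apply: inI; rewrite x1.
- apply: derivable_within_continuous => x; rewrite in_itv/= => xab.
  by have [] := dF x (inI x xab).
rewrite distrC E normrM [`|a - b|]distrC ler_wpM2r//; apply: hM; apply: inI.
by move: cab; rewrite in_itv.
Qed.

(* The limit is the supremum of the increasing sequence [x k - 2C / 2^k]. *)
Lemma geometric_cauchy (x : nat -> R) C : 0 <= C ->
  (forall k, `|x k.+1 - x k| <= C / 2 ^+ k) -> exists l, forall k, `|l - x k| <= 2 * C / 2 ^+ k.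
Proof.
move=> C0 hx; pose lo k := x k - 2 * C / 2 ^+ k; pose hi k := x k + 2 * C / 2 ^+ k.
have p2 k : (2 ^+ k : R) != 0 by rewrite expf_neq0.
have step k : 2 * C / 2 ^+ k = 2 * C / 2 ^+ k.+1 + C / 2 ^+ k.
  by rewrite exprS; move: (2 ^+ k) (p2 k) => q q0; field.
have lo_inc k : lo k <= lo k.+1.
  have := hx k; rewrite ler_norml /lo (step k) => /andP[h1 h2].
  by move: (2 * C / 2 ^+ k.+1) (C / 2 ^+ k) h1 => p q; lra.
have hi_dec k : hi k.+1 <= hi k.
  have := hx k; rewrite ler_norml /hi (step k) => /andP[h1 h2].
  by move: (2 * C / 2 ^+ k.+1) (C / 2 ^+ k) h2 => p q; lra.
have lo_mono j k : (j <= k)%N -> lo j <= lo k.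
  by apply: (homo_leq (r := <=%R)) => //; exact: le_trans.
have hi_mono j k : (j <= k)%N -> hi k <= hi j.
  move=> jk; rewrite -lerN2; move: j k jk.
  by apply: (homo_leq (r := <=%R) (f := fun k => - hi k)) => // [y x' z|k]; [exact: le_trans|rewrite lerN2].
have lohi k : lo k <= hi k.
  have : 0 <= 2 * C / 2 ^+ k by rewrite divr_ge0 ?mulr_ge0// exprn_ge0.
  by rewrite /lo /hi; lra.
have cross j k : lo j <= hi k.
  have [jk|/ltnW kj] := leqP j k; first exact: le_trans (lo_mono _ _ jk) (lohi k).
  exact: le_trans (lohi j) (hi_mono _ _ kj).
pose E : set R := [set lo k | k in [set: nat]].
have E0 : E !=set0 by exists (lo 0%N); exists 0%N.
have hsE : has_sup E by split => //; exists (hi 0%N) => _ [k _ <-]; exact: cross.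
exists (sup E) => k.
have h1 : lo k <= sup E by apply: ub_le_sup; [exact: hsE.2|exists k].
have h2 : sup E <= hi k by apply: ge_sup => // _ [j _ <-]; exact: cross.
by move: h1 h2; rewrite ler_norml /lo /hi; move: (2 * C / 2 ^+ k) => p h1 h2; apply/andP; split; lra.
Qed.

(* The hypotheses are coordinatewise and uniform in [i], so that the state space
   [I -> R] needs no norm; clamping makes the vector field and the time global. *)
Section PicardIteration.
Variables (I : Type) (f : (I -> R) -> I -> R) (x0 : I -> R) (r B C : R).
Hypothesis r_gt0 : 0 < r.
Hypothesis B_ge0 : 0 <= B.
Hypothesis C_ge0 : 0 <= C.
Let box (x : I -> R) := forall i, `|x i - x0 i| <= r.
Hypothesis f_bound : forall x, box x -> forall i, `|f x i| <= B.
Hypothesis f_lip : forall x y (e : R), box x -> box y -> (forall i, `|x i - y i| <= e) ->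
  forall i, `|f x i - f y i| <= C * e.

Let proj (x : I -> R) : I -> R := fun i => clamp (x0 i) r (x i).
Let fc x := f (proj x).

Let proj_box x : box (proj x).
Proof. by move=> i; exact: clamp_bound (ltW r_gt0). Qed.

Let fc_bound x i : `|fc x i| <= B.
Proof. exact: f_bound. Qed.

Let fc_lip x y (e : R) : (forall i, `|x i - y i| <= e) -> forall i, `|fc x i - fc y i| <= C * e.
Proof.
move=> h; apply: f_lip => // i; exact: le_trans (clamp_lip _ _ _ (ltW r_gt0)) (h i).
Qed.

(** The three bounds keep time within the range of [antiderivative], keep the iterates in the box
    ([dB]) and make the Picard map contract by 1/2 ([dC]); [B + 1] and [C + 1] avoid division by
    zero. *)
Let d : R := Num.min 1 (Num.min (r / (B + 1)) (2 * (C + 1))^-1).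

Let B1 : 0 < B + 1. Proof. by rewrite ltr_wpDl. Qed.
Let C1 : 0 < C + 1. Proof. by rewrite ltr_wpDl. Qed.

Let d_gt0 : 0 < d.
Proof. by rewrite !lt_min ltr01 divr_gt0//= invr_gt0 mulr_gt0. Qed.

Let d_le1 : d <= 1. Proof. by rewrite ge_min lexx. Qed.

Let dB : B * d <= r.
Proof.
apply: (@le_trans _ _ ((B + 1) * d)); first by rewrite ler_wpM2r ?(ltW d_gt0)// lerDl.
by rewrite -ler_pdivlMl// mulrC /d !ge_min lexx orbT.
Qed.

Let dC : C * d <= 2^-1.
Proof.
apply: (@le_trans _ _ ((C + 1) * d)); first by rewrite ler_wpM2r ?(ltW d_gt0)// lerDl.
rewrite -ler_pdivlMl// -invfM mulrC /d !ge_min.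
by rewrite (_ : (2 * (C + 1))^-1 <= _)// !orbT.
Qed.

Let lip (u : R -> I -> R) := forall s t i, `|u s i - u t i| <= B * `|s - t|.

Let lip_continuous u i : lip u -> continuous (fun t => fc (u t) i).
Proof.
by move=> hu; apply: (@lipschitz_cont _ (C * B)) => s t; rewrite -mulrA; apply: fc_lip => j; exact: hu.
Qed.

(** [v] is the image of [u] under the Picard map, frozen in time outside [-d, d]. Stated as a
    relation with some antiderivative [F], since only the derivative of [F] and its increments are
    used. *)
Let step_spec (u v : R -> I -> R) := forall i, exists2 F : R -> R,
  forall t, -2 < t -> is_derive t 1 F (fc (u t) i) &
  forall t, v t i = x0 i + (F (clamp 0 d t) - F (clamp 0 d 0)).

Let step_ex u : lip u -> exists v, step_spec u v.
Proof.
move=> hu; have /choice[F hF] i := antiderivative (lip_continuous (i := i) hu).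
exists (fun t i => x0 i + (F i (clamp 0 d t) - F i (clamp 0 d 0))) => i.
exists (F i); [exact: hF|move=> t; exact: erefl].
Qed.

Let in_d t : `|clamp 0 d t| <= d.
Proof. by have := clamp_bound 0 t (ltW d_gt0); rewrite subr0. Qed.

Let gt_m2 t : `|t| <= d -> -2 < t.
Proof. by rewrite ler_norml => /andP[h _]; move: d d_le1 h => e; lra. Qed.

Let step_lip u v : step_spec u v -> lip v.
Proof.
move=> h s t i; have [F dF vE] := h i; rewrite !vE opprD addrACA subrr add0r opprD.
rewrite addrACA subrr addr0.
have /le_trans := mvt_bound (fun t ht => dF t (gt_m2 ht)) (fun t _ => fc_bound (u t) i) (in_d s) (in_d t).
by apply; rewrite ler_wpM2l//; exact: clamp_lip (ltW d_gt0).
Qed.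

Let step_contract u u' v v' (e : R) : step_spec u v -> step_spec u' v' -> 0 <= e ->
  (forall t i, `|t| <= d -> `|u t i - u' t i| <= e) ->
  forall t i, `|v t i - v' t i| <= e / 2.
Proof.
move=> h h' e0 he t i; have [F dF vE] := h i; have [F' dF' vE'] := h' i.
rewrite vE vE' opprD addrACA subrr add0r.
pose H (s : R) : R := F s - F' s; have -> : F (clamp 0 d t) - F (clamp 0 d 0) - (F' (clamp 0 d t) - F' (clamp 0 d 0)) =
  H (clamp 0 d t) - H (clamp 0 d 0) by rewrite /H; ring.
have dH (s : R) : `|s| <= d -> is_derive s 1 H (fc (u s) i - fc (u' s) i).
  by move=> hs; apply: isd_sub; [exact: dF (gt_m2 hs)|exact: dF' (gt_m2 hs)].
have bH (s : R) : `|s| <= d -> `|fc (u s) i - fc (u' s) i| <= C * e.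
  by move=> hs; apply: fc_lip => j; exact: he.
apply: (le_trans (mvt_bound dH bH (in_d t) (in_d 0))).
have z0 : clamp 0 d 0 = 0 by apply: clamp_id; rewrite subr0 normr0 ltW.
rewrite z0 subr0; apply: (@le_trans _ _ (C * e * d)).
  by rewrite ler_wpM2l// mulr_ge0.
by rewrite mulrAC mulrC ler_wpM2l.
Qed.

Theorem picard_lindelof : exists u : R -> I -> R, exists2 e, 0 < e & u 0 = x0 /\
  forall t, `|t| < e -> box (u t) /\ forall i, is_derive t 1 (fun s => u s i) (f (u t) i).
Proof.
have lip0 : lip (fun _ => x0) by move=> s t i; rewrite subrr normr0 mulr_ge0.
(* The iteration runs in the subtype of Lipschitz curves, on which a step always exists and in which
   it ends. *)
have /choice[next hnext] : forall u : {u | lip u}, exists v : {u | lip u}, step_spec (sval u) (sval v).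
  by move=> [u hu]; have [v hv] := step_ex hu; exists (exist _ v (step_lip hv)).
pose w := fix w k := if k is k'.+1 then next (w k') else exist lip (fun _ => x0) lip0.
pose U k := sval (w k).
have US k : step_spec (U k) (U k.+1) by exact: hnext.
have Ulip k : lip (U k) by exact: (svalP (w k)).
have zd : clamp 0 d 0 = 0 by apply: clamp_id; rewrite subr0 normr0 ltW.
have box_step u v : step_spec u v -> forall t i, `|v t i - x0 i| <= B * d.
  move=> h t i; have [F dF vE] := h i; rewrite vE addrC addKr.
  have /le_trans := mvt_bound (fun t ht => dF t (gt_m2 ht)) (fun t _ => fc_bound (u t) i) (in_d t) (in_d 0).
  by apply; rewrite zd subr0 ler_wpM2l.
have E0 : 0 <= B * d by rewrite mulr_ge0// ltW.
have Ucauchy k t i : `|U k.+1 t i - U k t i| <= B * d / 2 ^+ k.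
  elim: k t i => [|k ih] t i; first by rewrite divr1; exact: (box_step _ _ (US 0%N)).
  have -> : B * d / 2 ^+ k.+1 = B * d / 2 ^+ k / 2 by rewrite exprSr invfM mulrA.
  apply: (step_contract (US k.+1) (US k)) => [|s j _]; last exact: ih.
  by rewrite divr_ge0// exprn_ge0.
have lim t i := geometric_cauchy E0 (fun k => Ucauchy k t i).
have /choice[l hl] : forall t, exists l : I -> R, forall i k, `|l i - U k t i| <= 2 * (B * d) / 2 ^+ k.
  by move=> t; have /choice[l hl] := lim t; exists l.
have tail e : 0 < e -> exists k, 4 * (B * d) / 2 ^+ k <= e.
  move=> e0; have [k hk] : exists k : nat, 4 * (B * d) / e <= k%:R.
    by exists (Num.truncn (4 * (B * d) / e)).+1; rewrite ltW// truncnS_gt.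
  exists k; rewrite ler_pdivrMr ?exprn_gt0// [leRHS]mulrC -ler_pdivrMr//.
  by apply: (le_trans hk); rewrite -natrX ler_nat ltnW// ltn_expl.
have small (x : R) : (forall k, `|x| <= 4 * (B * d) / 2 ^+ k) -> x = 0.
  move=> hx; apply/eqP; rewrite -normr_le0; apply/ler_addgt0Pr => e e0; rewrite add0r.
  by have [k hk] := tail e e0; exact: le_trans (hx k) hk.
have half k : 4 * (B * d) / 2 ^+ k = 2 * (B * d) / 2 ^+ k + 2 * (B * d) / 2 ^+ k.
  by move: (2 ^- k) (B * d) => p q; ring.
have llip : lip l.
  move=> s t i; apply/ler_addgt0Pr => e /tail[k hk].
  have -> : l s i - l t i = (U k s i - U k t i) + ((l s i - U k s i) - (l t i - U k t i)) by ring.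
  apply: (le_trans (ler_normD _ _)); apply: lerD; first exact: Ulip.
  apply: le_trans hk; rewrite half; apply: (le_trans (ler_normB _ _)).
  by apply: lerD; exact: hl.
(* One more step from the limit [l] stays close to the iterates, hence equals [l]; so [l] satisfies
   the integral equation. *)
have [v hv] := step_ex llip.
have vl t i : v t i = l t i.
  apply/eqP; rewrite -subr_eq0; apply/eqP; apply: small => k.
  have h1 : `|v t i - U k.+1 t i| <= 2 * (B * d) / 2 ^+ k / 2.
    apply: (step_contract hv (US k)) => [|s j _]; last exact: hl.
    by rewrite divr_ge0 ?exprn_ge0// mulr_ge0.
  have h2 := hl t i k.+1; rewrite exprSr invfM (mulrA (2 * (B * d))) in h2.
  have -> : v t i - l t i = (v t i - U k.+1 t i) - (l t i - U k.+1 t i) by ring.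
  have p0 : 0 <= 2 * (B * d) / 2 ^+ k by rewrite divr_ge0 ?exprn_ge0// mulr_ge0.
  rewrite half; apply: (le_trans (ler_normB _ _)); apply: lerD; [apply: (le_trans h1)|apply: (le_trans h2)];
    by rewrite ler_pdivrMr// ler_peMr// ler1n.
exists l, d => //; split.
  apply/funext => i; rewrite -vl; have [F dF ->] := hv i.
  by rewrite zd subrr addr0.
move=> t td; have bl : box (l t).
  by move=> i; rewrite -vl; exact: le_trans (box_step _ _ hv t i) dB.
split => // i; have [F dF vE] := hv i.
have fE : f (l t) = fc (l t).
  by congr f; apply/funext => j; rewrite /proj clamp_id.
rewrite fE; have := isd_add (isd_cst t 1 (x0 i - F 0)) (dF t (gt_m2 (ltW td))).
rewrite add0r; apply: near_eq_is_derive.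
near=> s; rewrite -vl vE zd clamp_id; first by ring.
rewrite subr0 ltW//; near: s.
have td' : 0 < d - `|t| by rewrite subr_gt0.
have : nbhs t (ball t (d - `|t|)) by exact: nbhsx_ballx.
apply: filterS => s; rewrite /ball/= => hs; have -> : s = t - (t - s) by ring.
by apply: (le_lt_trans (ler_normB _ _)); rewrite -ltrBrDl.
Unshelve. all: by end_near.
Qed.

End PicardIteration.

End Picard.

(** * Geodesics in all charts *)

(** The Euler-Lagrange equation of F^2 for position and velocity [z] and acceleration [q], with the
    time derivative expanded by the chain rule. Unlike the spray equation it involves no inverse
    matrix and changes charts easily. *)
Definition euler_lagrange (R : realType) n (L : 'rV[R]_n * 'rV[R]_n -> R)
    (z : 'rV[R]_n * 'rV[R]_n) (q : 'rV[R]_n) : Prop :=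
  forall l, 'D_((z.2, q) : 'rV[R]_n * 'rV[R]_n) ('D_(dy R l) (sqF L)) z = 'D_(dx R l) (sqF L) z.

Section PairDerivatives.
Variables (R : realType) (n : nat).
Notation V := 'rV[R]_n.
Notation e_ i := (delta_mx 0 i : V).

Lemma derive_pair_sum (f : V * V -> R) z (v w : V) : differentiable f z ->
  'D_((v, w) : V * V) f z =
  \sum_k v 0 k * 'D_(dx R k) f z + \sum_k w 0 k * 'D_(dy R k) f z.
Proof.
move=> df; have -> : ((v, w) : V * V) = ((v, 0) : V * V) + ((0, w) : V * V).
  by rewrite [RHS]/GRing.add/=/add_pair/= addr0 add0r.
rewrite (derive_Dl _ _ df) (derive_sum_x v df) (derive_sum_y w df); exact: erefl.
Qed.

Lemma Ck_sqF (W : set (V * V)) (L : V * V -> R) k : open W -> Ck k W L -> Ck k W (sqF L).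
Proof. by move=> oW C; apply: (Ck_ext oW _ (Ck_mul oW C C)) => z _; rewrite /sqF expr2. Qed.

End PairDerivatives.

Lemma open_slit_set (R : realType) n (W : set 'rV[R]_n) : open W -> open (slit W).
Proof.
move=> oW; rewrite (_ : slit W = [set z | W z.1] `&` [set z | z.2 != 0])//.
apply: openI; first exact: open_fst.
apply: (@open_snd _ _ _ [set y : 'rV[R]_n | y != 0]).
rewrite (_ : [set y : 'rV[R]_n | y != 0] = ~` [set y | dot (y - 0) (y - 0) <= 0]).
  by apply: closed_openC; exact: closed_sqdist_le.
by apply/seteqP; split => y /=; rewrite subr0 -dot_gt0 ltNge => /negP.
Qed.

Section SprayEulerLagrange.
Variables (R : realType) (n : nat).
Notation V := 'rV[R]_n.
Notation e_ i := (delta_mx 0 i : V).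
Variables (U : set V) (a : V -> 'M[R]_n) (b : V -> V) (L : V * V -> R).
Hypothesis HD : randers_data U a b L.
Let oS := open_slit HD.

(** The two sides of the Euler-Lagrange equation differ by 2 (q + 2 G) g with g invertible; the
    symmetry of second derivatives matches the order of differentiation with that in [spray]. *)
Lemma euler_lagrange_spray z q : slit U z ->
  euler_lagrange L z q <-> forall i, q 0 i + 2 * spray L i z = 0.
Proof.
move=> sz; have CE k := Ck_sqF (k := k) oS (rd_CL HD k).
set g := fundamental_tensor L z; set G := Gspray a b L z.
have EL l : 'D_((z.2, q) : V * V) ('D_(dy R l) (sqF L)) z - 'D_(dx R l) (sqF L) z =
    (2 *: ((q + 2 *: G) *m g)) 0 l.
  have key (A A' B D : R) (X Y : V) : A = A' -> B = 2 * Y 0 l -> A' - D = (4 *: X) 0 l ->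
      A + B - D = (2 *: (Y + 2 *: X)) 0 l.
    by move=> -> -> H; rewrite addrAC H !mxE; ring.
  have H : \sum_k 'D_(dy R l) ('D_(dx R k) (sqF L)) z * z.2 0 k - 'D_(dx R l) (sqF L) z =
      (4 *: (G *m g)) 0 l.
    by rewrite -(spray_source HD sz) [RHS]mxE.
  have e1 : \sum_k z.2 0 k * 'D_(dx R k) ('D_(dy R l) (sqF L)) z =
      \sum_k 'D_(dy R l) ('D_(dx R k) (sqF L)) z * z.2 0 k.
    apply: eq_bigr => k _; rewrite (derive_schwarz (dx R k) (dy R l) oS sz (CE 2)).
    exact: mulrC.
  have e2 : \sum_k q 0 k * 'D_(dy R k) ('D_(dy R l) (sqF L)) z = 2 * (q *m g) 0 l.
    rewrite [(q *m g) 0 l]mxE mulr_sumr; apply: eq_bigr => k _.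
    by rewrite [g k l]mxE; move: ('D__ _ _) (q 0 k) => A B; field.
  have -> : (q + 2 *: G) *m g = q *m g + 2 *: (G *m g) by rewrite mulmxDl -scalemxAl.
  rewrite (derive_pair_sum z.2 q ((CkS_derive (dy R l) (CE 1)).1 _ sz)).
  exact: (key _ _ _ _ (G *m g) (q *m g) e1 e2 H).
have Gi i : spray L i z = G 0 i by rewrite /G -(sprayE HD i sz).
split=> [h i|h l].
  have gu := posdef_unitmx (rd_gpos HD sz).
  have : 2 *: ((q + 2 *: G) *m g) = 0.
    by apply/rowP => l; rewrite -EL h subrr [RHS]mxE.
  move/eqP; rewrite scaler_eq0 pnatr_eq0/= => /eqP H.
  have : q + 2 *: G = 0 by rewrite -(mulmxK gu (q + _)) H mul0mx.
  by move=> /(congr1 (fun v : V => v 0 i)); rewrite Gi [LHS]mxE [(2 *: G) 0 i]mxE [RHS]mxE.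
apply/eqP; rewrite -subr_eq0 EL; have -> : q + 2 *: G = 0.
  by apply/rowP => i; rewrite [LHS]mxE [(2 *: G) 0 i]mxE [RHS]mxE -Gi h.
by rewrite mul0mx scaler0 mxE.
Qed.

Lemma derive_sqF_euler z : slit U z -> 'D_((0, z.2) : V * V) (sqF L) z = 2 * sqF L z.
Proof.
move=> sz; rewrite (derive_sqF HD _ sz) (derive_Ly HD _ sz) /ell dotDl (dotZl (alpha b L z)^-1).
rewrite -(alpha_sqr HD sz) (L_alpha b L z) /sqF (L_alpha b L z); have := gt_eqF (alpha_gt0 HD sz).
by move: (alpha b L z) (dot _ _) => p q p0; field; rewrite p0.
Qed.

End SprayEulerLagrange.

Section EulerLagrangeChange.
Variables (R : realType) (n : nat).
Notation V := 'rV[R]_n.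
Notation e_ i := (delta_mx 0 i : V).
Variables (W : set V) (T : V -> V) (W2 : set (V * V)) (L1 L2 : V * V -> R).
Hypotheses (oW : open W) (CT : forall k, Ck k W T) (oS : open (slit W)) (oW2 : open W2).
Hypothesis CL2 : forall k, Ck k W2 L2.

Definition tangent_map (z : V * V) : V * V := (T z.1, 'D_(z.2) T z.1).
Local Notation Phi := tangent_map.

Hypothesis PhiW2 : forall z, slit W z -> W2 (Phi z).
Hypothesis L1E : forall z, slit W z -> L1 z = L2 (Phi z).

Let CE2 k : Ck k W2 (sqF L2) := Ck_sqF oW2 (CL2 k).

Let Phi2_diff z : W z.1 -> differentiable (fun z : V * V => 'D_(z.2) T z.1) z.
Proof. by move=> Wz; exact: (Ck_directional oW CT 0).1. Qed.

Lemma differentiable_tangent_map z : W z.1 -> differentiable Phi z.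
Proof.
move=> Wz; apply: differentiable_pair; last exact: Phi2_diff.
exact: (differentiable_comp (differentiable_fst z) ((CT 0).1 _ Wz)).
Qed.

Lemma derive_tangent_map z (v : V * V) : W z.1 ->
  'D_v Phi z = ('D_(v.1) T z.1, 'D_v (fun z : V * V => 'D_(z.2) T z.1) z).
Proof.
move=> Wz; have d1 : differentiable (fun z : V * V => T z.1) z.
  exact: (differentiable_comp (differentiable_fst z) ((CT 0).1 _ Wz)).
have d2 := Phi2_diff Wz.
have e1 := etrans (esym (deriveE v d1)) (isd_val (isd_fst v ((CT 0).1 _ Wz))).
have e2 := esym (deriveE v d2).
rewrite (deriveE v (differentiable_tangent_map Wz)) (diff_pair d1 d2).
exact: (congr2 pair e1 e2).
Qed.

Let chain (f : V * V -> R) z (v : V * V) : W z.1 -> differentiable f (Phi z) ->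
  is_derive z v (fun z => f (Phi z)) ('D_('D_v Phi z) f (Phi z)).
Proof.
by move=> Wz df; exact: (isd_comp (differentiable_tangent_map Wz) df (erefl _)).
Qed.

Let Phi2_x z l i : W z.1 ->
  ('D_(dx R l) (fun z : V * V => 'D_(z.2) T z.1) z) 0 i = ('D_(z.2) ('D_(e_ l) T) z.1) 0 i.
Proof.
move=> Wz; have oZ := @open_fst R V V _ oW; pose Ti y := T y 0 i.
have CTi k : Ck k W Ti := Ck_mx oW (CT k) 0 i.
have D1 (w y : V) : W y -> ('D_w T y) 0 i = 'D_w Ti y.
  by move=> Wy; rewrite -(isd_val ((isd_mx _ _ _ _).2 (isd_diff w ((CT 0).1 _ Wy)) 0 i)).
have rhs : ('D_(z.2) ('D_(e_ l) T) z.1) 0 i = 'D_(z.2) ('D_(e_ l) Ti) z.1.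
  have := isd_val ((isd_mx _ _ _ _).2 (isd_diff z.2 ((CkS_derive (e_ l) (CT 1)).1 _ Wz)) 0 i).
  move=> <-; apply: near_eq_derive; apply: filterS (open_nbhs_nbhs (conj oW Wz)) => y Wy.
  exact: D1.
have lhs : ('D_(dx R l) (fun z : V * V => 'D_(z.2) T z.1) z) 0 i =
    'D_(dx R l) (fun y : V * V => \sum_k y.2 0 k * 'D_(e_ k) Ti y.1) z.
  have := isd_val ((isd_mx _ _ _ _).2 (isd_diff (dx R l) (Phi2_diff Wz)) 0 i).
  move=> <-; apply: near_eq_derive; apply: filterS (open_nbhs_nbhs (conj oZ Wz)) => y Wy.
  rewrite (D1 _ _ Wy); exact: (derive_basis _ ((CTi 0).1 _ Wy)).
have h : is_derive z (dx R l) (fun y : V * V => \sum_k y.2 0 k * 'D_(e_ k) Ti y.1)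
    (\sum_k ((dx R l).2 0 k * 'D_(e_ k) Ti z.1 + z.2 0 k * 'D_(e_ l) ('D_(e_ k) Ti) z.1)).
  apply: isd_sum => k _; apply: isd_mul.
    exact: ((isd_mx _ _ _ _).2 (isd_snd_id z (dx R l)) 0 k).
  exact: (isd_fst (dx R l) ((CkS_derive (e_ k) (CTi 1)).1 _ Wz)).
apply: (etrans lhs); apply: (etrans (isd_val h)); apply: (etrans _ (esym rhs)).
apply: (etrans _ (esym (derive_basis z.2 ((CkS_derive (e_ l) (CTi 1)).1 _ Wz)))).
have key (A X B B' c : R) : A = 0 -> B = B' -> A * X + c * B = c * B' by move=> -> ->; rewrite mul0r add0r.
apply: eq_bigr => k _; apply: key; first by rewrite /= mxE.
exact: (derive_schwarz _ _ oW Wz (CTi 2)).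
Qed.

(* The second derivatives of [T] on both sides cancel by symmetry. *)
Lemma euler_lagrange_change z q : slit W z ->
  (forall w : V, exists y, 'D_y T z.1 = w) -> euler_lagrange L1 z q ->
  euler_lagrange L2 (Phi z) ('D_((z.2, q) : V * V) (fun z : V * V => 'D_(z.2) T z.1) z).
Proof.
move=> sz surj EL; have [Wz z0] := sz; set q' := 'D__ _ _.
have addE (A A' B B' : R) : A = A' -> B = B' -> A + B = A' + B' by move=> -> ->.
have mulE (A A' B : R) : A = A' -> A * B = A' * B by move=> ->.
have mul0E (A B : R) : A = 0 -> A * B = 0 by move=> ->; rewrite mul0r.
have add0E (A B : R) : A = 0 -> A + B = B by move=> ->; rewrite add0r.
have E1 (v : V * V) y : slit W y -> 'D_v (sqF L1) y = 'D_('D_v Phi y) (sqF L2) (Phi y).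
  move=> sy; rewrite -(isd_val (chain v sy.1 ((CE2 0).1 _ (PhiW2 sy)))).
  apply: near_eq_derive; apply: filterS (open_nbhs_nbhs (conj oS sy)) => y' sy'.
  by rewrite /sqF L1E.
have Dy l y : slit W y -> 'D_(dy R l) (sqF L1) y =
    \sum_m ('D_(e_ l) T y.1) 0 m * 'D_(dy R m) (sqF L2) (Phi y).
  move=> sy; apply: (etrans (E1 _ _ sy)); rewrite (derive_tangent_map _ sy.1).
  rewrite (isd_val (isd_directional oW CT (e_ l) sy.1)).
  apply: (etrans (derive_pair_sum _ _ ((CE2 0).1 _ (PhiW2 sy)))).
  apply: add0E; apply: big1 => k _; apply: mul0E.
  exact: (etrans (congr1 (fun v : V => v 0 k) (derive0 T y.1)) (mxE _ _ _ _)).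
have Dx l : 'D_(dx R l) (sqF L1) z = \sum_m ('D_(e_ l) T z.1) 0 m * 'D_(dx R m) (sqF L2) (Phi z)
    + \sum_m ('D_(z.2) ('D_(e_ l) T) z.1) 0 m * 'D_(dy R m) (sqF L2) (Phi z).
  apply: (etrans (E1 _ _ sz)); rewrite (derive_tangent_map _ Wz).
  apply: (etrans (derive_pair_sum _ _ ((CE2 0).1 _ (PhiW2 sz)))).
  apply: (addE _ _ _ _ (erefl _)); apply: eq_bigr => m _.
  exact: (mulE _ _ _ (Phi2_x l m Wz)).
have Dxi l : 'D_((z.2, q) : V * V) ('D_(dy R l) (sqF L1)) z =
    \sum_m (('D_(z.2) ('D_(e_ l) T) z.1) 0 m * 'D_(dy R m) (sqF L2) (Phi z) +
      ('D_(e_ l) T z.1) 0 m * 'D_(('D_(z.2) T z.1, q') : V * V) ('D_(dy R m) (sqF L2)) (Phi z)).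
  transitivity ('D_((z.2, q) : V * V) (fun y : V * V => \sum_m ('D_(e_ l) T y.1) 0 m * 'D_(dy R m) (sqF L2) (Phi y)) z).
    apply: near_eq_derive; apply: filterS (open_nbhs_nbhs (conj oS sz)) => y sy.
    exact: Dy.
  apply: isd_val; apply: isd_sum => m _; apply: isd_mul.
    exact: ((isd_mx _ _ _ _).2 (isd_fst ((z.2, q) : V * V) ((CkS_derive (e_ l) (CT 1)).1 _ Wz)) 0 m).
  have := chain ((z.2, q) : V * V) Wz ((CkS_derive (dy R m) (CE2 1)).1 _ (PhiW2 sz)).
  by rewrite derive_tangent_map.
pose r : V := \row_m ('D_(('D_(z.2) T z.1, q') : V * V) ('D_(dy R m) (sqF L2)) (Phi z) -
  'D_(dx R m) (sqF L2) (Phi z)).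
have rl l : dot ('D_(e_ l) T z.1) r = 0.
  have key (A B C : R) : B + A = C + B -> A - C = 0.
    by rewrite [C + B]addrC => /addrI ->; rewrite subrr.
  have E0 := etrans (esym (Dxi l)) (etrans (EL l) (Dx l)); rewrite big_split in E0.
  apply: (etrans _ (key _ _ _ E0)); rewrite -sumrB; apply: eq_bigr => m _.
  by rewrite -mulrBr [r 0 m]mxE.
(* [r], the difference of the two sides in the new chart, is orthogonal to the image of the Jacobian
   of [T], which is the whole space. *)
have r0 : r = 0.
  have [w hw] := surj r; apply/eqP; rewrite -dot_eq0; apply/eqP.
  rewrite -{1}hw (derive_basis _ ((CT 0).1 _ Wz)) dot_suml big1// => l _.
  by rewrite dotZl rl mulr0.
move=> l; apply/eqP; rewrite -subr_eq0; apply/eqP.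
by have := congr1 (fun v : V => v 0 l) r0; rewrite [LHS]mxE [RHS]mxE.
Qed.

End EulerLagrangeChange.

(** * Projective parameters *)

Section SchwarzianSolutions.
Variable R : realType.

Lemma derive1n_chain (B : set R) (p p1 p2 p3 : R -> R) : open B ->
  (forall s, B s -> is_derive s 1 p (p1 s)) -> (forall s, B s -> is_derive s 1 p1 (p2 s)) ->
  (forall s, B s -> is_derive s 1 p2 (p3 s)) -> forall s, B s ->
  (forall m, (m < 3)%N -> derivable (derive1n m p) s 1) /\
  [/\ derive1 p s = p1 s, derive1n 2 p s = p2 s & derive1n 3 p s = p3 s].
Proof.
move=> oB h1 h2 h3.
have nB s : B s -> \forall t \near s, B t by move=> Bs; exact: open_nbhs_nbhs.
have e1 s : B s -> derive1 p s = p1 s by move=> Bs; rewrite derive1E (isd_val (h1 s Bs)).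
have d2 s : B s -> is_derive s 1 (derive1 p) (p2 s).
  move=> Bs; apply: near_eq_is_derive (h2 s Bs); apply: filterS (nB s Bs) => t Bt.
  by rewrite e1.
have e2 s : B s -> derive1n 2 p s = p2 s.
  by move=> Bs; rewrite /derive1n/= derive1E (isd_val (d2 s Bs)).
have d3 s : B s -> is_derive s 1 (derive1n 2 p) (p3 s).
  move=> Bs; apply: near_eq_is_derive (h3 s Bs); apply: filterS (nB s Bs) => t Bt.
  by rewrite e2.
move=> s Bs; split; last first.
  split; [exact: e1|exact: e2|]; rewrite [LHS](derive1E (derive1n 2 p)).
  exact: (isd_val (d3 s Bs)).
case=> [|[|[|//]]] _.
- by case: (h1 s Bs).
- by case: (d2 s Bs).
- by case: (d3 s Bs).
Qed.

Lemma schwarzian_solution (K : R) : 0 <= K -> exists (p : R -> R) (e : R), 0 < e /\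
  forall s : R, `|s| < e -> [/\ forall m : nat, (m < 3)%N -> derivable (derive1n m p) s 1,
    derive1 p s != 0 & schwarzian p s = 2 * K].
Proof.
rewrite le_eqVlt => /predU1P[<-|K0].
  exists id, 1; split => // s _.
  have d1 t : [set: R] t -> is_derive t 1 (@id R) 1 by move=> _; exact: is_derive_id.
  have dc c t : [set: R] t -> is_derive t 1 (fun _ : R => c : R) 0 by move=> _; exact: is_derive_cst.
  have [h [e1 e2 e3]] := derive1n_chain openT d1 (dc 1) (dc 0) (I : [set: R] s).
  by split => //; rewrite /schwarzian e1 ?oner_neq0// e2 e3 !mul0r expr0n/= mulr0 subr0 mulr0.
pose w := Num.sqrt K; have w0 : 0 < w by rewrite sqrtr_gt0.
have wK : w ^+ 2 = K by rewrite sqr_sqrtr// ltW.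
pose C (s : R) : R := cos (w * s); pose S (s : R) : R := sin (w * s).
have dw (s : R) : is_derive s 1 (fun s : R => w * s) w.
  by have := isd_scale w (is_derive_id s (1 : R)); rewrite mulr1.
have dC (s : R) : is_derive s 1 C (- (w * S s)).
  have hh := is_derive1_comp (is_derive_cos (w * s)) (dw s).
  by apply: (is_derive_eq hh); rewrite /GRing.scale/= mulNr mulrC.
have dS (s : R) : is_derive s 1 S (w * C s).
  have hh := is_derive1_comp (is_derive_sin (w * s)) (dw s).
  by apply: (is_derive_eq hh); rewrite /GRing.scale/= mulrC.
have C0 : \forall s \near (0 : R), 0 < C s.
  have cC : {for (0 : R), continuous C}.
    by apply: differentiable_continuous; apply/derivable1_diffP; case: (dC 0).
  have C01 : C 0 = 1 by rewrite /C mulr0 cos0.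
  move/cvgrPdist_lt : cC => /(_ 1 ltr01); rewrite C01; apply: filterS => s.
  by rewrite ltr_norml => /andP[_]; rewrite -[ltRHS]subr0 ltrD2l ltrN2.
have /nbhs_ballP[e /= e0 he] := C0.
have CS s : S s ^+ 2 = 1 - C s ^+ 2 by rewrite /S sin2cos2.
exists (fun s => S s * (C s)^-1), e; split => // s se.
have inB t : ball (0 : R) e t -> C t != 0 by move=> /he Ct; rewrite gt_eqF.
have oB : open (ball (0 : R) e) by exact: ball_open.
have Bs : ball (0 : R) e s by rewrite /ball/= sub0r normrN.
have d1 t : ball (0 : R) e t -> is_derive t 1 (fun s => S s * (C s)^-1) (w * (C t ^+ 2)^-1).
  move=> /inB Ct; apply: (is_derive_eq (isd_mul (dS t) (isd_inv Ct (dC t)))).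
  rewrite opprK; transitivity ((w * (C t ^+ 2 + S t ^+ 2)) / C t ^+ 2); first by field.
  by rewrite CS addrC subrK mulr1.
have d2 t : ball (0 : R) e t -> is_derive t 1 (fun s => w * (C s ^+ 2)^-1)
    (2 * w ^+ 2 * (S t * (C t ^+ 3)^-1)).
  move=> /inB Ct; have C2 : C t ^+ 2 != 0 by rewrite expf_neq0.
  have := isd_scale w (@isd_inv _ _ (fun s => C s ^+ 2) _ _ _ C2 (isd_exp 2 (dC t))).
  move=> hh; apply: (is_derive_eq hh); rewrite /= expr1; field.
  exact: Ct.
have d3 t : ball (0 : R) e t -> is_derive t 1 (fun s => 2 * w ^+ 2 * (S s * (C s ^+ 3)^-1))
    (2 * w ^+ 2 * (w * (C t ^+ 2)^-1 + 3 * w * S t ^+ 2 * (C t ^+ 4)^-1)).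
  move=> /inB Ct; have C3 : C t ^+ 3 != 0 by rewrite expf_neq0.
  have := isd_scale (2 * w ^+ 2) (isd_mul (dS t) (@isd_inv _ _ (fun s => C s ^+ 3) _ _ _ C3 (isd_exp 3 (dC t)))).
  move=> hh; apply: (is_derive_eq hh); rewrite /=; field.
  exact: Ct.
have [h [e1 e2 e3]] := derive1n_chain oB d1 d2 d3 Bs.
have Cs := inB s Bs; have w1 : w != 0 by rewrite gt_eqF.
split => //; first by rewrite e1 mulf_neq0// invr_eq0 expf_neq0.
rewrite /schwarzian e1 e2 e3 -wK.
transitivity (2 * w ^+ 2 + 6 * w ^+ 2 * S s ^+ 2 / C s ^+ 2 - 6 * w ^+ 2 * S s ^+ 2 / C s ^+ 2); first by field; rewrite w1 Cs.
by rewrite addrK.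
Qed.

End SchwarzianSolutions.

Section RicciContraction.
Variables (R : realType) (n : nat).
Notation V := 'rV[R]_n.
Variables (U : set V) (a : V -> 'M[R]_n) (b : V -> V) (L : V * V -> R) (k : R).
Hypothesis HD : randers_data U a b L.
Hypothesis HE : forall z, slit U z -> ricci_scalar L z = k.
Let oS := open_slit HD.

Lemma fundamental_tensor_euler z : slit U z ->
  dot (z.2 *m fundamental_tensor L z) z.2 = sqF L z.
Proof.
move=> sz; have al0 : alpha b L z != 0 by rewrite gt_eqF// (alpha_gt0 HD).
rewrite (fundamental_tensorE HD sz); have := alpha_sqr HD sz.
have el : dot z.2 (ell a b L z) = L z.
  rewrite dotC /ell dotDl (dotZl (alpha b L z)^-1) -(alpha_sqr HD sz) expr2 mulKf//.
  by rewrite -(L_alpha b L z).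
have key (y et l : V) (A : 'M[R]_n) (al Lz : R) : al != 0 -> y *m A = et -> dot y l = Lz ->
    al ^+ 2 = dot et y -> dot (y *m (l^T *m l + (Lz / al) *: (A - al ^- 2 *: (et^T *m et)))) y = Lz ^+ 2.
  move=> al1 yA yl e; rewrite mulmxDr mulmxA row_mul_tr mul_scalar_mx -scalemxAr mulmxBr yA.
  rewrite -scalemxAr mulmxA row_mul_tr mul_scalar_mx dotDl !dotZl dotDl dotNl dotZl.
  by rewrite (dotZl (dot y et)) (dotC l) yl (dotC y et) -e; field.
by move=> e; exact: (key _ _ _ _ _ _ al0 (erefl _) el e).
Qed.

(** F^2 Ric equals k F^2 on an open set, so Ric_ij = k g_ij there, and Euler's identity for g
    concludes. *)
Lemma ricci_tensor_contraction z : slit U z ->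
  \sum_(i < n) \sum_(j < n) ricci_tensor L i j z * z.2 0 i * z.2 0 j = k * sqF L z.
Proof.
move=> sz; have CE m := Ck_sqF (k := m) oS (rd_CL HD m).
rewrite -fundamental_tensor_euler// dot_mulmxE mulr_sumr; apply: eq_bigr => i _.
rewrite mulr_sumr; apply: eq_bigr => j _.
suff -> : ricci_tensor L i j z = k * fundamental_tensor L z i j by rewrite !mulrA.
rewrite /ricci_tensor [in RHS]mxE mulrCA; congr (_ * _).
transitivity ('D_(dy R i) (fun w => k * 'D_(dy R j) (sqF L) w) z); last first.
  by apply: isd_val; apply: isd_scale; apply: isd_diff; exact: (CkS_derive (dy R j) (CE 1)).1.
apply: near_eq_derive; apply: filterS (open_nbhs_nbhs (conj oS sz)) => w sw.
transitivity ('D_(dy R j) (fun w => k * sqF L w) w); last first.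
  by apply: isd_val; apply: isd_scale; apply: isd_diff; exact: (CE 0).1.
apply: near_eq_derive; apply: filterS (open_nbhs_nbhs (conj oS sw)) => y sy.
by rewrite HE// mulrC.
Qed.

End RicciContraction.

(** * Geodesics within one chart *)

Section LocalGeodesic.
Variables (R : realType) (n : nat).
Notation V := 'rV[R]_n.
Notation e_ i := (delta_mx 0 i : V).
Variables (U : set V) (a : V -> 'M[R]_n) (b : V -> V) (L : V * V -> R).
Hypothesis HD : randers_data U a b L.
Let oS := open_slit HD.
Local Notation G := (Gspray a b L).
Local Notation g := (Gc a b L).

Lemma near_box (z0 : V * V) (P : set (V * V)) : (\forall z \near z0, P z) ->
  exists2 r : R, 0 < r & forall z : V * V,
    (forall i, `|z.1 0 i - z0.1 0 i| <= r) -> (forall i, `|z.2 0 i - z0.2 0 i| <= r) -> P z.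
Proof.
move=> /nbhs_ballP[e /= e0 he]; exists (e / 2); first by rewrite divr_gt0.
have lt t : t <= e / 2 -> t < e by move=> /le_lt_trans; apply; rewrite ltr_pdivrMr// ltr_pMr// ltr1n.
by move=> z h1 h2; apply: he; split; (split; first exact: e0) => i j; rewrite ord1 /ball/= distrC; apply: lt.
Qed.

(** A single continuous function, the sum of the squares of the spray coefficients and of their
    first derivatives, bounds all of them near [z0]. *)
Lemma spray_near_bounded z0 : slit U z0 -> exists (r B : R), [/\ 0 < r, 0 <= B & forall z : V * V,
  (forall i, `|z.1 0 i - z0.1 0 i| <= r) -> (forall i, `|z.2 0 i - z0.2 0 i| <= r) ->
  slit U z /\ forall i, `|g i z| <= B /\ forall k, `|'D_(dx R k) (g i) z| <= B /\ `|'D_(dy R k) (g i) z| <= B].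
Proof.
move=> sz; pose f z := \sum_i (g i z ^+ 2 + \sum_k ('D_(dx R k) (g i) z ^+ 2 + 'D_(dy R k) (g i) z ^+ 2)).
have sq (h : V * V -> R) : Ck 0 (slit U) h -> Ck 0 (slit U) (fun z => h z ^+ 2).
  by move=> Ch; apply: (Ck_ext oS _ (Ck_mul oS Ch Ch)) => z _; rewrite expr2.
have Cf : Ck 0 (slit U) f.
  apply: (Ck_sum oS) => i _; have Cg k := Ck_Gc HD k i.
  apply: (Ck_add oS (sq _ (Cg 0))); apply: (Ck_sum oS) => k _.
  exact: (Ck_add oS (sq _ (CkS_derive (dx R k) (Cg 1))) (sq _ (CkS_derive (dy R k) (Cg 1)))).
have hb := continuous_near_bounded (Ck_continuous Cf sz).
have hs : \forall z \near z0, slit U z by exact: open_nbhs_nbhs (conj oS sz).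
have [r r0 hr] := near_box (filterI hb hs); set B := `|f z0| + 1 in hr.
have B0 : 0 <= B by rewrite addr_ge0.
exists r, (1 + B); split => //; first by rewrite addr_ge0.
move=> z h1 h2; have [fB sz'] := hr z h1 h2; split => // i.
have q0 j l : 0 <= 'D_(dx R l) (g j) z ^+ 2 + 'D_(dy R l) (g j) z ^+ 2 by rewrite addr_ge0// sqr_ge0.
have s0 j : 0 <= \sum_k ('D_(dx R k) (g j) z ^+ 2 + 'D_(dy R k) (g j) z ^+ 2) by apply: sumr_ge0.
have fi : g i z ^+ 2 + \sum_k ('D_(dx R k) (g i) z ^+ 2 + 'D_(dy R k) (g i) z ^+ 2) <= B.
  apply: le_trans (le_trans (ler_norm _) fB); rewrite /f [leRHS](bigD1 i)//= lerDl.
  by apply: sumr_ge0 => j _; rewrite addr_ge0// sqr_ge0.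
have sb (x : R) : x ^+ 2 <= B -> `|x| <= 1 + B.
  move=> h; rewrite -real_normK ?num_real// in h; move: h (normr_ge0 x); move: (`|x|) => y h y0.
  by have [y1|y1] := lerP y 1; [rewrite (le_trans y1)// lerDl|nra].
have two_sqr (x y : R) : x ^+ 2 + y ^+ 2 <= B -> x ^+ 2 <= B /\ y ^+ 2 <= B.
  by move=> h; split; apply: (le_trans _ h); rewrite ?lerDl ?lerDr sqr_ge0.
split; first by apply: sb; apply: le_trans fi; rewrite lerDl.
move=> k; have fk : 'D_(dx R k) (g i) z ^+ 2 + 'D_(dy R k) (g i) z ^+ 2 <= B.
  apply: le_trans fi; rewrite [X in _ <= _ + X](bigD1 k)//= addrCA lerDl.
  by rewrite addr_ge0// ?sqr_ge0//; apply: sumr_ge0.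
by have [k1 k2] := two_sqr _ _ fk; split; [exact: (sb _ k1)|exact: (sb _ k2)].
Qed.

(** Mean value theorem on a segment, which stays in the box by convexity; 2 n is the number of
    partial derivatives. *)
Lemma spray_lipschitz (z0 z z' : V * V) (r B e : R) i : 0 <= B ->
  (forall z : V * V, (forall i, `|z.1 0 i - z0.1 0 i| <= r) -> (forall i, `|z.2 0 i - z0.2 0 i| <= r) ->
    slit U z /\ forall i, `|g i z| <= B /\ forall k, `|'D_(dx R k) (g i) z| <= B /\ `|'D_(dy R k) (g i) z| <= B) ->
  (forall i, `|z.1 0 i - z0.1 0 i| <= r) -> (forall i, `|z.2 0 i - z0.2 0 i| <= r) ->
  (forall i, `|z'.1 0 i - z0.1 0 i| <= r) -> (forall i, `|z'.2 0 i - z0.2 0 i| <= r) ->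
  (forall i, `|z.1 0 i - z'.1 0 i| <= e) -> (forall i, `|z.2 0 i - z'.2 0 i| <= e) ->
  `|g i z - g i z'| <= 2 * n%:R * B * e.
Proof.
move=> B0 hb z1 z2 z1' z2' e1 e2; pose v := z - z'.
have conv (x y c t : R) : `|x - c| <= r -> `|y - c| <= r -> 0 <= t <= 1 -> `|y + t * (x - y) - c| <= r.
  move=> hx hy /andP[t0 t1]; have -> : y + t * (x - y) - c = t * (x - c) + (1 - t) * (y - c) by ring.
  have t1' : 0 <= 1 - t by rewrite subr_ge0.
  apply: (le_trans (ler_normD _ _)); rewrite !normrM (ger0_norm t0) (ger0_norm t1').
  rewrite [leRHS](_ : r = t * r + (1 - t) * r); last by ring.
  exact: lerD (ler_wpM2l t0 hx) (ler_wpM2l t1' hy).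
have box t : 0 <= t <= 1 -> slit U (z' + t *: v) /\ forall i, `|g i (z' + t *: v)| <= B /\
    forall k, `|'D_(dx R k) (g i) (z' + t *: v)| <= B /\ `|'D_(dy R k) (g i) (z' + t *: v)| <= B.
  by move=> t01; apply: hb => j; rewrite !mxE; exact: conv.
have [|t /andP[t0 t1] E] := @line_MVT R (V * V)%type (g i) z' v.
  by move=> t t01; exact: (Ck_Gc HD 0 i).1 _ (box t t01).1.
have t01 : 0 <= t <= 1 by rewrite !ltW.
have [sx bx] := box t t01; have [_ bk] := bx i.
have zE : z = z' + v by rewrite /v addrC subrK.
rewrite {1}zE E (_ : v = (v.1, v.2)); last by case: (v).
rewrite (derive_pair_sum _ _ ((Ck_Gc HD 0 i).1 _ sx)).
have sum_bound (w : V) (D : 'I_n -> R) : (forall k, `|w 0 k| <= e) -> (forall k, `|D k| <= B) ->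
    `|\sum_k w 0 k * D k| <= n%:R * (B * e).
  move=> hw hD; apply: (le_trans (ler_norm_sum _ _ _)).
  apply: (@le_trans _ _ (\sum_(k < n) B * e)); last by rewrite sumr_const card_ord mulr_natl.
  by apply: ler_sum => k _; rewrite normrM mulrC ler_pM.
apply: (le_trans (ler_normD _ _)).
have -> : 2 * n%:R * B * e = n%:R * (B * e) + n%:R * (B * e) by ring.
apply: lerD; apply: sum_bound => k.
- by rewrite /v /= !mxE.
- exact: (bk k).1.
- by rewrite /v /= !mxE.
- exact: (bk k).2.
Qed.

Lemma local_geodesic z0 : slit U z0 -> exists (u w : R -> V) (e : R),
  [/\ 0 < e, u 0 = z0.1, w 0 = z0.2 & forall t, `|t| < e ->
    [/\ slit U (u t, w t), is_derive t 1 u (w t) & is_derive t 1 w (- (2 *: G (u t, w t)))]].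
Proof.
move=> sz; have [r [B [r0 B0 hb]]] := spray_near_bounded sz.
(* The geodesic equation as a first-order system: the left copy of the indices carries positions,
   the right one velocities. *)
pose I := ('I_n + 'I_n)%type; pose toz (s : I -> R) : V * V := (\row_i s (inl i), \row_i s (inr i)).
pose f (s : I -> R) (i : I) : R := match i with inl i => s (inr i) | inr i => - (2 * g i (toz s)) end.
pose s0 (i : I) : R := match i with inl i => z0.1 0 i | inr i => z0.2 0 i end.
pose Y := \sum_i `|z0.2 0 i|; have Y0 : 0 <= Y by apply: sumr_ge0.
have n0 : 0 <= 2 * n%:R * B by rewrite !mulr_ge0// ler0n.
have tb s : (forall i, `|s i - s0 i| <= r) -> (forall i, `|(toz s).1 0 i - z0.1 0 i| <= r) /\
    (forall i, `|(toz s).2 0 i - z0.2 0 i| <= r).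
  by move=> hs; split => i; rewrite mxE; [exact: (hs (inl i))|exact: (hs (inr i))].
(* [r + Y] bounds the velocities in the box and [2 * B] the accelerations; the Lipschitz constant is
   1 for the first half of the system plus that of 2 G for the second. *)
have [|||||u [e e0 [u0 hu]]] := @picard_lindelof R I f s0 r (r + Y + 2 * B) (1 + 2 * (2 * n%:R * B)).
- exact: r0.
- by rewrite !addr_ge0 ?mulr_ge0// ltW.
- by rewrite addr_ge0 ?mulr_ge0.
- move=> s bs [i|i] /=.
    have := bs (inr i); rewrite /s0 => h; have -> : s (inr i) = (s (inr i) - z0.2 0 i) + z0.2 0 i by ring.
    apply: (le_trans (ler_normD _ _)); rewrite -addrA lerD//.
    apply: (@le_trans _ _ Y); last by rewrite lerDl mulr_ge0.
    by rewrite /Y (bigD1 i)//= lerDl sumr_ge0.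
  have [t1 t2] := tb s bs; have [_ /(_ i)[gB _]] := hb _ t1 t2.
  rewrite normrN normrM (ger0_norm (ler0n R 2)); apply: (le_trans (ler_wpM2l (ler0n R 2) gB)).
  by rewrite lerDr addr_ge0// ltW.
- move=> s s' d bs bs' hd [i|i] /=.
    have d0 : 0 <= d by exact: le_trans (hd (inr i)).
    by apply: (le_trans (hd (inr i))); rewrite ler_peMl// lerDl mulr_ge0.
  have [t1 t2] := tb s bs; have [t1' t2'] := tb s' bs'.
  have d0 : 0 <= d by exact: le_trans (hd (inr i)).
  have gl : `|g i (toz s) - g i (toz s')| <= 2 * n%:R * B * d.
    by apply: (spray_lipschitz i B0 hb t1 t2 t1' t2') => j; rewrite !mxE; exact: hd.
  have key (p q : R) : `|- (2 * p) - - (2 * q)| = 2 * `|p - q|.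
    have -> : - (2 * p) - - (2 * q) = - (2 * (p - q)) by ring.
    by rewrite normrN normrM (ger0_norm (ler0n R 2)).
  rewrite key; apply: (le_trans (ler_wpM2l (ler0n R 2) gl)).
  rewrite [leRHS](_ : _ = d + 2 * (2 * n%:R * B * d)); last by ring.
  by rewrite lerDr.
exists (fun t => (toz (u t)).1), (fun t => (toz (u t)).2), e; split => //.
- by rewrite u0; apply/rowP => i; rewrite mxE.
- by rewrite u0; apply/rowP => i; rewrite mxE.
move=> t te; have [bu du] := hu t te; have [t1 t2] := tb _ bu.
have [st _] := hb _ t1 t2; split; first by move: st; case: (toz (u t)).
- apply/isd_mx => k i; rewrite (_ : (fun z => _) = (fun s => u s (inl i))).
    by rewrite [X in is_derive _ _ _ X]mxE; exact: du (inl i).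
  by apply/funext => s; rewrite mxE.
apply/isd_mx => k i; rewrite (_ : (fun z => _) = (fun s => u s (inr i))); last first.
  by apply/funext => s; rewrite mxE.
have lin (X : V) : - (2 * X 0 i) = (- (2 *: X)) 0 i by rewrite !mxE.
by apply: (is_derive_eq (du (inr i))); rewrite ord1; exact: lin.
Qed.

(** Euler's identity reads 2 F^2 = y^m (F^2)_{y^m}. Differentiating it along a solution of the
    Euler-Lagrange equation shows that the derivative D of F^2 satisfies 2 D = D. *)
Lemma speed_constant (u w : R -> V) (e : R) : 0 < e ->
  (forall t, `|t| < e ->
    [/\ slit U (u t, w t), is_derive t 1 u (w t) & is_derive t 1 w (- (2 *: G (u t, w t)))]) ->
  forall t, `|t| < e -> L (u t, w t) = L (u 0, w 0).
Proof.
move=> e0 H; pose gam t : V * V := (u t, w t); have CE k := Ck_sqF (k := k) oS (rd_CL HD k).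
have chain (f : V * V -> R) t : `|t| < e -> differentiable f (gam t) ->
    is_derive t 1 (fun s => f (gam s)) ('D_((w t, - (2 *: G (gam t))) : V * V) f (gam t)).
  move=> te df; have [st du dw] := H t te.
  have d1 : differentiable u t by apply/derivable1_diffP; case: du.
  have d2 : differentiable w t by apply/derivable1_diffP; case: dw.
  have dg := differentiable_pair d1 d2; apply: (isd_comp dg df).
  rewrite (deriveE _ dg) (diff_pair d1 d2).
  have e1 := etrans (esym (deriveE (1 : R) d1)) (isd_val du).
  have e2 := etrans (esym (deriveE (1 : R) d2)) (isd_val dw).
  exact: (congr2 pair e1 e2).
have dE (t : R) : `|t| < e -> is_derive t 1 (fun s => sqF L (gam s)) 0.
  move=> te; have [st du dw] := H t te.
  have h1 := chain (sqF L) t te ((CE 0).1 _ st); set D : R := 'D__ _ _ in h1.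
  have h2 : is_derive t 1 (fun s => \sum_m w s 0 m * 'D_(dy R m) (sqF L) (gam s))
     (\sum_m ((- (2 *: G (gam t))) 0 m * 'D_(dy R m) (sqF L) (gam t) +
        w t 0 m * 'D_(dx R m) (sqF L) (gam t))).
    apply: isd_sum => m _; apply: isd_mul; first exact: ((isd_mx _ _ _ _).2 dw 0 m).
    have hh := chain ('D_(dy R m) (sqF L)) t te ((CkS_derive (dy R m) (CE 1)).1 _ st).
    have EL : euler_lagrange L (gam t) (- (2 *: G (gam t))).
      apply/(euler_lagrange_spray HD _ st) => i; rewrite (sprayE HD i st).
      by move: (G (gam t)) => X; rewrite !mxE addNr.
    by apply: (is_derive_eq hh); exact: (EL m).
  have h3 : is_derive t 1 (fun s => 2 * sqF L (gam s)) D.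
    have ED : D = \sum_m ((- (2 *: G (gam t))) 0 m * 'D_(dy R m) (sqF L) (gam t) +
        w t 0 m * 'D_(dx R m) (sqF L) (gam t)).
      apply: (etrans (derive_pair_sum _ _ ((CE 0).1 _ st))); rewrite -big_split.
      by apply: eq_bigr => m _; exact: addrC.
    rewrite ED; apply: near_eq_is_derive h2.
    have nt : nbhs t (ball t (e - `|t|)) by apply: nbhsx_ballx; rewrite subr_gt0.
    apply: filterS nt => s; rewrite /ball/= => hs.
    have se : `|s| < e.
      have -> : s = t - (t - s) by ring.
      by apply: (le_lt_trans (ler_normB _ _)); rewrite -ltrBrDl.
    have [ss _ _] := H s se; have := derive_sqF_euler HD ss.
    rewrite (derive_pair_sum _ _ ((CE 0).1 _ ss)) => <- /=.
    rewrite [X in X + _]big1 ?add0r// => m _; by rewrite mxE mul0r.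
  have := isd_val h3; rewrite (isd_val (isd_scale 2 h1)) => E.
  have twice (x : R) : 2 * x = x -> x = 0 by move=> hx; have -> : x = 2 * x - x by [ring]; rewrite hx subrr.
  have D0 : D = 0 := twice _ E.
  by rewrite D0 in h1.
move=> t te; have hs (s : R) : `|s| <= `|t| -> `|s| < e by move=> /le_lt_trans; apply.
have z0 : `|0 : R| <= `|t| by rewrite normr0.
have bz (s : R) : `|s| <= `|t| -> `|0 : R| <= 0 by rewrite normr0.
have := mvt_bound (fun s ss => dE s (hs s ss)) bz (lexx `|t|) z0.
rewrite mul0r normr_le0 subr_eq0 /sqF => E.
by apply/eqP; rewrite -(eqrXn2 (n := 2)) ?(rd_ge0 HD).
Qed.

End LocalGeodesic.

(** * Geodesics and projective parameters on the manifold *)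

Section GlobalGeodesic.
Variables (R : realType) (n : nat) (M : topologicalType) (A : smooth_atlas R n M).
Notation V := 'rV[R]_n.
Variables (F : tangent_vector A -> R) (a : atlas_index A -> V -> 'M[R]_n)
  (b : atlas_index A -> V -> V).
Hypothesis HD : forall c, randers_data (chart_cod (A c)) (a c) (b c) (in_chart F c).

Lemma open_overlap c d :
  open (chart_map (A c) @` (chart_dom (A c) `&` chart_dom (A d))).
Proof.
rewrite openE => _ [p [pc pd] <-].
have h1 : nbhs (chart_map (A c) p) (chart_cod (A c)).
  by apply: open_nbhs_nbhs; split; [exact: chart_cod_open|exists p].
have h2 : nbhs (chart_map (A c) p) (chart_inv (A c) @^-1` chart_dom (A d)).
  apply: (chart_inv_cont pc); rewrite chart_mapK//.
  by apply: open_nbhs_nbhs; split => //; exact: chart_dom_open.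
rewrite /interior; apply: filterS2 h1 h2 => _ [q qc <-] /=; rewrite chart_mapK// => qd.
by exists q.
Qed.

Lemma tangent_map_slit c d z :
  slit (chart_map (A c) @` (chart_dom (A c) `&` chart_dom (A d))) z ->
  in_chart F c z = in_chart F d (tangent_map (transition (A c) (A d)) z) /\
  slit (chart_cod (A d)) (tangent_map (transition (A c) (A d)) z).
Proof.
case: z => x y [/= [p [pc pd] <-] y0]; rewrite /tangent_map/=.
have Tp : transition (A c) (A d) (chart_map (A c) p) = chart_map (A d) p.
  by rewrite /transition/= chart_mapK.
have E := in_chart_change F y pc pd; rewrite Tp; split; first exact: E.
split; first by exists p.
have sz : slit (chart_cod (A c)) (chart_map (A c) p, y) by split => //; exists p.
(* F has the same value in both charts, so a zero image would contradict [L_neq0] in the first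
   chart. *)
apply: contraNneq (L_neq0 (HD c) sz) => /= D0.
have cd : chart_cod (A d) (chart_map (A d) p) by exists p.
by rewrite E D0 (rd_LE (HD d) _ cd) mul0mx !dot0r sqrtr0 addr0.
Qed.

(** The curve is built in the chart [c] alone; in any other chart its equation follows by passing
    from the spray to the Euler-Lagrange equation, changing coordinates and passing back. The last
    clause, nonzero velocity in every chart, is what the contraction of the Ricci tensor
    requires. *)
Lemma arclength_geodesic_exists c z0 : slit (chart_cod (A c)) z0 -> in_chart F c z0 = 1 ->
  exists (e : R) (g : R -> M), [/\ 0 < e, arclength_geodesic F [set s | `|s| < e] g &
    forall s, `|s| < e -> forall d, chart_dom (A d) (g s) ->
      let v : R -> V := chart_map (A d) \o g in slit (chart_cod (A d)) (v s, derive1 v s)].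
Proof.
move=> sz0 L0; have [u [w [e [e0 u0 w0 H]]]] := local_geodesic (HD c) sz0.
have L1 t : `|t| < e -> in_chart F c (u t, w t) = 1.
  move=> te; rewrite (speed_constant (HD c) e0 H te) u0 w0 -L0; by case: (z0).
have nJ (s : R) : `|s| < e -> \forall t \near s, `|t| < e.
  move=> se; have ns : nbhs s (ball s (e - `|s|)) by apply: nbhsx_ballx; rewrite subr_gt0.
  apply: filterS ns => t; rewrite /ball/= => ht; have -> : t = s - (s - t) by ring.
  by apply: (le_lt_trans (ler_normB _ _)); rewrite -ltrBrDl.
pose g s := chart_inv (A c) (u s); exists e, g.
have diff_u (t : R) : `|t| < e -> differentiable u t.
  by move=> te; have [_ du _] := H t te; apply/derivable1_diffP; case: du.
have diff_w (t : R) : `|t| < e -> differentiable w t.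
  by move=> te; have [_ _ dw] := H t te; apply/derivable1_diffP; case: dw.
have main (s : R) (d : atlas_index A) : `|s| < e -> chart_dom (A d) (g s) ->
    let v : R -> V := chart_map (A d) \o g in
    [/\ derivable v s 1, derivable (derive1 v) s 1,
      slit (chart_cod (A d)) (v s, derive1 v s),
      in_chart F d (v s, derive1 v s) = 1 &
      forall i, derive1n 2 v s 0 i + 2 * spray (in_chart F d) i (v s, derive1 v s) = 0].
  move=> se gd v; set W := chart_map (A c) @` (chart_dom (A c) `&` chart_dom (A d)).
  have oW : open W by exact: open_overlap.
  pose T := transition (A c) (A d).
  have CT k : Ck k W T by apply: smooth_on_Ck; exact: atlas_smooth.
  have Wu : W (u s).
    have [[/= [p pc pe] _] _ _] := H s se; exists p; rewrite ?pe//; split => //.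
    by move: gd; rewrite /g -pe chart_mapK.
  have nW : \forall t \near s, `|t| < e /\ W (u t).
    have h1 := differentiable_continuous (diff_u s se) (open_nbhs_nbhs (conj oW Wu)).
    by apply: filterS2 (nJ s se) h1.
  have dv (t : R) : `|t| < e -> W (u t) -> is_derive t 1 v ('D_(w t) T (u t)).
    move=> te Wt; have [_ du _] := H t te.
    exact: (isd_comp (diff_u t te) ((CT 0).1 _ Wt) (isd_val du)).
  have dvE (t : R) : `|t| < e -> W (u t) -> derive1 v t = 'D_(w t) T (u t).
    by move=> te Wt; rewrite derive1E (isd_val (dv t te Wt)).
  pose z := (u s, w s); pose q := - (2 *: Gspray (a c) (b c) (in_chart F c) z).
  pose Phi2 := fun y : V * V => 'D_(y.2) T y.1.
  have [sz du dw] := H s se; have szW : slit W z by split => //; case: sz.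
  have dv2 : is_derive s 1 (derive1 v) ('D_((z.2, q) : V * V) Phi2 z).
    have dg := differentiable_pair (diff_u s se) (diff_w s se).
    have Dg : 'D_1 (fun t => (u t, w t)) s = (z.2, q) :> V * V.
      rewrite (deriveE _ dg) (diff_pair (diff_u s se) (diff_w s se)).
      have e1 := etrans (esym (deriveE (1 : R) (diff_u s se))) (isd_val du).
      have e2 := etrans (esym (deriveE (1 : R) (diff_w s se))) (isd_val dw).
      exact: (congr2 pair e1 e2).
    have dP : differentiable Phi2 (u s, w s) := (Ck_directional oW CT 0).1 (u s, w s) Wu.
    have hh := isd_comp dg dP Dg; apply: near_eq_is_derive hh.
    apply: filterS nW => t [te Wt]; rewrite (dvE t te Wt); exact: erefl.
  have zE : (v s, derive1 v s) = tangent_map T z by rewrite (dvE s se Wu).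
  have [LE sl] := tangent_map_slit szW.
  split; first by case: (dv s se Wu).
  - by case: dv2.
  - by rewrite zE.
  - by rewrite zE -LE; exact: L1.
  have v2 : derive1n 2 v s = 'D_((z.2, q) : V * V) Phi2 z.
    by rewrite [LHS](derive1E (derive1 v)) (isd_val dv2).
  rewrite zE v2; apply/(euler_lagrange_spray (HD d) _ sl).
  apply: (@euler_lagrange_change R n W T (slit (chart_cod (A d))) (in_chart F c) (in_chart F d)
    oW CT (open_slit_set oW) (open_slit (HD d)) (rd_CL (HD d))).
  - by move=> y /tangent_map_slit[].
  - by move=> y /tangent_map_slit[].
  - exact: szW.
  - by case: Wu => p [pc pd] pe y; rewrite /= -pe; exact: transition_surj.
  apply/(euler_lagrange_spray (HD c) _ sz) => i; rewrite (sprayE (HD c) i sz).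
  by rewrite /q -/z; move: (Gspray _ _ _ _) => X; rewrite !mxE addNr.
split => //; last by move=> s se d gd /=; have [_ _ h _ _] := main s d se gd.
split.
- have -> : [set s : R | `|s| < e] = ball (0 : R) e; last exact: ball_open.
  by apply/seteqP; split => s; rewrite /ball/= sub0r normrN.
- move=> x y /= xe ye t /andP[xt ty]; move: xe ye; rewrite !ltr_norml => /andP[h1 _] /andP[_ h2].
  by apply/andP; split; [exact: lt_le_trans xt|exact: le_lt_trans ty h2].
move=> s /= se; split.
  have [[/= [p pc pe] _] _ _] := H s se.
  have cu : {for s, continuous u} := differentiable_continuous (diff_u s se).
  apply: (@continuous_comp _ _ _ u (chart_inv (A c)) s cu).
  by rewrite -pe; exact: chart_inv_cont.
by move=> d gd; have [h1 h2 _ h3 h4] := main s d se gd.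
Qed.

Hypothesis n2 : (2 <= n)%N.
Variable K : R.
Hypothesis HE : forall c z, slit (chart_cod (A c)) z ->
  ricci_scalar (in_chart F c) z = (n%:R - 1) * K.

Lemma projective_parameter_exists c z0 : slit (chart_cod (A c)) z0 -> 0 <= K ->
  exists (J : set R) (g : R -> M) (p : R -> R), [/\ arclength_geodesic F J g,
    projective_parameter F J g p, J 0 & schwarzian p 0 = 2 * K].
Proof.
move=> sz K0; have [Uz y0] := sz.
have Lz : 0 < in_chart F c z0 by rewrite lt_neqAle eq_sym (L_neq0 (HD c) sz) (rd_ge0 (HD c)).
(* Positive homogeneity rescales the initial velocity to F = 1, so that the parameter is arc
   length. *)
pose l := (in_chart F c z0)^-1; have l0 : 0 < l by rewrite invr_gt0.
pose z1 : V * V := (z0.1, l *: z0.2).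
have sz1 : slit (chart_cod (A c)) z1 := slit_scale sz l0.
have Lz1 : in_chart F c z1 = 1.
  have h1 := alpha_hom (HD c) sz l0; have h2 := L_alpha (b c) (in_chart F c) z1.
  rewrite h2 h1 /= dotZr -mulrDr -(L_alpha (b c) (in_chart F c) z0) /l mulVf//.
  by rewrite gt_eqF.
have [e [g [e0 geo sl]]] := arclength_geodesic_exists sz1 Lz1.
(* With F = 1 along the geodesic, the prescribed Schwarzian is the constant 2 K, so one function [p]
   serves for every geodesic. *)
have [p [e' [e'0 hp]]] := schwarzian_solution K0.
pose d := Num.min e e'; have d0 : 0 < d by rewrite lt_min e0.
have de (s : R) : `|s| < d -> `|s| < e by rewrite lt_min => /andP[].
have de' (s : R) : `|s| < d -> `|s| < e' by rewrite lt_min => /andP[].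
exists [set s | `|s| < d], g, p; split.
- have [_ _ h] := geo; split.
  + have -> : [set s : R | `|s| < d] = ball (0 : R) d; last exact: ball_open.
    by apply/seteqP; split => s; rewrite /ball/= sub0r normrN.
  + move=> x y /= xe ye t /andP[xt ty]; move: xe ye; rewrite !ltr_norml => /andP[h1 _] /andP[_ h2].
    by apply/andP; split; [exact: lt_le_trans xt|exact: le_lt_trans ty h2].
  by move=> s /= /de; exact: h.
- move=> s /= sd; have [h1 h2 h3] := hp s (de' s sd); split => //.
  move=> c' gc'; rewrite /= h3; have svs := sl s (de s sd) c' gc'.
  have [_ _ /(_ s (de s sd))[_ /(_ c' gc')[_ _ L1 _]]] := geo.
  have := ricci_tensor_contraction (HD c') (HE (c := c')) svs; rewrite /sqF L1 expr1n mulr1 /= => ->.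
  have N0 : (n%:R - 1 : R) != 0 by rewrite gt_eqF// (N_gt0 R n2).
  by rewrite mulrA divfK.
- by rewrite /= normr0.
by have [] := hp 0 _ => //; rewrite normr0.
Qed.

End GlobalGeodesic.

Theorem theorem1p5 (R : realType) (n : nat) (M : topologicalType)
    (A : smooth_atlas R n M) (F : tangent_vector A -> R) (K : M -> R) :
  (2 <= n)%N ->
  hausdorff_space M -> @second_countable M ->
  connected [set: M] -> compact [set: M] ->
  randers_metric F ->
  einstein F K -> (forall p q : M, K p = K q) ->
  (schwarzian_along_geodesics F (fun r => r = 0) -> berwaldian F) /\
  (schwarzian_along_geodesics F (fun r => r < 0) -> riemannian F).
Proof.
move=> n2 _ _ cM kM RF EF Kcst.
have [alpha [beta [a [b hab]]]] := randers_charts RF.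
have HD c : randers_data (chart_cod (A c)) (a c) (b c) (in_chart F c) by case: (hab c).
have betaE c x y : chart_cod (A c) x -> in_chart beta c (x, y) = dot (b c x) y.
  by move=> cx; case: (hab c) => _ h _; exact: h.
have alphaE c x y : chart_cod (A c) x -> in_chart alpha c (x, y) = Num.sqrt (dot (y *m a c x) y).
  by move=> cx; case: (hab c) => _ _ h; exact: h.
have ric p c z : slit (chart_cod (A c)) z -> ricci_scalar (in_chart F c) z = (n%:R - 1) * K p.
  by move=> sz; rewrite (EF c z sz) (Kcst _ p).
have riem p c z : slit (chart_cod (A c)) z ->
    \sum_i riemann_curvature (in_chart F c) i i z = (n%:R - 1) * K p * in_chart F c z ^+ 2.
  move=> sz; rewrite -(ric p c z sz) /ricci_scalar /sqF divfK// expf_neq0//.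
  exact: (L_neq0 (HD c) sz).
split=> hS c x y y'; [move=> i j k|] => sy sy'; pose p0 := chart_inv (A c) x.
  (* The sign of the constant is decided by one geodesic, started in the direction of the nonzero
     vector [y]; [p0] merely provides a point at which to read [K]. *)
  have K0 : K p0 <= 0.
    rewrite leNgt; apply/negP => K0.
    have [J [g [p [geo pp J0 Sp]]]] := projective_parameter_exists HD n2 (ric p0) sy (ltW K0).
    have := hS J g p geo pp 0 J0; rewrite Sp => /eqP; rewrite mulf_eq0 pnatr_eq0/=.
    by rewrite gt_eqF.
  have [m hm] := bnorm2_global HD betaE alphaE n2 cM kM K0 (riem p0).
  rewrite (berwald_coef_rigid (HD c) n2 (riem p0 c) K0 (hm c) i j k sy).
  by rewrite (berwald_coef_rigid (HD c) n2 (riem p0 c) K0 (hm c) i j k sy').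
have K0 : K p0 < 0.
  rewrite ltNge; apply/negP => K0.
  have [J [g [p [geo pp J0 Sp]]]] := projective_parameter_exists HD n2 (ric p0) sy K0.
  by have := hS J g p geo pp 0 J0; rewrite Sp ltNge mulr_ge0.
have [m hm] := bnorm2_global HD betaE alphaE n2 cM kM (ltW K0) (riem p0).
rewrite (fundamental_tensor_rigid (HD c) n2 (riem p0 c) (ltW K0) (hm c) K0 sy).
by rewrite (fundamental_tensor_rigid (HD c) n2 (riem p0 c) (ltW K0) (hm c) K0 sy').
Qed.
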